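(* Let $\chi$ be a non-trivial Dirichlet character modulo $q$ (any $q$), and let $\eta(s)$ be the entire function equal to $\sum_{n\ge1}(-1)^{n-1}n^{-s}$ for $\Re s>0$. For $\Re s_0>-1$ and $s\in\mathbb{C}$, $$L(s+s_0,\chi)=\frac{1}{\Gamma(s_0+1)}\sum_{m=0}^\infty(m+1)\left(\int_0^\infty\frac{x^{s_0}e^{-x(m+1)}}{(1+e^{-x})^{m+2}}\,dx\right)\sum_{j=0}^m\frac{\chi(j+1)\binom{m}{j}}{(j+1)^s},$$ and for all $s_0,s\in\mathbb{C}$, $$L(s+s_0,\chi)=\sum_{m=0}^\infty\frac{(-1)^m}{m!}\sum_{l=1}^{m+1}s(m+1,l)\,\eta(s_0+1-l)\sum_{j=0}^m\frac{\chi(j+1)\binom{m}{j}}{(j+1)^s}.$$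
   Context: $L(s,\chi)$ is the Dirichlet $L$-function, analytically continued to $\mathbb{C}$. $s(m+1,l)$ are the (signed) Stirling numbers of the first kind, defined by $x(x-1)\cdots(x-m)=\sum_l s(m+1,l)x^l$. *)

(* Defs.v *)
From Stdlib Require Import Reals ZArith Znumtheory.
From Coquelicot Require Import Coquelicot.
Open Scope R_scope.
Open Scope C_scope.

Definition cexp (z : C) : C :=
  ((exp (Re z) * cos (Im z))%R, (exp (Re z) * sin (Im z))%R).

Definition cpow (x : R) (z : C) : C := cexp (RtoC (ln x) * z).

Definition entire (f : C -> C) : Prop := forall z : C, ex_derive f z.

(* Dirichlet character modulo q (q >= 1), as a function on positive integers
   (indexed by nat; the value at 0 is irrelevant but forced to be chi(q)). *)
Definition dirichlet_character (q : nat) (chi : nat -> C) : Prop :=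
  (1 <= q)%nat /\
  (forall n, chi (n + q)%nat = chi n) /\
  (forall m n, chi (m * n)%nat = chi m * chi n) /\
  chi 1%nat = 1 /\
  (forall n, chi n = 0 <-> Z.gcd (Z.of_nat n) (Z.of_nat q) <> 1%Z).

Definition nontrivial_character (q : nat) (chi : nat -> C) : Prop :=
  exists n, Z.gcd (Z.of_nat n) (Z.of_nat q) = 1%Z /\ chi n <> 1.

Definition is_L_function (chi : nat -> C) (L : C -> C) : Prop :=
  entire L /\
  forall s : C, (1 < Re s)%R ->
    is_series (fun n : nat => chi (S n) * cpow (INR (S n)) (- s)) (L s).

Definition is_eta_function (eta : C -> C) : Prop :=
  entire eta /\
  forall s : C, (0 < Re s)%R ->
    is_series (fun n : nat => RtoC ((-1) ^ n)%R * cpow (INR (S n)) (- s)) (eta s).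

(* Signed Stirling numbers of the first kind, s(n,k), defined by
   x(x-1)...(x-(n-1)) = sum_k s(n,k) x^k; multiplying by (x - n) gives the
   recursion s(n+1,k+1) = s(n,k) - n s(n,k+1). *)
Fixpoint stirling1 (n k : nat) : Z :=
  match n, k with
  | O, O => 1%Z
  | O, S _ => 0%Z
  | S n', O => 0%Z
  | S n', S k' => (stirling1 n' k' - Z.of_nat n' * stirling1 n' (S k'))%Z
  end.

Fixpoint csum (m : nat) (f : nat -> C) : C :=
  match m with
  | O => f O
  | S m' => csum m' f + f (S m')
  end.

Fixpoint csum1 (n : nat) (f : nat -> C) : C :=
  match n with
  | O => 0
  | S n' => csum1 n' f + f (S n')
  end.

Definition inner_sum (chi : nat -> C) (s : C) (m : nat) : C :=
  csum m (fun j => chi (S j) * RtoC (Binomial.C m j) * cpow (INR (S j)) (- s)).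

Definition is_Gamma (z G : C) : Prop :=
  is_RInt_gen (fun t : R => cpow t (z - 1) * RtoC (exp (- t)))
    (at_right 0) (Rbar_locally p_infty) G.

(* Main.v *)
Require Import Defs.
From Stdlib Require Import Reals ZArith Lra Lia Psatz ClassicalEpsilon List Permutation.
From Coquelicot Require Import Coquelicot.
Open Scope R_scope.
Open Scope C_scope.

(** Write b_m(s) for the inner sum, c_m(s0) = ((-1)^m / m!) sum_l s(m+1,l) eta(s0+1-l), and
    u = e^-x / (1 + e^-x).  The recursion of the Stirling numbers gives
    c_m(s0-1) = (m+1) (c_m(s0) - c_(m+1)(s0)), and c_0 = eta.  Integrating by parts, the Mellin
    transform of u^(m+1) (1-u) satisfies the same recursion, so it represents
    Gamma(s0+1) c_m(s0) for Re s0 > 0, and for Re s0 > -1 by the identity theorem.  Since u <= 1/2,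
    c_m(s0) is 2^-m up to a power of m for Re s0 > -1, hence for every s0 by the recursion.

    A nontrivial character has mean zero, so it is a combination of the sequences z^n with z a root
    of unity other than 1; then Gamma(s) b_m(s) is the Mellin transform of a combination of
    z e^-x (1 + z e^-x)^m, and |1 + z e^-x| <= rho < 2.  As b_m(s-1) = (m+1) b_m(s) - m b_(m-1)(s),
    b_m(s) is O(rho^m) up to a power of m for every s, and sum_m c_m b_m converges geometrically.

    Summation by parts turns the two recursions into
    sum_m c_m(s0-1) b_m(s) = sum_m c_m(s0) b_m(s-1).  When Re s0 >= 2 and Re s > 0, expanding
    e^-x / (1 - v e^-x)^2 in powers of v and of 1 + v gives the value L(s+s0).  For fixed s0 both
    sides are holomorphic in Re s > 0 after multiplication by Gamma(s), so the identity theorem and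
    the shift relation give the result for all s0 and s.

    The identity theorem only assumes complex differentiability: Goursat's lemma on squares gives
    |f(z)| <= 2 max |f| over a square centred at z, which is applied to f(w) / (w - z0)^n for
    f vanishing near z0. *)

(** Every exchange of a sum with an integral except one rests on a single estimate: if |phi(x)| <= K
    e^-x, then the Mellin transform of phi at w is at most K times a constant depending only on Re
    w. The remainder of a series of such functions is thus controlled by the tail of the series of
    the constants K. The exception is eta, whose series need not converge absolutely; there the
    remainder has a closed form. The decay 2^-m of the coefficients competes with the growth rho^m
    of the inner sums, so convergence hinges on the strict inequality |1 + z| < 2 for |z| = 1. It
    fails exactly at z = 1, the frequency that a character of mean zero lacks. Mellin transforms
    reach the inner sums only for Re s > 0 and the coefficients only for Re s0 > -1. Trading one
    unit between s0 and s keeps s + s0 fixed, so it carries the double series out of these regions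
    without changing the value claimed. Bounds obtained for Gamma times a quantity become bounds for
    the quantity because Gamma has no zero in Re w > 0, which is proved by a positivity argument. *)

(** * Modulus, complex exponential and complex powers *)

Lemma C_eq (a b : C) : Re a = Re b -> Im a = Im b -> a = b.
Proof. destruct a, b; simpl; congruence. Qed.

Lemma Cmod_le_Rabs (z : C) : (Cmod z <= Rabs (Re z) + Rabs (Im z))%R.
Proof.
  assert (H1 := Rabs_pos (Re z)). assert (H2 := Rabs_pos (Im z)).
  apply Rsqr_incr_0_var; [|lra].
  replace (Rsqr (Cmod z)) with (Cmod z ^ 2)%R by (unfold Rsqr; ring).
  rewrite Cmod2_alt, <- (pow2_abs (Re z)), <- (pow2_abs (Im z)). unfold Rsqr; nra.
Qed.

Lemma im_le_Cmod (z : C) : (Rabs (Im z) <= Cmod z)%R.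
Proof. eapply Rle_trans; [|apply Rmax_Cmod]. apply Rmax_r. Qed.

Lemma Cmod_minus_sym (a b : C) : Cmod (a - b) = Cmod (b - a).
Proof. rewrite <- Cmod_opp. f_equal. ring. Qed.

Lemma Cmod_triangle_sub (a b : C) : (Cmod a - Cmod b <= Cmod (a - b))%R.
Proof.
  assert (H := Cmod_triangle (a - b) b). replace (a - b + b) with a in H by ring. lra.
Qed.

Lemma Cmod_minus_le (a b : C) : (Cmod (a - b) <= Cmod a + Cmod b)%R.
Proof. unfold Cminus. rewrite <- (Cmod_opp b). apply Cmod_triangle. Qed.

Lemma RtoC_INR_S n : RtoC (INR (S n)) = RtoC (INR n) + 1.
Proof. rewrite S_INR, RtoC_plus. reflexivity. Qed.

Lemma Cmod_RtoC_pos x : (0 <= x)%R -> Cmod (RtoC x) = x.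
Proof. intro. rewrite Cmod_R. apply Rabs_pos_eq; auto. Qed.

Lemma RtoC_neq_0 x : (0 < x)%R -> RtoC x <> 0.
Proof. intros H E. apply (f_equal Re) in E. simpl in E. lra. Qed.

Lemma exp_mono x y : (x <= y)%R -> (exp x <= exp y)%R.
Proof. intros [H|H]; [left; apply exp_increasing; auto|subst; lra]. Qed.

Lemma exp_opp_le_1 x : (0 <= x)%R -> (exp (- x) <= 1)%R.
Proof. intros H. rewrite <- exp_0. apply exp_mono. lra. Qed.

Lemma cexp_plus (a b : C) : cexp (a + b) = cexp a * cexp b.
Proof.
  unfold cexp. rewrite re_plus, im_plus, exp_plus, cos_plus, sin_plus.
  apply C_eq; rewrite ?re_mult, ?im_mult; simpl; ring.
Qed.

Lemma cexp_0 : cexp 0 = 1.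
Proof. unfold cexp; simpl. rewrite exp_0, cos_0, sin_0. apply C_eq; simpl; ring. Qed.

Lemma Cmod_cexp (z : C) : Cmod (cexp z) = exp (Re z).
Proof.
  unfold Cmod, cexp; simpl.
  replace (exp (Re z) * cos (Im z) * (exp (Re z) * cos (Im z) * 1) +
     exp (Re z) * sin (Im z) * (exp (Re z) * sin (Im z) * 1))%R
    with ((exp (Re z)) ^ 2 * (Rsqr (sin (Im z)) + Rsqr (cos (Im z))))%R
    by (unfold Rsqr; ring).
  rewrite sin2_cos2, Rmult_1_r. rewrite <- Rsqr_pow2. apply sqrt_Rsqr.
  left; apply exp_pos.
Qed.

Lemma cexp_RtoC (x : R) : cexp (RtoC x) = RtoC (exp x).
Proof. unfold cexp; simpl. rewrite cos_0, sin_0. apply C_eq; simpl; ring. Qed.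

Lemma cpow_plus x a b : cpow x (a + b) = cpow x a * cpow x b.
Proof. unfold cpow. rewrite Cmult_plus_distr_l. apply cexp_plus. Qed.

Lemma cpow_0 x : cpow x 0 = 1.
Proof. unfold cpow. rewrite Cmult_0_r. apply cexp_0. Qed.

Lemma cpow_mult x y a : (0 < x)%R -> (0 < y)%R -> cpow (x * y) a = cpow x a * cpow y a.
Proof.
  intros. unfold cpow. rewrite ln_mult, RtoC_plus, Cmult_plus_distr_r by auto. apply cexp_plus.
Qed.

Lemma cpow_RtoC x (a : R) : cpow x (RtoC a) = RtoC (Rpower x a).
Proof. unfold cpow. rewrite <- RtoC_mult, cexp_RtoC. unfold Rpower. f_equal. f_equal. ring. Qed.

Lemma cpow_1 x : (0 < x)%R -> cpow x 1 = RtoC x.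
Proof. intros. rewrite cpow_RtoC, Rpower_1; auto. Qed.

Lemma Cmod_cpow x a : Cmod (cpow x a) = Rpower x (Re a).
Proof.
  unfold cpow. rewrite Cmod_cexp. unfold Rpower. f_equal. rewrite re_mult; simpl. ring.
Qed.

Lemma cpow_opp_l x a : cpow x (- a) * cpow x a = 1.
Proof. rewrite <- cpow_plus. replace (- a + a) with (RtoC 0) by ring. apply cpow_0. Qed.

Lemma cpow_plus1 x a : (0 < x)%R -> cpow x (a + 1) = RtoC x * cpow x a.
Proof. intros. rewrite cpow_plus, cpow_1 by auto. ring. Qed.

(** * Continuity, derivatives and integrals of complex-valued functions *)

(** Real-variable derivatives and integrals use C as a real normed module, whose norm is the product
    norm of R x R; this lets every bound there be read with [Cmod]. *)
Lemma norm_C_R (z : C) : @norm R_AbsRing C_R_NormedModule z = Cmod z.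
Proof.
  change (sqrt (Rabs (Re z) ^ 2 + Rabs (Im z) ^ 2) = Cmod z)%R.
  rewrite !pow2_abs. reflexivity.
Qed.

Lemma continuous_C_eps (f : R -> C) x :
  (forall eps, (0 < eps)%R -> exists d, (0 < d)%R /\
     forall y, (Rabs (y - x) < d)%R -> (Cmod (f y - f x) < eps)%R) ->
  @continuous R_UniformSpace C_UniformSpace f x.
Proof.
  intros H. apply filterlim_locally. intros eps.
  destruct (H eps (cond_pos eps)) as [d [Hd Hy]].
  exists (mkposreal d Hd). intros y Hb. apply C_NormedModule_mixin_compat1. apply Hy. exact Hb.
Qed.

(** Balls of the product uniform structure are squares, hence the loss of a factor 2 when passing to
    the modulus. *)
Lemma ball_Cmod (x y : C) eps : @ball C_UniformSpace x eps y -> (Cmod (y - x) < 2 * eps)%R.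
Proof.
  intros [H1 H2].
  change (Rabs (Re y - Re x) < eps)%R in H1. change (Rabs (Im y - Im x) < eps)%R in H2.
  eapply Rle_lt_trans; [apply Cmod_le_Rabs|].
  unfold Cminus. rewrite re_plus, re_opp, im_plus, im_opp. unfold Rminus in *. lra.
Qed.

Lemma continuous_C_inv (f : R -> C) x eps :
  @continuous R_UniformSpace C_UniformSpace f x -> (0 < eps)%R ->
  exists d, (0 < d)%R /\ forall y, (Rabs (y - x) < d)%R -> (Cmod (f y - f x) < eps)%R.
Proof.
  intros H He.
  assert (He' : (0 < eps / 2)%R) by lra.
  destruct (proj1 (filterlim_locally f (f x)) H (mkposreal _ He')) as [d Hd].
  exists d. split; [apply cond_pos|]. intros y Hy.
  replace eps with (2 * (eps / 2))%R by field. apply ball_Cmod. exact (Hd y Hy).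
Qed.

Lemma continuous_C_pair (f : R -> C) x :
  continuous (fun t => Re (f t)) x -> continuous (fun t => Im (f t)) x ->
  @continuous R_UniformSpace C_UniformSpace f x.
Proof.
  intros H1 H2. apply filterlim_locally. intros eps.
  assert (K1 := proj1 (filterlim_locally _ _) H1 eps).
  assert (K2 := proj1 (filterlim_locally _ _) H2 eps).
  generalize (filter_and _ _ K1 K2). apply filter_imp. intros y [A B]. split; [exact A|exact B].
Qed.

Lemma continuous_Re (f : R -> C) x :
  @continuous R_UniformSpace C_UniformSpace f x -> continuous (fun t => Re (f t)) x.
Proof.
  intros H. apply (@continuous_comp R_UniformSpace C_UniformSpace R_UniformSpace f Re x H).
  apply (@continuous_fst R_UniformSpace R_UniformSpace).
Qed.

Lemma continuous_Im (f : R -> C) x :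
  @continuous R_UniformSpace C_UniformSpace f x -> continuous (fun t => Im (f t)) x.
Proof.
  intros H. apply (@continuous_comp R_UniformSpace C_UniformSpace R_UniformSpace f Im x H).
  apply (@continuous_snd R_UniformSpace R_UniformSpace).
Qed.

Notation ccont := (@continuous R_UniformSpace C_UniformSpace).

Lemma ccont_ext (f g : R -> C) (x : R) : (forall t, f t = g t) -> ccont f x -> ccont g x.
Proof. apply continuous_ext. Qed.

Lemma ccont_plus (f g : R -> C) (x : R) : ccont f x -> ccont g x -> ccont (fun t => f t + g t) x.
Proof.
  intros Hf Hg. apply (@continuous_plus R_UniformSpace R_AbsRing C_R_NormedModule f g x Hf Hg).
Qed.

Lemma ccont_const (c : C) x : ccont (fun _ => c) x.
Proof. apply continuous_const. Qed.

Lemma ccont_mult (f g : R -> C) (x : R) : ccont f x -> ccont g x -> ccont (fun t => f t * g t) x.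
Proof.
  intros Hf Hg.
  assert (A1 := continuous_Re _ _ Hf). assert (A2 := continuous_Im _ _ Hf).
  assert (B1 := continuous_Re _ _ Hg). assert (B2 := continuous_Im _ _ Hg).
  apply continuous_C_pair.
  - apply (continuous_ext (fun t => minus (mult (Re (f t)) (Re (g t))) (mult (Im (f t)) (Im (g t))))%R).
    { intros t. rewrite re_mult. reflexivity. }
    apply (continuous_minus (V:=R_NormedModule)); apply (continuous_mult (K:=R_AbsRing)); auto.
  - apply (continuous_ext (fun t => plus (mult (Re (f t)) (Im (g t))) (mult (Im (f t)) (Re (g t))))%R).
    { intros t. rewrite im_mult. reflexivity. }
    apply (continuous_plus (V:=R_NormedModule)); apply (continuous_mult (K:=R_AbsRing)); auto.
Qed.

Lemma ccont_opp (f : R -> C) (x : R) : ccont f x -> ccont (fun t => - f t) x.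
Proof.
  intros H. apply ccont_ext with (fun t => (- (1)) * f t). { intros; ring. }
  apply ccont_mult; auto. apply ccont_const.
Qed.

Lemma ccont_minus (f g : R -> C) (x : R) : ccont f x -> ccont g x -> ccont (fun t => f t - g t) x.
Proof. intros. apply ccont_plus; auto. apply ccont_opp; auto. Qed.

Lemma ccont_RtoC (f : R -> R) x : continuous f x -> ccont (fun t => RtoC (f t)) x.
Proof. intros. apply continuous_C_pair; simpl; auto. apply continuous_const. Qed.

Lemma ccont_pow (f : R -> C) (n : nat) (x : R) : ccont f x -> ccont (fun t => f t ^ n) x.
Proof.
  intros H. induction n as [|n IH]; simpl; [apply ccont_const|]. apply ccont_mult; auto.
Qed.

Lemma ccont_cexp (f : R -> C) (x : R) : ccont f x -> ccont (fun t => cexp (f t)) x.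
Proof.
  intros H. assert (A1 := continuous_Re _ _ H). assert (A2 := continuous_Im _ _ H).
  assert (E : continuous (fun t => exp (Re (f t))) x).
  { apply (continuous_comp (fun t => Re (f t)) exp); auto. apply continuous_exp. }
  apply continuous_C_pair; simpl.
  - apply (continuous_mult (K:=R_AbsRing) (fun t => exp (Re (f t))) (fun t => cos (Im (f t)))); auto.
    apply (continuous_comp (fun t => Im (f t)) cos); auto. apply continuous_cos.
  - apply (continuous_mult (K:=R_AbsRing) (fun t => exp (Re (f t))) (fun t => sin (Im (f t)))); auto.
    apply (continuous_comp (fun t => Im (f t)) sin); auto. apply continuous_sin.
Qed.

Lemma continuous_ln x : (0 < x)%R -> continuous ln x.
Proof.
  intros H. apply (ex_derive_continuous (K:=R_AbsRing) (V:=R_NormedModule)).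
  exists (/ x)%R. apply is_derive_ln; auto.
Qed.

Lemma ccont_cpow w x : (0 < x)%R -> ccont (fun t => cpow t w) x.
Proof.
  intros H. unfold cpow. apply ccont_cexp. apply ccont_mult; [|apply ccont_const].
  apply ccont_RtoC. apply continuous_ln; auto.
Qed.

(** * Derivatives of complex functions of a real variable *)

Notation cderiv := (@is_derive R_AbsRing C_R_NormedModule).

Lemma cderiv_pair (f : R -> C) x (l : C) :
  is_derive (fun t => Re (f t)) x (Re l) -> is_derive (fun t => Im (f t)) x (Im l) -> cderiv f x l.
Proof.
  intros H1 H2. split; [apply is_linear_scal_l|].
  intros x' Hx'. assert (E := is_filter_lim_locally_unique _ _ Hx'). subst x'. clear Hx'.
  intros eps.
  assert (He : (0 < eps / 2)%R) by (destruct eps; simpl; lra).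
  destruct H1 as [_ H1]. destruct H2 as [_ H2].
  assert (K1 := H1 x (fun P H => H) (mkposreal _ He)).
  assert (K2 := H2 x (fun P H => H) (mkposreal _ He)).
  generalize (filter_and _ _ K1 K2). apply filter_imp. intros y [A B].
  cbn [pos] in A, B.
  change (Rabs (Re (f y) - Re (f x) - (y - x) * Re l) <= eps / 2 * Rabs (y - x))%R in A.
  change (Rabs (Im (f y) - Im (f x) - (y - x) * Im l) <= eps / 2 * Rabs (y - x))%R in B.
  rewrite norm_C_R. eapply Rle_trans; [apply Cmod_le_Rabs|].
  change (Rabs (Re (f y) - Re (f x) - (y - x) * Re l) + Rabs (Im (f y) - Im (f x) - (y - x) * Im l)
     <= eps * Rabs (y - x))%R. lra.
Qed.

Lemma cderiv_Re (f : R -> C) x (l : C) : cderiv f x l -> is_derive (fun t => Re (f t)) x (Re l).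
Proof.
  intros [_ H]. split; [apply is_linear_scal_l|].
  intros x' Hx' eps. assert (E := is_filter_lim_locally_unique _ _ Hx'). subst x'.
  generalize (H x (fun P H => H) eps). apply filter_imp. intros y A.
  eapply Rle_trans; [|exact A]. rewrite norm_C_R.
  eapply Rle_trans; [|apply re_le_Cmod]. right; reflexivity.
Qed.

Lemma cderiv_Im (f : R -> C) x (l : C) : cderiv f x l -> is_derive (fun t => Im (f t)) x (Im l).
Proof.
  intros [_ H]. split; [apply is_linear_scal_l|].
  intros x' Hx' eps. assert (E := is_filter_lim_locally_unique _ _ Hx'). subst x'.
  generalize (H x (fun P H => H) eps). apply filter_imp. intros y A.
  eapply Rle_trans; [|exact A]. rewrite norm_C_R.
  eapply Rle_trans; [|apply im_le_Cmod]. right; reflexivity.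
Qed.

Lemma cderiv_mult (f g : R -> C) (x : R) (l m : C) : cderiv f x l -> cderiv g x m ->
  cderiv (fun t => f t * g t) x (l * g x + f x * m).
Proof.
  intros Hf Hg. assert (A1 := cderiv_Re _ _ _ Hf). assert (A2 := cderiv_Im _ _ _ Hf).
  assert (B1 := cderiv_Re _ _ _ Hg). assert (B2 := cderiv_Im _ _ _ Hg).
  apply cderiv_pair.
  - eapply is_derive_ext. { intros t. symmetry. apply re_mult. }
    evar_last. { apply @is_derive_minus; apply Derive.is_derive_mult; [apply A1|apply B1|apply A2|apply B2]. }
    rewrite re_plus, !re_mult. unfold minus, plus, opp; simpl. ring.
  - eapply is_derive_ext. { intros t. symmetry. apply im_mult. }
    evar_last. { apply @is_derive_plus; apply Derive.is_derive_mult; [apply A1|apply B2|apply A2|apply B1]. }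
    rewrite im_plus, !im_mult. unfold minus, plus, opp; simpl. ring.
Qed.

Lemma cderiv_RtoC (f : R -> R) x l : is_derive f x l -> cderiv (fun t => RtoC (f t)) x (RtoC l).
Proof. intros H. apply cderiv_pair; simpl; auto. apply @is_derive_const. Qed.

Lemma cderiv_cexp (A : C) (t : R) : cderiv (fun t : R => cexp (RtoC t * A)) t (A * cexp (RtoC t * A)).
Proof.
  apply cderiv_pair.
  - apply (is_derive_ext (fun t => exp (t * Re A) * cos (t * Im A))%R).
    { intros; unfold cexp; simpl. rewrite !Rmult_0_l, Rminus_0_r, Rplus_0_r. reflexivity. }
    rewrite re_mult. unfold cexp; simpl. rewrite !Rmult_0_l, Rminus_0_r, Rplus_0_r.
    fold (Re A) (Im A). auto_derive; auto. ring.
  - apply (is_derive_ext (fun t => exp (t * Re A) * sin (t * Im A))%R).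
    { intros; unfold cexp; simpl. rewrite !Rmult_0_l, Rminus_0_r, Rplus_0_r. reflexivity. }
    rewrite im_mult. unfold cexp; simpl. rewrite !Rmult_0_l, Rminus_0_r, Rplus_0_r.
    fold (Re A) (Im A). auto_derive; auto. ring.
Qed.

Lemma cderiv_cpow (w : C) (x : R) : (0 < x)%R ->
  cderiv (fun t : R => cpow t w) x (w * cpow x (w - 1)).
Proof.
  intros Hx.
  assert (E : w * cpow x (w - 1) = RtoC (/ x) * (w * cpow x w)).
  { unfold Cminus. rewrite cpow_plus.
    assert (K := cpow_opp_l x 1). rewrite (cpow_1 x Hx) in K.
    assert (RtoC x <> 0) by (apply RtoC_neq_0; lra).
    rewrite RtoC_inv by lra.
    replace (cpow x (- (1))) with (/ RtoC x). ring.
    apply (f_equal (fun z => z * / RtoC x)) in K. rewrite <- Cmult_assoc, Cinv_r in K by auto.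
    rewrite Cmult_1_r, Cmult_1_l in K. auto. }
  rewrite E, <- scal_R_Cmult. unfold cpow.
  apply (@is_derive_comp R_AbsRing C_R_NormedModule (fun t => cexp (RtoC t * w)) ln x
    (w * cexp (RtoC (ln x) * w)) (/ x)%R).
  - apply cderiv_cexp.
  - apply is_derive_ln; auto.
Qed.

(** * Integrals of complex functions over bounded intervals *)

Notation CInt := (@is_RInt C_R_NormedModule).

Lemma CInt_plus (f g : R -> C) (a b : R) (lf lg : C) : CInt f a b lf -> CInt g a b lg ->
  CInt (fun t => f t + g t) a b (lf + lg).
Proof. apply (@is_RInt_plus C_R_NormedModule). Qed.

Lemma CInt_minus (f g : R -> C) (a b : R) (lf lg : C) : CInt f a b lf -> CInt g a b lg ->
  CInt (fun t => f t - g t) a b (lf - lg).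
Proof. apply (@is_RInt_minus C_R_NormedModule). Qed.

(** The scalar is complex whereas the integral lives in a real module, so the product is split into
    real and imaginary parts. *)
Lemma CInt_mult_l (c : C) (f : R -> C) (a b : R) (l : C) : CInt f a b l -> CInt (fun t => c * f t) a b (c * l).
Proof.
  intros H.
  assert (H1 := is_RInt_fct_extend_fst (U:=R_NormedModule) (V:=R_NormedModule) f a b l H).
  assert (H2 := is_RInt_fct_extend_snd (U:=R_NormedModule) (V:=R_NormedModule) f a b l H).
  apply (is_RInt_fct_extend_pair (U:=R_NormedModule) (V:=R_NormedModule)).
  - apply (is_RInt_minus (V:=R_NormedModule) (fun t => Re c * Re (f t))%R (fun t => Im c * Im (f t))%R a b (Re c * Re l)%R (Im c * Im l)%R).
    apply (is_RInt_scal (V:=R_NormedModule) (fun t => Re (f t))); exact H1.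
    apply (is_RInt_scal (V:=R_NormedModule) (fun t => Im (f t))); exact H2.
  - apply (is_RInt_plus (V:=R_NormedModule) (fun t => Re c * Im (f t))%R (fun t => Im c * Re (f t))%R a b (Re c * Im l)%R (Im c * Re l)%R).
    apply (is_RInt_scal (V:=R_NormedModule) (fun t => Im (f t))); exact H2.
    apply (is_RInt_scal (V:=R_NormedModule) (fun t => Re (f t))); exact H1.
Qed.

Lemma CInt_Re (f : R -> C) (a b : R) (l : C) : CInt f a b l -> is_RInt (fun t => Re (f t)) a b (Re l).
Proof. intros H. exact (is_RInt_fct_extend_fst (U:=R_NormedModule) (V:=R_NormedModule) f a b l H). Qed.

Lemma CInt_ex (f : R -> C) (a b : R) : (forall x, (Rmin a b <= x <= Rmax a b)%R -> ccont f x) -> exists l : C, CInt f a b l.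
Proof. intros H. exact (@ex_RInt_continuous C_R_CompleteNormedModule f a b H). Qed.

Lemma CInt_unique (f : R -> C) (a b : R) (l l' : C) : CInt f a b l -> CInt f a b l' -> l = l'.
Proof.
  intros H H'.
  rewrite <- (@is_RInt_unique C_R_CompleteNormedModule f a b l H).
  apply (@is_RInt_unique C_R_CompleteNormedModule f a b l' H').
Qed.

Lemma CInt_bound (f : R -> C) (a b : R) (l : C) (M : R) : (a <= b)%R -> (forall x, (a <= x <= b)%R -> (Cmod (f x) <= M)%R) ->
  CInt f a b l -> (Cmod l <= (b - a) * M)%R.
Proof.
  intros Hab HM H. rewrite <- norm_C_R. apply (norm_RInt_le_const (V:=C_R_NormedModule) f a b l M Hab); auto.
  intros x Hx. rewrite norm_C_R. auto.
Qed.

Lemma CInt_dominated (f : R -> C) (g : R -> R) (a b : R) (l : C) (lg : R) : (a <= b)%R -> (forall x, (a <= x <= b)%R -> (Cmod (f x) <= g x)%R) ->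
  CInt f a b l -> is_RInt g a b lg -> (Cmod l <= lg)%R.
Proof.
  intros Hab HM H Hg. rewrite <- norm_C_R. apply (norm_RInt_le (V:=C_R_NormedModule) f g a b l lg Hab); auto.
  intros x Hx. rewrite norm_C_R. auto.
Qed.

Lemma CInt_FTC (f df : R -> C) (a b : R) :
  (forall x, (Rmin a b <= x <= Rmax a b)%R -> cderiv f x (df x)) ->
  (forall x, (Rmin a b <= x <= Rmax a b)%R -> ccont df x) ->
  CInt df a b (f b - f a).
Proof. apply (@is_RInt_derive C_R_CompleteNormedModule). Qed.

Lemma CInt_Chasles (f : R -> C) (a b c : R) (l l' : C) : CInt f a b l -> CInt f b c l' -> CInt f a c (l + l').
Proof. apply (@is_RInt_Chasles C_R_NormedModule). Qed.

Lemma CInt_ext (f g : R -> C) (a b : R) (l : C) : (forall x, (Rmin a b < x < Rmax a b)%R -> f x = g x) ->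
  CInt f a b l -> CInt g a b l.
Proof. apply (@is_RInt_ext C_R_NormedModule). Qed.

(** * Growth of the complex exponential *)

(** Integrate the derivative A e^(tA) over [0,1], where |e^(tA)| <= e^|A|. *)
Lemma cexp_minus_1_bound (A : C) : (Cmod (cexp A - 1) <= Cmod A * exp (Cmod A))%R.
Proof.
  assert (H : CInt (fun t => A * cexp (RtoC t * A)) 0 1 (cexp (RtoC 1 * A) - cexp (RtoC 0 * A))).
  { apply (CInt_FTC (fun t => cexp (RtoC t * A))).
    - intros; apply cderiv_cexp.
    - intros. apply ccont_mult; [apply ccont_const|]. apply ccont_cexp. apply ccont_mult; [|apply ccont_const].
      apply ccont_RtoC. apply continuous_id. }
  rewrite Cmult_1_l, Cmult_0_l, cexp_0 in H.
  replace (Cmod A * exp (Cmod A))%R with ((1 - 0) * (Cmod A * exp (Cmod A)))%R by ring.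
  eapply CInt_bound; [lra| |exact H]. cbv beta. intros x Hx.
  rewrite Cmod_mult, Cmod_cexp. apply Rmult_le_compat_l; [apply Cmod_ge_0|].
  apply exp_mono. rewrite re_scal_l.
  assert (K := re_le_Cmod A). assert (K2 := Rle_abs (Re A)). assert (K3 := Cmod_ge_0 A).
  destruct (Rle_dec 0 (Re A)); nra.
Qed.

(** The same integration one order higher. With A = h ln x it controls the second-order error when a
    Mellin transform is differentiated in its argument. *)
Lemma cexp_minus_1_minus_id_bound (A : C) :
  (Cmod (cexp A - 1 - A) <= Cmod A ^ 2 * exp (Cmod A))%R.
Proof.
  assert (H0 : forall x, cderiv (fun t => cexp (RtoC t * A) - RtoC t * A) x (A * cexp (RtoC x * A) - A)).
  { intros x. apply (@is_derive_minus R_AbsRing C_R_NormedModule _ (fun t => RtoC t * A)).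
    - apply cderiv_cexp.
    - evar_last. { apply cderiv_mult. apply cderiv_RtoC. apply @is_derive_id. apply @is_derive_const. }
      rewrite Cmult_1_l. change (A + RtoC x * 0 = A). ring. }
  assert (H : CInt (fun t => A * cexp (RtoC t * A) - A) 0 1
     ((cexp (RtoC 1 * A) - RtoC 1 * A) - (cexp (RtoC 0 * A) - RtoC 0 * A))).
  { apply (CInt_FTC (fun t => cexp (RtoC t * A) - RtoC t * A)).
    - intros; apply H0.
    - intros. apply ccont_minus; [|apply ccont_const].
      apply ccont_mult; [apply ccont_const|]. apply ccont_cexp. apply ccont_mult; [|apply ccont_const].
      apply ccont_RtoC. apply continuous_id. }
  rewrite !Cmult_1_l, Cmult_0_l, cexp_0 in H.
  replace (cexp A - A - (1 - 0)) with (cexp A - 1 - A) in H by ring.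
  replace (Cmod A ^ 2 * exp (Cmod A))%R with ((1 - 0) * (Cmod A ^ 2 * exp (Cmod A)))%R by ring.
  eapply CInt_bound; [lra| |exact H]. cbv beta. intros x Hx.
  replace (A * cexp (RtoC x * A) - A) with (A * (cexp (RtoC x * A) - 1)) by ring.
  rewrite Cmod_mult. assert (K := cexp_minus_1_bound (RtoC x * A)).
  rewrite Cmod_mult, Cmod_RtoC_pos in K by lra.
  assert (K3 := Cmod_ge_0 A).
  assert (K4 : (exp (x * Cmod A) <= exp (Cmod A))%R) by (apply exp_mono; nra).
  assert (K5 := exp_pos (x * Cmod A)).
  replace (Cmod A ^ 2 * exp (Cmod A))%R with (Cmod A * (Cmod A * exp (Cmod A)))%R by ring.
  apply Rmult_le_compat_l; auto. eapply Rle_trans; [exact K|].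
  apply Rmult_le_compat; try nra.
Qed.

(** * Complex differentiability *)

(** An epsilon-delta form in which estimates can be made directly; the algebraic rules are imported
    through the equivalence with [is_derive]. *)
Definition Cdiff (f : C -> C) (z l : C) : Prop :=
  forall eps, (0 < eps)%R -> exists d, (0 < d)%R /\
    forall w, (Cmod (w - z) < d)%R -> (Cmod (f w - f z - l * (w - z)) <= eps * Cmod (w - z))%R.

Lemma is_derive_Cdiff f (z l : C) :
  @is_derive C_AbsRing C_NormedModule f z l -> Cdiff f z l.
Proof.
  intros [_ H] eps He. destruct (H z (fun P H => H) (mkposreal eps He)) as [d Hd].
  exists d. split; [apply cond_pos|]. intros w Hw.
  specialize (Hd w Hw). cbn [pos] in Hd.
  change (Cmod (f w - f z - (w - z) * l) <= eps * Cmod (w - z))%R in Hd.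
  rewrite (Cmult_comm l). exact Hd.
Qed.

Lemma Cdiff_ext_loc f g z l r : (0 < r)%R ->
  (forall w, (Cmod (w - z) < r)%R -> f w = g w) -> Cdiff f z l -> Cdiff g z l.
Proof.
  intros Hr E H eps He. destruct (H eps He) as [d [Hd K]].
  exists (Rmin r d). split; [apply Rmin_case; auto|]. intros w Hw.
  rewrite <- !E. apply K. eapply Rlt_le_trans; [apply Hw|apply Rmin_r].
  replace (z - z) with (RtoC 0) by ring. rewrite Cmod_0; auto.
  eapply Rlt_le_trans; [apply Hw|apply Rmin_l].
Qed.

Lemma Cdiff_ext f g z l : (forall w, f w = g w) -> Cdiff f z l -> Cdiff g z l.
Proof. intros E. apply Cdiff_ext_loc with (1%R); auto; lra. Qed.

Lemma Cdiff_const c z : Cdiff (fun _ => c) z 0.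
Proof.
  intros eps He. exists 1%R. split; [lra|]. intros w _.
  replace (c - c - 0 * (w - z)) with (RtoC 0) by ring. rewrite Cmod_0.
  apply Rmult_le_pos; [lra|apply Cmod_ge_0].
Qed.

Lemma Cdiff_id z : Cdiff (fun w => w) z 1.
Proof.
  intros eps He. exists 1%R. split; [lra|]. intros w _.
  replace (w - z - 1 * (w - z)) with (RtoC 0) by ring. rewrite Cmod_0.
  apply Rmult_le_pos; [lra|apply Cmod_ge_0].
Qed.

Notation C_is_derive := (@is_derive C_AbsRing (AbsRing_NormedModule C_AbsRing)).

Lemma Cdiff_is_derive (f : C -> C) (z l : C) : Cdiff f z l <-> C_is_derive f z l.
Proof.
  split.
  - intros H. split; [apply is_linear_scal_l|]. intros y Hy. assert (E := is_filter_lim_locally_unique _ _ Hy). subst y.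
    intros eps. destruct (H eps (cond_pos eps)) as [d [Hd K]].
    exists (mkposreal d Hd). intros w Hw. specialize (K w Hw). rewrite (Cmult_comm l) in K. exact K.
  - intros [_ H] eps He. destruct (H z (fun P H => H) (mkposreal eps He)) as [d Hd].
    exists d. split; [apply cond_pos|]. intros w Hw. specialize (Hd w Hw). rewrite (Cmult_comm l). exact Hd.
Qed.

Lemma Cdiff_plus f g z l m : Cdiff f z l -> Cdiff g z m -> Cdiff (fun w => f w + g w) z (l + m).
Proof.
  rewrite !Cdiff_is_derive. apply (@is_derive_plus C_AbsRing (AbsRing_NormedModule C_AbsRing)).
Qed.

Lemma Cdiff_mult f g z l m : Cdiff f z l -> Cdiff g z m ->
  Cdiff (fun w => f w * g w) z (l * g z + f z * m).
Proof.
  rewrite !Cdiff_is_derive. intros Hf Hg.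
  exact (@is_derive_mult C_AbsRing f g z l m Hf Hg Cmult_comm).
Qed.

Lemma Cdiff_comp f g z l m : Cdiff f (g z) l -> Cdiff g z m -> Cdiff (fun w => f (g w)) z (m * l).
Proof.
  rewrite !Cdiff_is_derive. apply (@is_derive_comp C_AbsRing (AbsRing_NormedModule C_AbsRing)).
Qed.

Lemma Cdiff_Lipschitz f z l : Cdiff f z l -> exists d, (0 < d)%R /\
  forall w, (Cmod (w - z) < d)%R -> (Cmod (f w - f z) <= (Cmod l + 1) * Cmod (w - z))%R.
Proof.
  intros H. destruct (H 1%R ltac:(lra)) as [d [Hd K]]. exists d. split; auto.
  intros w Hw. specialize (K w Hw).
  replace (f w - f z) with ((f w - f z - l * (w - z)) + l * (w - z)) by ring.
  eapply Rle_trans; [apply Cmod_triangle|]. rewrite Cmod_mult. lra.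
Qed.

Lemma Cdiff_inv (z : C) : z <> 0 -> Cdiff (fun w => / w) z (- / (z * z)).
Proof.
  intros Hz eps He. assert (Hm : (0 < Cmod z)%R) by exact (proj1 (Cmod_gt_0 z) Hz).
  set (m := Cmod z) in *.
  (* The error is (w - z)^2 / (w z^2). The first bound keeps |w| >= m/2, and the second makes |w -
     z| / (m/2 m^2) at most eps. *)
  exists (Rmin (m / 2) (eps * (m * m * m) / 2)). split.
  { apply Rmin_case; [lra|]. assert (0 < eps * (m * m * m))%R by (apply Rmult_lt_0_compat; auto; apply Rmult_lt_0_compat; nra). lra. }
  intros w Hw.
  assert (Q1 := Rlt_le_trans _ _ _ Hw (Rmin_l _ _)).
  assert (Q2 := Rlt_le_trans _ _ _ Hw (Rmin_r _ _)).
  assert (T := Cmod_triangle_sub z w). rewrite Cmod_minus_sym in T. fold m in T.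
  assert (Hw0 : w <> 0) by (apply Cmod_gt_0; lra).
  replace (/ w - / z - - / (z * z) * (w - z)) with ((w - z) * (w - z) * / (w * (z * z))) by (field; auto).
  assert (N : w * (z * z) <> 0) by (repeat apply Cmult_neq_0; auto).
  rewrite !Cmod_mult, Cmod_inv, !Cmod_mult by auto. fold m.
  set (h := Cmod (w - z)) in *. assert (Hh : (0 <= h)%R) by apply Cmod_ge_0.
  replace (h * h * / (Cmod w * (m * m)))%R with (h * / (Cmod w * (m * m)) * h)%R by ring.
  apply Rmult_le_compat_r; auto.
  apply Rmult_le_reg_r with (Cmod w * (m * m))%R. { apply Rmult_lt_0_compat; nra. }
  rewrite Rmult_assoc, Rinv_l, Rmult_1_r by (apply Rgt_not_eq; apply Rmult_lt_0_compat; nra).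
  apply Rle_trans with (eps * (m * m * m) / 2)%R; [lra|].
  replace (eps * (m * m * m) / 2)%R with (eps * (m / 2 * (m * m)))%R by field.
  apply Rmult_le_compat_l; [lra|]. apply Rmult_le_compat_r; nra.
Qed.

Lemma Cdiff_translate f c z l : Cdiff f (c + z) l -> Cdiff (fun w => f (c + w)) z l.
Proof.
  intros H. replace l with ((0 + 1) * l) by ring. apply (Cdiff_comp f (fun w => c + w)); auto.
  apply Cdiff_plus; [apply Cdiff_const|apply Cdiff_id].
Qed.

Lemma Cdiff_div f g (z l m : C) : Cdiff f z l -> Cdiff g z m -> g z <> 0 ->
  exists n, Cdiff (fun w => f w / g w) z n.
Proof.
  intros Hf Hg Hz. eexists. apply Cdiff_mult; [exact Hf|].
  apply (Cdiff_comp (fun w => / w) g); [apply Cdiff_inv; auto|exact Hg].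
Qed.

Definition Ccont (f : C -> C) (z : C) : Prop :=
  forall eps, (0 < eps)%R -> exists d, (0 < d)%R /\
    forall w, (Cmod (w - z) < d)%R -> (Cmod (f w - f z) < eps)%R.

Lemma Cdiff_Ccont f z l : Cdiff f z l -> Ccont f z.
Proof.
  intros H eps He. destruct (Cdiff_Lipschitz _ _ _ H) as [d [Hd K]].
  set (B := (Cmod l + 1)%R) in *. assert (HB : (0 < B)%R) by (unfold B; assert (G := Cmod_ge_0 l); lra).
  exists (Rmin d (eps / B)). split. { apply Rmin_case; auto. apply Rdiv_lt_0_compat; auto. }
  intros w Hw. eapply Rle_lt_trans; [apply K; eapply Rlt_le_trans; [apply Hw|apply Rmin_l]|].
  assert (Q := Rlt_le_trans _ _ _ Hw (Rmin_r _ _)).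
  apply Rmult_lt_reg_l with (/ B)%R; [apply Rinv_0_lt_compat; auto|].
  replace (/ B * (B * Cmod (w - z)))%R with (Cmod (w - z)) by (field; lra).
  replace (/ B * eps)%R with (eps / B)%R by (unfold Rdiv; ring). auto.
Qed.

Lemma Ccont_horizontal (f : C -> C) (x y : R) : Ccont f (x, y) -> ccont (fun t => f (t, y)) x.
Proof.
  intros H. apply continuous_C_eps. intros eps He. destruct (H eps He) as [d [Hd K]].
  exists d. split; auto. intros t Ht. apply K.
  assert (E : ((t, y) : C) - ((x, y) : C) = RtoC (t - x)) by (apply C_eq; simpl; ring).
  change (Cmod (((t, y) : C) - ((x, y) : C)) < d)%R. rewrite E, Cmod_R. auto.
Qed.

Lemma Ccont_vertical (f : C -> C) (x y : R) : Ccont f (x, y) -> ccont (fun t => f (x, t)) y.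
Proof.
  intros H. apply continuous_C_eps. intros eps He. destruct (H eps He) as [d [Hd K]].
  exists d. split; auto. intros t Ht. apply K.
  assert (E : ((x, t) : C) - ((x, y) : C) = Ci * RtoC (t - y)) by (apply C_eq; simpl; ring).
  change (Cmod (((x, t) : C) - ((x, y) : C)) < d)%R. rewrite E, Cmod_mult, Cmod_Ci, Rmult_1_l, Cmod_R. auto.
Qed.

(** * Contour integrals over squares *)

Definition J (f : R -> C) (a b : R) : C := @RInt C_R_CompleteNormedModule f a b.

Lemma J_unique f a b l : CInt f a b l -> J f a b = l.
Proof. apply (@is_RInt_unique C_R_CompleteNormedModule). Qed.

Lemma J_correct f a b : (a <= b)%R -> (forall t, (a <= t <= b)%R -> ccont f t) -> CInt f a b (J f a b).
Proof.
  intros Hab H. destruct (CInt_ex f a b) as [l Hl].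
  { rewrite Rmin_left, Rmax_right by auto. auto. }
  rewrite (J_unique _ _ _ _ Hl). auto.
Qed.

(* Counterclockwise integral over the boundary of [x, x+s] x [y, y+s]. *)
Definition SqInt (f : C -> C) (x y s : R) : C :=
  J (fun t => f (t, y)) x (x + s) - J (fun t => f (t, (y + s)%R)) x (x + s)
  + Ci * (J (fun t => f ((x + s)%R, t)) y (y + s) - J (fun t => f (x, t)) y (y + s)).

Definition on_sides (x y s : R) (z : C) : Prop :=
  (x <= Re z <= x + s)%R /\ (y <= Im z <= y + s)%R /\
  (Re z = x \/ Re z = (x + s)%R \/ Im z = y \/ Im z = (y + s)%R).

Lemma SqInt_correct f x y s : (0 <= s)%R -> (forall z, on_sides x y s z -> Ccont f z) ->
  CInt (fun t => f (t, y)) x (x + s) (J (fun t => f (t, y)) x (x + s)) /\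
  CInt (fun t => f (t, (y + s)%R)) x (x + s) (J (fun t => f (t, (y + s)%R)) x (x + s)) /\
  CInt (fun t => f ((x + s)%R, t)) y (y + s) (J (fun t => f ((x + s)%R, t)) y (y + s)) /\
  CInt (fun t => f (x, t)) y (y + s) (J (fun t => f (x, t)) y (y + s)).
Proof.
  intros Hs H. repeat split; apply J_correct; try lra; intros t Ht.
  - apply Ccont_horizontal. apply H. unfold on_sides; simpl; lra.
  - apply Ccont_horizontal. apply H. unfold on_sides; simpl; lra.
  - apply Ccont_vertical. apply H. unfold on_sides; simpl; lra.
  - apply Ccont_vertical. apply H. unfold on_sides; simpl; lra.
Qed.

Lemma SqInt_bound f x y s M : (0 <= s)%R -> (forall z, on_sides x y s z -> Ccont f z) ->
  (forall z, on_sides x y s z -> (Cmod (f z) <= M)%R) -> (Cmod (SqInt f x y s) <= 4 * s * M)%R.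
Proof.
  intros Hs Hc HM. destruct (SqInt_correct f x y s Hs Hc) as [H1 [H2 [H3 H4]]].
  apply CInt_bound with (M := M) in H1; [|lra|intros t Ht; apply HM; unfold on_sides; simpl; lra].
  apply CInt_bound with (M := M) in H2; [|lra|intros t Ht; apply HM; unfold on_sides; simpl; lra].
  apply CInt_bound with (M := M) in H3; [|lra|intros t Ht; apply HM; unfold on_sides; simpl; lra].
  apply CInt_bound with (M := M) in H4; [|lra|intros t Ht; apply HM; unfold on_sides; simpl; lra].
  unfold SqInt. eapply Rle_trans; [apply Cmod_triangle|]. rewrite Cmod_mult, Cmod_Ci.
  assert (A := Cmod_minus_le (J (fun t => f (t, y)) x (x + s)) (J (fun t => f (t, (y + s)%R)) x (x + s))).
  assert (B := Cmod_minus_le (J (fun t => f ((x + s)%R, t)) y (y + s)) (J (fun t => f (x, t)) y (y + s))).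
  lra.
Qed.

Lemma SqInt_plus f g x y s : (0 <= s)%R -> (forall z, on_sides x y s z -> Ccont f z) ->
  (forall z, on_sides x y s z -> Ccont g z) ->
  SqInt (fun z => f z + g z) x y s = SqInt f x y s + SqInt g x y s.
Proof.
  intros Hs Hf Hg. destruct (SqInt_correct f x y s Hs Hf) as [H1 [H2 [H3 H4]]].
  destruct (SqInt_correct g x y s Hs Hg) as [K1 [K2 [K3 K4]]].
  unfold SqInt at 1.
  rewrite (J_unique _ _ _ _ (CInt_plus _ _ _ _ _ _ H1 K1)).
  rewrite (J_unique _ _ _ _ (CInt_plus _ _ _ _ _ _ H2 K2)).
  rewrite (J_unique _ _ _ _ (CInt_plus _ _ _ _ _ _ H3 K3)).
  rewrite (J_unique _ _ _ _ (CInt_plus _ _ _ _ _ _ H4 K4)).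
  unfold SqInt. ring.
Qed.

Lemma SqInt_mult_l c f x y s : (0 <= s)%R -> (forall z, on_sides x y s z -> Ccont f z) ->
  SqInt (fun z => c * f z) x y s = c * SqInt f x y s.
Proof.
  intros Hs Hf. destruct (SqInt_correct f x y s Hs Hf) as [H1 [H2 [H3 H4]]].
  unfold SqInt at 1.
  rewrite (J_unique _ _ _ _ (CInt_mult_l c _ _ _ _ H1)).
  rewrite (J_unique _ _ _ _ (CInt_mult_l c _ _ _ _ H2)).
  rewrite (J_unique _ _ _ _ (CInt_mult_l c _ _ _ _ H3)).
  rewrite (J_unique _ _ _ _ (CInt_mult_l c _ _ _ _ H4)).
  unfold SqInt. ring.
Qed.

Lemma J_ext f g a b : (a <= b)%R -> (forall t, (a <= t <= b)%R -> f t = g t) -> J f a b = J g a b.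
Proof.
  intros Hab E. apply (@RInt_ext C_R_CompleteNormedModule). intros t Ht.
  rewrite Rmin_left, Rmax_right in Ht by auto. apply E; lra.
Qed.

Lemma SqInt_ext f g x y s : (0 <= s)%R -> (forall z, on_sides x y s z -> f z = g z) ->
  SqInt f x y s = SqInt g x y s.
Proof.
  intros Hs E. unfold SqInt.
  rewrite (J_ext (fun t => f (t, y)) (fun t => g (t, y))),
    (J_ext (fun t => f (t, (y + s)%R)) (fun t => g (t, (y + s)%R))),
    (J_ext (fun t => f ((x + s)%R, t)) (fun t => g ((x + s)%R, t))),
    (J_ext (fun t => f (x, t)) (fun t => g (x, t)));
   try reflexivity; try lra; intros t Ht; apply E; unfold on_sides; simpl; lra.
Qed.

(** Chasles joins the halves of each outer side, and each inner side is traversed twice in opposite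
    directions, so it cancels in the final [ring]. *)
Lemma SqInt_quarter f a x y s : (a < x)%R -> (0 < s)%R -> (forall z, (a < Re z)%R -> Ccont f z) ->
  SqInt f x y (s + s) =
  SqInt f x y s + SqInt f (x + s) y s + SqInt f x (y + s) s + SqInt f (x + s) (y + s) s.
Proof.
  intros Hx Hs Hf.
  assert (D : forall u v, (a < u)%R -> forall z, on_sides u v s z -> Ccont f z).
  { intros u v Hu z Hz. apply Hf. destruct Hz as [Hz _]. lra. }
  destruct (SqInt_correct f x y s ltac:(lra) (D _ _ Hx)) as [H1 [H2 [H3 H4]]].
  destruct (SqInt_correct f (x + s) y s ltac:(lra) (D (x + s)%R y ltac:(lra))) as [K1 [K2 [K3 K4]]].
  destruct (SqInt_correct f x (y + s) s ltac:(lra) (D _ _ Hx)) as [L1 [L2 [L3 L4]]].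
  destruct (SqInt_correct f (x + s) (y + s) s ltac:(lra) (D (x + s)%R (y + s)%R ltac:(lra))) as [M1 [M2 [M3 M4]]].
  unfold SqInt at 1. rewrite <- !Rplus_assoc.
  rewrite (J_unique _ _ _ _ (CInt_Chasles _ _ _ _ _ _ H1 K1)).
  rewrite (J_unique _ _ _ _ (CInt_Chasles _ _ _ _ _ _ L2 M2)).
  rewrite (J_unique _ _ _ _ (CInt_Chasles _ _ _ _ _ _ K3 M3)).
  rewrite (J_unique _ _ _ _ (CInt_Chasles _ _ _ _ _ _ H4 L4)).
  unfold SqInt. ring.
Qed.

Lemma CInt_affine (A B : C) a b : CInt (fun t => A + B * RtoC t) a b
  (A * RtoC (b - a) + B * RtoC ((b * b - a * a) / 2)).
Proof.
  replace (A * RtoC (b - a) + B * RtoC ((b * b - a * a) / 2)) with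
    ((A * RtoC b + B * RtoC (b * b / 2)) - (A * RtoC a + B * RtoC (a * a / 2))).
  2:{ rewrite (RtoC_minus b a). replace ((b * b - a * a) / 2)%R with (b * b / 2 - a * a / 2)%R by field.
      rewrite (RtoC_minus (b * b / 2)). ring. }
  apply (CInt_FTC (fun t => A * RtoC t + B * RtoC (t * t / 2))).
  - intros t _.
    apply (@is_derive_plus R_AbsRing C_R_NormedModule (fun t => A * RtoC t) (fun t => B * RtoC (t * t / 2))).
    + evar_last. { apply cderiv_mult. apply @is_derive_const. apply cderiv_RtoC. apply @is_derive_id. }
      change (0 * RtoC t + A * 1 = A). ring.
    + evar_last. { apply cderiv_mult. apply @is_derive_const. apply cderiv_RtoC.
        instantiate (1 := t). auto_derive; auto. field. }
      change (0 * RtoC (t * t / 2) + B * RtoC t = B * RtoC t). ring.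
  - intros t _. apply ccont_plus; [apply ccont_const|]. apply ccont_mult; [apply ccont_const|].
    apply ccont_RtoC. apply continuous_id.
Qed.

Lemma SqInt_affine (A B : C) x y s : SqInt (fun z => A + B * z) x y s = 0.
Proof.
  assert (E1 : forall v u1 u2, J (fun t => A + B * (t, v)) u1 u2 =
     (A + B * Ci * RtoC v) * RtoC (u2 - u1) + B * RtoC ((u2 * u2 - u1 * u1) / 2)).
  { intros. apply J_unique. eapply CInt_ext; [|apply CInt_affine]. intros t _. cbv beta.
    replace ((t, v) : C) with (RtoC t + Ci * RtoC v) by (apply C_eq; simpl; ring). ring. }
  assert (E2 : forall v u1 u2, J (fun t => A + B * (v, t)) u1 u2 =
     (A + B * RtoC v) * RtoC (u2 - u1) + B * Ci * RtoC ((u2 * u2 - u1 * u1) / 2)).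
  { intros. apply J_unique. eapply CInt_ext; [|apply CInt_affine]. intros t _. cbv beta.
    replace ((v, t) : C) with (RtoC v + Ci * RtoC t) by (apply C_eq; simpl; ring). ring. }
  unfold SqInt. rewrite !E1, !E2.
  replace (x + s - x)%R with s by ring. replace (y + s - y)%R with s by ring.
  rewrite (RtoC_plus x s), (RtoC_plus y s).
  ring.
Qed.

(** * Goursat's lemma *)

Lemma quarter_large (z a b c d : C) : z = a + b + c + d ->
  (Cmod z / 4 <= Cmod a \/ Cmod z / 4 <= Cmod b \/ Cmod z / 4 <= Cmod c \/ Cmod z / 4 <= Cmod d)%R.
Proof.
  intros ->. assert (H1 := Cmod_triangle (a + b + c) d). assert (H2 := Cmod_triangle (a + b) c).
  assert (H3 := Cmod_triangle a b). lra.
Qed.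

Section Nested.

Variable Sq : R -> R -> R -> C.
Variable a x0 y0 s0 : R.
Hypothesis Hx0 : (a < x0)%R.
Hypothesis Hs0 : (0 < s0)%R.
Hypothesis Hadd : forall x y s, (a < x)%R -> (0 < s)%R ->
  Sq x y (s + s) = Sq x y s + Sq (x + s) y s + Sq x (y + s) s + Sq (x + s) (y + s) s.

Let side (n : nat) : R := (s0 / 2 ^ n)%R.

Let side_S n : side n = (side (S n) + side (S n))%R.
Proof. unfold side. simpl. field. apply pow_nonzero; lra. Qed.

Let side_pos n : (0 < side n)%R.
Proof. unfold side. apply Rdiv_lt_0_compat; auto. apply pow_lt; lra. Qed.

(** Keeps the first quarter that carries at least a fourth of the current modulus; if three of them
    fail, [quarter_large] leaves only the last. *)
Let next (n : nat) (p : R * R) : R * R :=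
  let (x, y) := p in
  let h := side (S n) in
  let A := (Cmod (Sq x y (side n)) / 4)%R in
  if Rle_dec A (Cmod (Sq x y h)) then (x, y)
  else if Rle_dec A (Cmod (Sq (x + h) y h)) then ((x + h)%R, y)
  else if Rle_dec A (Cmod (Sq x (y + h) h)) then (x, (y + h)%R)
  else ((x + h)%R, (y + h)%R).

Let corner : nat -> R * R := fix corner n :=
  match n with O => (x0, y0) | S k => next k (corner k) end.

Let X n := fst (corner n).
Let Y n := snd (corner n).

Let step n : (a < X n)%R ->
  (X n <= X (S n))%R /\ (X (S n) + side (S n) <= X n + side n)%R /\
  (Y n <= Y (S n))%R /\ (Y (S n) + side (S n) <= Y n + side n)%R /\
  (Cmod (Sq (X n) (Y n) (side n)) / 4 <=
    Cmod (Sq (X (S n)) (Y (S n)) (side (S n))))%R.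
Proof.
  unfold X, Y. simpl corner. destruct (corner n) as [x y]. simpl fst; simpl snd. intros Hx.
  assert (P := side_pos (S n)).
  assert (E := side_S n).
  assert (Q := quarter_large _ _ _ _ _ (Hadd x y (side (S n)) Hx P)).
  rewrite <- E in Q. unfold next.
  destruct (Rle_dec _ _) as [H|H]; simpl; [repeat split; lra|].
  destruct (Rle_dec _ _) as [H'|H']; simpl; [repeat split; lra|].
  destruct (Rle_dec _ _) as [H''|H'']; simpl; [repeat split; lra|].
  repeat split; lra.
Qed.

Let X_gt n : (a < X n)%R.
Proof. induction n as [|n IH]; [exact Hx0|]. destruct (step n IH) as [H _]. lra. Qed.

Let mono n k : (X n <= X (n + k) /\ X (n + k) + side (n + k) <= X n + side n /\
  Y n <= Y (n + k) /\ Y (n + k) + side (n + k) <= Y n + side n)%R.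
Proof.
  induction k as [|k IH]. { rewrite Nat.add_0_r. lra. }
  rewrite <- plus_n_Sm. destruct (step (n + k) (X_gt _)) as [H1 [H2 [H3 [H4 _]]]]. lra.
Qed.

Let big n : (Cmod (Sq x0 y0 s0) / 4 ^ n <= Cmod (Sq (X n) (Y n) (side n)))%R.
Proof.
  induction n as [|n IH].
  - unfold side; simpl. replace (s0 / 1)%R with s0 by field. change (X 0) with x0. change (Y 0) with y0. lra.
  - destruct (step n (X_gt _)) as [_ [_ [_ [_ H]]]].
    replace (Cmod (Sq x0 y0 s0) / 4 ^ S n)%R with (Cmod (Sq x0 y0 s0) / 4 ^ n / 4)%R.
    lra. simpl. field. apply pow_nonzero; lra.
Qed.

Lemma nested_limit (Z : nat -> R) :
  (forall n k, Z n <= Z (n + k)%nat /\ Z (n + k)%nat + side (n + k) <= Z n + side n)%R ->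
  exists p, forall n, (Z n <= p <= Z n + side n)%R.
Proof.
  intros H.
  assert (A : forall n m, (Z m <= Z n + side n)%R).
  { intros n m. destruct (Nat.le_ge_cases n m) as [L|L].
    - replace m with (n + (m - n))%nat by lia. destruct (H n (m - n)%nat) as [_ K].
      assert (P := side_pos (n + (m - n))). lra.
    - replace n with (m + (n - m))%nat by lia. destruct (H m (n - m)%nat) as [K _].
      assert (P := side_pos (m + (n - m))). lra. }
  destruct (completeness (fun z => exists n, z = Z n)) as [p [Hp1 Hp2]].
  - exists (Z 0%nat + side 0)%R. intros z [n ->]. apply A.
  - exists (Z 0%nat), 0%nat; auto.
  - exists p. intros n. split.
    + apply Hp1. exists n; auto.
    + apply Hp2. intros z [m ->]. apply A.
Qed.

(** The kept value shrinks at most by 4 per step, exactly as the area does. A value that is o(area)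
    on small squares around every point is therefore incompatible with a nonzero start. *)
Lemma nested_squares_zero :
  (forall px py, (x0 <= px <= x0 + s0)%R -> (y0 <= py <= y0 + s0)%R ->
     forall eps, (0 < eps)%R -> exists d, (0 < d)%R /\ forall x y s,
       (a < x)%R -> (0 < s < d)%R -> (x <= px <= x + s)%R -> (y <= py <= y + s)%R ->
       (Cmod (Sq x y s) <= eps * (s * s))%R) ->
  Sq x0 y0 s0 = 0.
Proof.
  intros Hsmall.
  destruct (nested_limit X) as [px Hpx]. { intros n k. destruct (mono n k) as [H1 [H2 _]]. auto. }
  destruct (nested_limit Y) as [py Hpy]. { intros n k. destruct (mono n k) as [_ [_ H]]. auto. }
  apply Cmod_eq_0. apply Rle_antisym; [|apply Cmod_ge_0].
  apply Rnot_lt_le. intros HA. set (A := Cmod (Sq x0 y0 s0)) in *.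
  assert (S0 : side 0 = s0) by (unfold side; simpl; field).
  assert (B1 := Hpx 0%nat). assert (B2 := Hpy 0%nat). rewrite S0 in B1, B2.
  change (X 0) with x0 in B1. change (Y 0) with y0 in B2.
  (* With this epsilon the N-th square would carry at most half of A / 4^N, while [big] gives at
     least A / 4^N. *)
  destruct (Hsmall px py B1 B2 (A / (2 * (s0 * s0)))%R) as [d [Hd K]].
  { apply Rdiv_lt_0_compat; nra. }
  destruct (pow_lt_1_zero (/ 2) ltac:(rewrite Rabs_pos_eq; lra) (d / s0)) as [N HN].
  { apply Rdiv_lt_0_compat; auto. }
  specialize (HN N (Nat.le_refl _)).
  assert (HNs : (side N < d)%R).
  { rewrite pow_inv, Rabs_pos_eq in HN.
    - unfold side. apply Rmult_lt_reg_l with (/ s0)%R; [apply Rinv_0_lt_compat; auto|].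
      replace (/ s0 * (s0 / 2 ^ N))%R with (/ 2 ^ N)%R by (field; split; [apply pow_nonzero; lra|lra]).
      unfold Rdiv in HN. rewrite Rmult_comm. auto.
    - left. apply Rinv_0_lt_compat. apply pow_lt; lra. }
  specialize (K (X N) (Y N) (side N) (X_gt N) (conj (side_pos N) HNs) (Hpx N) (Hpy N)).
  assert (G := big N). fold A in G.
  assert (E : (side N * side N = s0 * s0 / 4 ^ N)%R).
  { unfold side. replace 4%R with (2 * 2)%R by ring. rewrite Rpow_mult_distr. field. apply pow_nonzero; lra. }
  rewrite E in K.
  replace (A / (2 * (s0 * s0)) * (s0 * s0 / 4 ^ N))%R with (A / 4 ^ N / 2)%R in K.
  2:{ field. split; [apply pow_nonzero|]; lra. }
  assert (0 < A / 4 ^ N)%R by (apply Rdiv_lt_0_compat; auto; apply pow_lt; lra). lra.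
Qed.

End Nested.

Lemma Goursat_square f a x y s : (a < x)%R -> (0 < s)%R ->
  (forall z, (a < Re z)%R -> Ccont f z) ->
  (forall z, (x <= Re z <= x + s)%R -> (y <= Im z <= y + s)%R -> exists l, Cdiff f z l) ->
  SqInt f x y s = 0.
Proof.
  intros Hx Hs Hc Hd. apply (nested_squares_zero (SqInt f) a x y s Hx Hs).
  { intros. apply SqInt_quarter with a; auto. }
  intros px py Hpx Hpy eps He.
  destruct (Hd (px, py) Hpx Hpy) as [l Hl].
  (* Subtracting the affine part changes no integral. On a square of side h containing p, |z - p| <=
     2h < d, so the perimeter 4h times the error (eps/8) 2h gives eps h^2. *)
  destruct (Hl (eps / 8)%R ltac:(lra)) as [d [Hd0 K]].
  exists (d / 2)%R. split; [lra|]. intros u v h Hu Hh Hpu Hpv.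
  set (p := (px, py) : C) in *.
  set (A := f p - l * p).
  set (e := fun z => f z + (- A + - l * z)).
  assert (Hsd : forall z, on_sides u v h z -> Ccont f z).
  { intros z [Hz _]. apply Hc. lra. }
  assert (Haff : forall B D z, Ccont (fun z => B + D * z) z).
  { intros B D z. eapply Cdiff_Ccont. apply Cdiff_plus; [apply Cdiff_const|].
    apply Cdiff_mult; [apply Cdiff_const|apply Cdiff_id]. }
  assert (Hes : forall z, on_sides u v h z -> Ccont e z).
  { intros z Hz eps' He'. destruct (Hsd z Hz (eps' / 2)%R ltac:(lra)) as [d1 [D1 K1]].
    destruct (Haff (- A) (- l) z (eps' / 2)%R ltac:(lra)) as [d2 [D2 K2]].
    exists (Rmin d1 d2). split; [apply Rmin_case; auto|]. intros w Hw.
    specialize (K1 w (Rlt_le_trans _ _ _ Hw (Rmin_l _ _))).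
    specialize (K2 w (Rlt_le_trans _ _ _ Hw (Rmin_r _ _))).
    unfold e. replace (f w + (- A + - l * w) - (f z + (- A + - l * z))) with
      ((f w - f z) + ((- A + - l * w) - (- A + - l * z))) by ring.
    eapply Rle_lt_trans; [apply Cmod_triangle|]. lra. }
  assert (E : SqInt f u v h = SqInt e u v h).
  { unfold e. rewrite SqInt_plus, SqInt_affine; auto; [ring|lra]. }
  rewrite E.
  replace (eps * (h * h))%R with (4 * h * (eps / 8 * (2 * h)))%R by field.
  apply SqInt_bound; [lra|auto|].
  intros z [Hz1 [Hz2 _]].
  assert (Hzp : (Cmod (z - p) <= 2 * h)%R).
  { eapply Rle_trans; [apply Cmod_le_Rabs|]. unfold Cminus. rewrite re_plus, im_plus, re_opp, im_opp.
    unfold p; simpl.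
    assert (Rabs (Re z + - px) <= h)%R by (apply Rabs_le; lra).
    assert (Rabs (Im z + - py) <= h)%R by (apply Rabs_le; lra). lra. }
  unfold e, A. replace (f z + (- (f p - l * p) + - l * z)) with (f z - f p - l * (z - p)) by ring.
  eapply Rle_trans; [apply K; lra|]. apply Rmult_le_compat_l; lra.
Qed.

(* Only the four inner sixteenths touch the centre, so halving the square does not change the
   integral, which therefore tends to 0. *)
Lemma Goursat_punctured f a r : (0 < r)%R -> (a < - r)%R ->
  (forall z, (a < Re z)%R -> Ccont f z) ->
  (forall z, (a < Re z)%R -> z <> 0 -> exists l, Cdiff f z l) ->
  SqInt f (- r) (- r) (r + r) = 0.
Proof.
  intros Hr Ha Hc Hd.
  assert (half : forall r, (0 < r)%R -> (a < - r)%R ->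
    SqInt f (- r) (- r) (r + r) = SqInt f (- (r / 2)) (- (r / 2)) (r / 2 + r / 2)).
  { clear r Hr Ha. intros r Hr Ha.
    assert (Z : forall x y, (a < x)%R -> ~ (x <= 0 <= x + r / 2 /\ y <= 0 <= y + r / 2)%R -> SqInt f x y (r / 2) = 0).
    { intros x y Hx Hn. apply Goursat_square with a; auto; [lra|].
      intros z Hz1 Hz2. apply Hd; [lra|]. intros ->. simpl in *. apply Hn; lra. }
    rewrite !(SqInt_quarter f a) by (auto; lra).
    rewrite (Rplus_opp_l r).
    replace (SqInt f (- r) (- r) r) with (SqInt f (- r) (- r) (r / 2 + r / 2)) by (f_equal; field).
    replace (SqInt f 0 (- r) r) with (SqInt f 0 (- r) (r / 2 + r / 2)) by (f_equal; field).
    replace (SqInt f (- r) 0 r) with (SqInt f (- r) 0 (r / 2 + r / 2)) by (f_equal; field).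
    replace (SqInt f 0 0 r) with (SqInt f 0 0 (r / 2 + r / 2)) by (f_equal; field).
    rewrite !(SqInt_quarter f a) by (auto; lra).
    replace (- r + r / 2)%R with (- (r / 2))%R by field. rewrite !Rplus_0_l, !(Rplus_opp_l (r / 2)).
    rewrite (Z (- r) (- r))%R, (Z (- (r / 2)) (- r))%R, (Z (- r) (- (r / 2)))%R by lra.
    rewrite (Z 0 (- r))%R, (Z (r / 2) (- r))%R, (Z (r / 2) (- (r / 2)))%R by lra.
    rewrite (Z (- r) 0)%R, (Z (- r) (r / 2))%R, (Z (- (r / 2)) (r / 2))%R by lra.
    rewrite (Z (r / 2) 0)%R, (Z 0 (r / 2))%R, (Z (r / 2) (r / 2))%R by lra.
    ring. }
  assert (halves : forall n, SqInt f (- r) (- r) (r + r) = SqInt f (- (r / 2 ^ n)) (- (r / 2 ^ n)) (r / 2 ^ n + r / 2 ^ n)).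
  { induction n as [|n IH]. { simpl. replace (r / 1)%R with r by field. auto. }
    assert (P : (0 < r / 2 ^ n)%R) by (apply Rdiv_lt_0_compat; auto; apply pow_lt; lra).
    assert (P2 : (r / 2 ^ n <= r)%R).
    { apply Rle_div_l; [apply pow_lt; lra|]. assert (1 <= 2 ^ n)%R by (apply pow_R1_Rle; lra). nra. }
    rewrite IH, half by lra.
    replace (r / 2 ^ S n)%R with (r / 2 ^ n / 2)%R by (simpl; field; apply pow_nonzero; lra). auto. }
  apply Cmod_eq_0. apply Rle_antisym; [|apply Cmod_ge_0].
  apply Rnot_lt_le. intros HA.
  set (M := (Cmod (f 0) + 1)%R). assert (HM : (0 < M)%R) by (unfold M; assert (G := Cmod_ge_0 (f 0)); lra).
  destruct (Hc 0 ltac:(simpl; lra) 1%R ltac:(lra)) as [d [D0 K]].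
  set (A := Cmod (SqInt f (- r) (- r) (r + r))) in *.
  (* A square of half-side q < t lies in the disc of radius d, where |f| <= M, and its bound 8 q M
     is below A. *)
  set (t := Rmin (d / 2) (A / (8 * M))).
  assert (Ht : (0 < t)%R) by (apply Rmin_case; [lra|apply Rdiv_lt_0_compat; lra]).
  destruct (pow_lt_1_zero (/ 2) ltac:(rewrite Rabs_pos_eq; lra) (t / r)) as [N HN].
  { apply Rdiv_lt_0_compat; auto. }
  specialize (HN N (Nat.le_refl _)).
  set (q := (r / 2 ^ N)%R) in *.
  assert (Hq : (0 < q)%R) by (apply Rdiv_lt_0_compat; auto; apply pow_lt; lra).
  assert (Hqr : (q <= r)%R).
  { apply Rle_div_l; [apply pow_lt; lra|]. assert (1 <= 2 ^ N)%R by (apply pow_R1_Rle; lra). nra. }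
  assert (HNs : (q < t)%R).
  { rewrite pow_inv, Rabs_pos_eq in HN.
    - unfold q. apply Rmult_lt_reg_l with (/ r)%R; [apply Rinv_0_lt_compat; auto|].
      replace (/ r * (r / 2 ^ N))%R with (/ 2 ^ N)%R by (field; split; [apply pow_nonzero; lra|lra]).
      unfold Rdiv in HN. rewrite Rmult_comm. auto.
    - left. apply Rinv_0_lt_compat. apply pow_lt; lra. }
  assert (T1 := Rlt_le_trans _ _ _ HNs (Rmin_l _ _)).
  assert (T2 := Rlt_le_trans _ _ _ HNs (Rmin_r _ _)).
  assert (B : (Cmod (SqInt f (- q) (- q) (q + q)) <= 4 * (q + q) * M)%R).
  { apply SqInt_bound; [lra| |].
    - intros z [Hz _]. apply Hc. lra.
    - intros z [Hz1 [Hz2 _]].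
      assert (Hz : (Cmod (z - 0) < d)%R).
      { replace (z - 0) with z by ring. eapply Rle_lt_trans; [apply Cmod_le_Rabs|].
        assert (Rabs (Re z) <= q)%R by (apply Rabs_le; lra).
        assert (Rabs (Im z) <= q)%R by (apply Rabs_le; lra). lra. }
      specialize (K z Hz). assert (T := Cmod_triangle_sub (f z) (f 0)). unfold M. lra. }
  unfold q in B. rewrite <- halves in B. fold A q in B.
  assert (q * (8 * M) < A)%R.
  { apply Rmult_lt_reg_r with (/ (8 * M))%R; [apply Rinv_0_lt_compat; lra|].
    rewrite Rmult_assoc, Rinv_r, Rmult_1_r by lra. exact T2. }
  lra.
Qed.

(** * The identity theorem on a half-plane *)

Lemma on_sides_centred_ge r z : (0 < r)%R -> on_sides (- r) (- r) (r + r) z -> (r <= Cmod z)%R.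
Proof.
  intros Hr [_ [_ H]].
  assert (A := re_le_Cmod z). assert (B := im_le_Cmod z).
  assert (A1 := Rle_abs (Re z)). assert (A2 := Rle_abs (- Re z)). rewrite Rabs_Ropp in A2.
  assert (B1 := Rle_abs (Im z)). assert (B2 := Rle_abs (- Im z)). rewrite Rabs_Ropp in B2.
  destruct H as [H|[H|[H|H]]]; lra.
Qed.

(** The exact value is 2 pi i, but a positive lower bound suffices. After all sides are parametrised
    by t in [-r, r], the imaginary part of the total integrand is 4r / (t^2 + r^2) >= 2/r over a
    length 2r. Multiplying by -i moves it to the real part, where integrals can be compared. *)
Lemma SqInt_inv_lower r : (0 < r)%R -> (4 <= Cmod (SqInt (fun z : C => (/ z)%C) (- r) (- r) (r + r)))%R.
Proof.
  intros Hr.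
  assert (Hc : forall z, on_sides (- r) (- r) (r + r) z -> Ccont (fun z : C => / z) z).
  { intros z Hz. apply on_sides_centred_ge in Hz; auto.
    eapply Cdiff_Ccont. apply Cdiff_inv. apply Cmod_gt_0. lra. }
  destruct (SqInt_correct (fun z : C => / z) (- r) (- r) (r + r) ltac:(lra) Hc) as [H1 [H2 [H3 H4]]].
  assert (H := CInt_plus _ _ _ _ _ _ (CInt_minus _ _ _ _ _ _ H1 H2)
     (CInt_mult_l Ci _ _ _ _ (CInt_minus _ _ _ _ _ _ H3 H4))).
  fold (SqInt (fun z : C => / z) (- r) (- r) (r + r)) in H.
  set (W := SqInt (fun z : C => / z) (- r) (- r) (r + r)) in *.
  assert (H' := CInt_mult_l (- Ci) _ _ _ _ H). apply CInt_Re in H'.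
  assert (E : Re (- Ci * W) = Im W). { destruct W; simpl; ring. }
  rewrite E in H'.
  eapply Rle_trans; [|apply im_le_Cmod]. eapply Rle_trans; [|apply Rle_abs].
  assert (G : is_RInt (fun _ => 2 / r)%R (- r) (- r + (r + r)) 4).
  { evar_last. apply (@is_RInt_const R_NormedModule).
    change ((- r + (r + r) - - r) * (2 / r) = 4)%R. field. lra. }
  refine (is_RInt_le _ _ _ _ _ _ _ G H' _). lra.
  intros t Ht.
  replace (- r + (r + r))%R with r by ring.
  assert (D : (0 < t * t + r * r)%R) by nra.
  assert (N1 : forall u v : R, (u * u + v * v = t * t + r * r)%R -> / ((u, v) : C) = ((u / (t * t + r * r))%R, (- v / (t * t + r * r))%R)).
  { intros u v Euv. unfold Cinv; simpl.
    replace (u * (u * 1) + v * (v * 1))%R with (t * t + r * r)%R by lra. reflexivity. }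
  rewrite (N1 t (- r)%R), (N1 t r), (N1 r t), (N1 (- r)%R t) by ring. simpl.
  match goal with |- (_ <= ?B)%R => replace B with (4 * r / (t * t + r * r))%R by (field; lra) end.
  apply Rle_trans with (4 * r / (r * r + r * r))%R. { right; field; repeat split; nra. }
  apply Rmult_le_compat_l; [lra|]. apply Rinv_le_contravar; nra.
Qed.

(** A weak Cauchy formula. The quotient (g(z) - g(0)) / z, completed by g'(0), is continuous and
    differentiable off 0, so the integral of g(z)/z is g(0) times that of 1/z. The first is at most
    8r M/r, the second at least 4 |g(0)|; the resulting factor 2 is harmless because the estimate is
    later applied with arbitrarily high powers. *)
Lemma SqInt_bound_center g a r M : (0 < r)%R -> (a < - r)%R ->
  (forall z, (a < Re z)%R -> exists l, Cdiff g z l) ->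
  (forall z, on_sides (- r) (- r) (r + r) z -> (Cmod (g z) <= M)%R) ->
  (Cmod (g 0) <= 2 * M)%R.
Proof.
  intros Hr Ha Hd HM.
  destruct (Hd 0 ltac:(simpl; lra)) as [l Hl].
  set (h := fun z : C => if Ceq_dec z 0 then l else (g z - g 0) / z).
  assert (Hne : forall z : C, (a < Re z)%R -> z <> 0 -> exists m, Cdiff h z m).
  { intros z Haz Hz. destruct (Hd z Haz) as [m Hm].
    destruct (Cdiff_div (fun z => g z + - g 0) (fun z => z) z (m + 0) 1) as [n Hn]; auto.
    - apply Cdiff_plus; auto. apply Cdiff_const.
    - apply Cdiff_id.
    - exists n. apply (Cdiff_ext_loc _ h z n (Cmod z)) in Hn; auto.
      + apply (proj1 (Cmod_gt_0 z)); auto.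
      + intros w Hw. unfold h. destruct (Ceq_dec w 0) as [->|_]; auto.
        replace (0 - z) with (- z) in Hw by ring. rewrite Cmod_opp in Hw. lra. }
  assert (H0 : h 0 = l). { unfold h. destruct (Ceq_dec 0 0); congruence. }
  assert (Hc : forall z, (a < Re z)%R -> Ccont h z).
  { intros z Hz. destruct (Ceq_dec z 0) as [->|Hz0].
    - intros eps He. destruct (Hl (eps / 2)%R ltac:(lra)) as [d [D K]]. exists d. split; auto.
      intros w Hw. rewrite H0. unfold h. destruct (Ceq_dec w 0) as [->|Hw0].
      { replace (l - l) with (RtoC 0) by ring. rewrite Cmod_0; auto. }
      specialize (K w Hw). replace (w - 0) with w in * by ring.
      replace ((g w - g 0) / w - l) with ((g w - g 0 - l * w) * / w) by (field; auto).
      rewrite Cmod_mult, Cmod_inv by auto. assert (P := proj1 (Cmod_gt_0 w) Hw0).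
      apply Rle_lt_trans with (eps / 2 * Cmod w * / Cmod w)%R.
      { apply Rmult_le_compat_r; auto. left; apply Rinv_0_lt_compat; auto. }
      rewrite Rmult_assoc, Rinv_r by lra. lra.
    - destruct (Hne z Hz Hz0) as [m Hm]. eapply Cdiff_Ccont; eauto. }
  assert (Z := Goursat_punctured h a r Hr Ha Hc Hne).
  assert (Hside : forall z, on_sides (- r) (- r) (r + r) z -> z <> 0 /\ (a < Re z)%R /\ (r <= Cmod z)%R).
  { intros z Hz. assert (B := on_sides_centred_ge r z Hr Hz). repeat split; auto.
    - apply Cmod_gt_0. lra.
    - destruct Hz as [Hz _]. lra. }
  assert (Ci1 : forall z, on_sides (- r) (- r) (r + r) z -> Ccont (fun z : C => / z) z).
  { intros z Hz. eapply Cdiff_Ccont. apply Cdiff_inv. apply Hside; auto. }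
  assert (Ci2 : forall z, on_sides (- r) (- r) (r + r) z -> Ccont (fun z : C => g z * / z) z).
  { intros z Hz. destruct (Hd z) as [m Hm]. apply Hside; auto.
    eapply Cdiff_Ccont. apply Cdiff_mult; [exact Hm|]. apply Cdiff_inv. apply Hside; auto. }
  assert (Ci3 : forall z, on_sides (- r) (- r) (r + r) z -> Ccont (fun z : C => - g 0 * / z) z).
  { intros z Hz. eapply Cdiff_Ccont. apply Cdiff_mult; [apply Cdiff_const|]. apply Cdiff_inv. apply Hside; auto. }
  rewrite (SqInt_ext h (fun z => g z * / z + - g 0 * / z)) in Z; [|lra|].
  2:{ intros z Hz. unfold h. destruct (Ceq_dec z 0) as [E|_]. { destruct (Hside z Hz); contradiction. }
      unfold Cdiv, Cminus. ring. }
  rewrite SqInt_plus, SqInt_mult_l in Z; auto; try lra.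
  set (W := SqInt (fun z : C => / z) (- r) (- r) (r + r)) in *.
  set (V := SqInt (fun z : C => g z * / z) (- r) (- r) (r + r)) in *.
  assert (E : V = g 0 * W). { replace V with (V + - g 0 * W + g 0 * W) by ring. rewrite Z. ring. }
  assert (LW := SqInt_inv_lower r Hr). fold W in LW.
  assert (LV : (Cmod V <= 4 * (r + r) * (M * / r))%R).
  { apply SqInt_bound; auto; [lra|]. intros z Hz. destruct (Hside z Hz) as [Hz0 [_ Hzr]].
    rewrite Cmod_mult, Cmod_inv by auto. apply Rmult_le_compat; try apply Cmod_ge_0; auto.
    - left; apply Rinv_0_lt_compat; lra.
    - apply Rinv_le_contravar; auto. }
  replace (4 * (r + r) * (M * / r))%R with (8 * M)%R in LV by (field; lra).
  rewrite E, Cmod_mult in LV. assert (P := Cmod_ge_0 (g 0)). nra.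
Qed.

Lemma ccont_bounded (f : R -> C) (a b : R) : (a <= b)%R -> (forall t, (a <= t <= b)%R -> ccont f t) ->
  exists M, forall t, (a <= t <= b)%R -> (Cmod (f t) <= M)%R.
Proof.
  intros Hab H.
  destruct (continuity_ab_maj (fun t => Cmod (f t)) a b Hab) as [m [Hm _]].
  - intros t Ht. apply continuity_pt_filterlim.
    apply (filterlim_locally (fun t => Cmod (f t)) (Cmod (f t))). intros eps.
    destruct (continuous_C_inv f t eps (H t Ht) (cond_pos eps)) as [d [D K]].
    exists (mkposreal d D). intros y Hy. specialize (K y Hy).
    change (Rabs (Cmod (f y) - Cmod (f t)) < eps)%R.
    assert (T1 := Cmod_triangle_sub (f y) (f t)). assert (T2 := Cmod_triangle_sub (f t) (f y)).
    rewrite Cmod_minus_sym in T2. apply Rabs_def1; lra.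
  - exists (Cmod (f m)). auto.
Qed.

Lemma sides_bounded f x y s : (0 <= s)%R -> (forall z, on_sides x y s z -> Ccont f z) ->
  exists M, forall z, on_sides x y s z -> (Cmod (f z) <= M)%R.
Proof.
  intros Hs Hc.
  destruct (ccont_bounded (fun t => f (t, y)) x (x + s)) as [M1 K1]; [lra| |].
  { intros t Ht. apply Ccont_horizontal. apply Hc. unfold on_sides; simpl; lra. }
  destruct (ccont_bounded (fun t => f (t, (y + s)%R)) x (x + s)) as [M2 K2]; [lra| |].
  { intros t Ht. apply Ccont_horizontal. apply Hc. unfold on_sides; simpl; lra. }
  destruct (ccont_bounded (fun t => f (x, t)) y (y + s)) as [M3 K3]; [lra| |].
  { intros t Ht. apply Ccont_vertical. apply Hc. unfold on_sides; simpl; lra. }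
  destruct (ccont_bounded (fun t => f ((x + s)%R, t)) y (y + s)) as [M4 K4]; [lra| |].
  { intros t Ht. apply Ccont_vertical. apply Hc. unfold on_sides; simpl; lra. }
  exists (Rmax (Rmax M1 M2) (Rmax M3 M4)).
  assert (R1 := Rmax_l M1 M2). assert (R2 := Rmax_r M1 M2).
  assert (R3 := Rmax_l M3 M4). assert (R4 := Rmax_r M3 M4).
  assert (R5 := Rmax_l (Rmax M1 M2) (Rmax M3 M4)). assert (R6 := Rmax_r (Rmax M1 M2) (Rmax M3 M4)).
  intros [u v] [Hu [Hv H]]. simpl in Hu, Hv, H.
  destruct H as [E|[E|[E|E]]].
  - rewrite E. specialize (K3 v Hv). lra.
  - rewrite E. specialize (K4 v Hv). lra.
  - rewrite E. specialize (K1 u Hu). lra.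
  - rewrite E. specialize (K2 u Hu). lra.
Qed.

Lemma Cdiff_pow f z l n : Cdiff f z l -> exists m, Cdiff (fun w => f w ^ n) z m.
Proof.
  intros H. induction n as [|n [m IH]].
  - exists 0. apply (Cdiff_const 1).
  - eexists. exact (Cdiff_mult _ _ _ _ _ H IH).
Qed.

(** Let rho be the distance from z1 to the line Re z = a, and let q = rho/4. The threshold 4/5 says
    that z1 + q lies in the zero region: rho + rho/4 > b - a. On a square of half-side 3 rho/4 about
    z1 the distance to z1 + q is at least rho/2, but at the centre it is rho/4, so dividing f by the
    n-th power of that distance yields |f(z1)| <= 2M 2^-n. *)
Lemma half_plane_vanish_step f a b z1 : (a < b)%R ->
  (forall z, (a < Re z)%R -> exists l, Cdiff f z l) ->
  (forall z, (b < Re z)%R -> f z = 0) ->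
  (a + 4 / 5 * (b - a) < Re z1)%R -> f z1 = 0.
Proof.
  intros Hab Hd Hb Hz1.
  set (rho := (Re z1 - a)%R). assert (Hrho : (0 < rho)%R) by (unfold rho; lra).
  set (r := (3 / 4 * rho)%R). assert (Hr : (0 < r)%R) by (unfold r; lra).
  set (q := RtoC (rho / 4)).
  assert (Hq : (b < Re (z1 + q))%R). { rewrite re_plus. unfold q, rho; simpl. lra. }
  set (f1 := fun w => f (z1 + w)).
  assert (Hf1 : forall w, (- rho < Re w)%R -> exists l, Cdiff f1 w l).
  { intros w Hw. destruct (Hd (z1 + w)) as [l Hl]. { rewrite re_plus. unfold rho in Hw. lra. }
    exists l. apply Cdiff_translate. auto. }
  destruct (sides_bounded f1 (- r) (- r) (r + r)) as [M HM]; [lra| |].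
  { intros z [Hz _]. destruct (Hf1 z) as [l Hl]. unfold r in Hz; lra. eapply Cdiff_Ccont; eauto. }
  assert (Bound : forall n, (Cmod (f z1) <= 2 * M * (/ 2) ^ n)%R).
  { intros n. set (g := fun w => f1 w * (/ (w - q)) ^ n).
    assert (Hg : (Cmod (g 0) <= 2 * (M * (2 / rho) ^ n))%R).
    { apply SqInt_bound_center with (a := (- rho)%R) (r := r); auto.
      - unfold r; lra.
      (* Around q the factor [f1] is identically 0, hence so is [g], whatever value the inverse
         takes at 0. *)
      - intros w Hw. destruct (Ceq_dec w q) as [->|Hwq].
        + exists 0. apply (Cdiff_ext_loc (fun _ => 0) g q 0 (Re (z1 + q) - b)); [lra| |apply Cdiff_const].
          intros w' Hw'. unfold g, f1. rewrite Hb; [ring|].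
          assert (T := re_le_Cmod (w' - q)). assert (T2 := Rle_abs (- Re (w' - q))). rewrite Rabs_Ropp in T2.
          unfold Cminus in *. rewrite re_plus in *. rewrite re_opp in *. lra.
        + destruct (Hf1 w Hw) as [l Hl].
          destruct (Cdiff_pow (fun w => 1 / (w + - q)) w) with (l := - / ((w - q) * (w - q))) (n := n) as [m Hm].
          { apply Cdiff_ext with (fun w => / (- q + w)).
            { intros w'. unfold Cdiv. rewrite Cmult_1_l. f_equal. ring. }
            apply (Cdiff_translate (fun w => / w) (- q) w).
            replace (w - q) with (- q + w) by ring. apply Cdiff_inv.
            intros E. apply Hwq. replace w with (- q + w + q) by ring. rewrite E. ring. }
          exists (l * (1 / (w + - q)) ^ n + f1 w * m).
          apply Cdiff_ext with (fun w => f1 w * (1 / (w + - q)) ^ n).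
          { intros w'. unfold g, Cdiv. rewrite Cmult_1_l. reflexivity. }
          apply (Cdiff_mult _ (fun w => (1 / (w + - q)) ^ n)); auto.
      - intros w Hw. unfold g. rewrite Cmod_mult, Cmod_pow.
        assert (Hw1 := on_sides_centred_ge r w Hr Hw).
        assert (T := Cmod_triangle_sub w q).
        assert (Eq : Cmod q = (rho / 4)%R) by (unfold q; rewrite Cmod_RtoC_pos; lra).
        assert (Hwq : (rho / 2 <= Cmod (w - q))%R) by (unfold r in *; lra).
        assert (Hn : w - q <> 0) by (apply Cmod_gt_0; lra).
        apply Rmult_le_compat; try apply Cmod_ge_0; auto. { apply pow_le. apply Cmod_ge_0. }
        apply pow_incr. split; [apply Cmod_ge_0|]. rewrite Cmod_inv by auto.
        replace (2 / rho)%R with (/ (rho / 2))%R by (field; lra). apply Rinv_le_contravar; lra. }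
    assert (Eg : (Cmod (g 0) = Cmod (f z1) * (4 / rho) ^ n)%R).
    { unfold g, f1. rewrite Cmod_mult, Cmod_pow. replace (z1 + 0) with z1 by ring. f_equal. f_equal.
      assert (Eq : Cmod (0 - q) = (rho / 4)%R).
      { replace (0 - q) with (- q) by ring. rewrite Cmod_opp. unfold q; rewrite Cmod_RtoC_pos; lra. }
      rewrite Cmod_inv. rewrite Eq. field. lra. apply Cmod_gt_0. lra. }
    rewrite Eg in Hg.
    assert (P : (0 < (4 / rho) ^ n)%R) by (apply pow_lt; apply Rdiv_lt_0_compat; lra).
    apply Rmult_le_reg_r with ((4 / rho) ^ n)%R; auto.
    replace (2 * M * (/ 2) ^ n * (4 / rho) ^ n)%R with (2 * (M * (2 / rho) ^ n))%R; auto.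
    rewrite (Rmult_assoc (2 * M)), <- Rpow_mult_distr. replace (/ 2 * (4 / rho))%R with (2 / rho)%R by (field; lra). ring. }
  apply Cmod_eq_0. apply Rle_antisym; [|apply Cmod_ge_0].
  assert (Lim : is_lim_seq (fun n => 2 * M * (/ 2) ^ n)%R (2 * M * 0)%R).
  { apply (is_lim_seq_scal_l _ (2 * M) 0). apply is_lim_seq_geom. rewrite Rabs_pos_eq; lra. }
  rewrite Rmult_0_r in Lim.
  refine (is_lim_seq_le (fun _ => Cmod (f z1)) _ (Cmod (f z1)) 0 Bound _ Lim). apply is_lim_seq_const.
Qed.

(** Each step multiplies the remaining gap b - a by 4/5. The line Re z = a is never reached, but
    every point to its right is passed after finitely many steps. *)
Theorem half_plane_vanish f a b : (forall z, (a < Re z)%R -> exists l, Cdiff f z l) ->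
  (forall z, (b < Re z)%R -> f z = 0) -> forall z, (a < Re z)%R -> f z = 0.
Proof.
  intros Hd Hb z Hz. destruct (Rle_dec b a) as [Hba|Hab]. { apply Hb; lra. }
  assert (It : forall n z, (a + (4 / 5) ^ n * (b - a) < Re z)%R -> f z = 0).
  { induction n as [|n IH]; intros w Hw. { apply Hb. simpl in Hw. lra. }
    assert (P : (0 < (4 / 5) ^ n)%R) by (apply pow_lt; lra).
    apply half_plane_vanish_step with (a := a) (b := (a + (4 / 5) ^ n * (b - a))%R); auto.
    - nra.
    - simpl in Hw. lra. }
  destruct (pow_lt_1_zero (4 / 5) ltac:(rewrite Rabs_pos_eq; lra) ((Re z - a) / (b - a))) as [N HN].
  { apply Rdiv_lt_0_compat; lra. }
  specialize (HN N (Nat.le_refl _)). rewrite Rabs_pos_eq in HN by (apply pow_le; lra).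
  apply (It N). apply Rlt_div_r in HN; lra.
Qed.

Theorem half_plane_identity f g a b : (forall z, (a < Re z)%R -> exists l, Cdiff f z l) ->
  (forall z, (a < Re z)%R -> exists l, Cdiff g z l) ->
  (forall z, (b < Re z)%R -> f z = g z) -> forall z, (a < Re z)%R -> f z = g z.
Proof.
  intros Hf Hg E z Hz.
  assert (K : f z + - (1) * g z = 0).
  { apply (half_plane_vanish (fun z => f z + - (1) * g z) a b); auto.
    - intros w Hw. destruct (Hf w Hw) as [l Hl]. destruct (Hg w Hw) as [m Hm]. eexists.
      apply Cdiff_plus; [exact Hl|]. apply Cdiff_mult; [apply Cdiff_const|exact Hm].
    - intros w Hw. rewrite E; auto. ring. }
  replace (f z) with (f z + - (1) * g z + g z) by ring. rewrite K. ring.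
Qed.

(** * Complex series *)

Definition Cser (a : nat -> C) (l : C) : Prop :=
  forall eps, (0 < eps)%R -> exists N, forall n, (N <= n)%nat -> (Cmod (csum n a - l) < eps)%R.

Lemma csum_sum_n a n : @sum_n C_AbelianMonoid a n = csum n a.
Proof. induction n as [|n IH]; [apply sum_O|]. rewrite sum_Sn, IH. reflexivity. Qed.

Lemma Cser_is_series a l : Cser a l <-> @is_series C_AbsRing C_NormedModule a l.
Proof.
  split.
  - intros H. apply filterlim_locally. intros eps. destruct (H eps (cond_pos eps)) as [N HN].
    exists N. intros n Hn. apply C_NormedModule_mixin_compat1.
    specialize (HN n Hn). rewrite <- csum_sum_n in HN. exact HN.
  - intros H eps He.
    assert (He' : (0 < eps / 2)%R) by lra.
    destruct (proj1 (filterlim_locally _ _) H (mkposreal _ He')) as [N HN].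
    exists N. intros n Hn. specialize (HN n Hn). rewrite <- csum_sum_n.
    replace eps with (2 * (eps / 2))%R by field. apply ball_Cmod. exact HN.
Qed.

Lemma csum_ext n f g : (forall k, (k <= n)%nat -> f k = g k) -> csum n f = csum n g.
Proof.
  induction n as [|n IH]; intros H; simpl; [apply H; lia|].
  rewrite IH, (H (S n)) by (auto; intros; apply H; lia). auto.
Qed.

Lemma csum_plus n f g : csum n (fun k => f k + g k) = csum n f + csum n g.
Proof. induction n as [|n IH]; simpl; auto. rewrite IH. ring. Qed.

Lemma csum_mult_l n c f : csum n (fun k => c * f k) = c * csum n f.
Proof. induction n as [|n IH]; simpl; auto. rewrite IH. ring. Qed.

Lemma Cser_ext a b l : (forall n, a n = b n) -> Cser a l -> Cser b l.
Proof.
  intros E H eps He. destruct (H eps He) as [N HN]. exists N. intros n Hn.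
  rewrite <- (csum_ext n a b); auto.
Qed.

Lemma small_eq (a b : C) : (forall eps, (0 < eps)%R -> (Cmod (a - b) < eps)%R) -> a = b.
Proof.
  intros H. apply Ceq_minus. apply Cmod_eq_0. apply Rle_antisym; [|apply Cmod_ge_0].
  apply Rnot_lt_le. intros K. specialize (H _ K). lra.
Qed.

Lemma Cser_unique a l l' : Cser a l -> Cser a l' -> l = l'.
Proof.
  intros H H'. apply small_eq. intros eps He.
  destruct (H (eps / 2)%R ltac:(lra)) as [N HN]. destruct (H' (eps / 2)%R ltac:(lra)) as [N' HN'].
  specialize (HN (N + N')%nat ltac:(lia)). specialize (HN' (N + N')%nat ltac:(lia)).
  replace (l - l') with ((csum (N + N') a - l') - (csum (N + N') a - l)) by ring.
  eapply Rle_lt_trans; [apply Cmod_minus_le|]. lra.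
Qed.

Lemma Cser_mult_l c a l : Cser a l -> Cser (fun n => c * a n) (c * l).
Proof.
  intros H eps He. assert (P := Cmod_ge_0 c).
  destruct (H (eps / (Cmod c + 1))%R) as [N HN]. { apply Rdiv_lt_0_compat; lra. }
  exists N. intros n Hn. specialize (HN n Hn). rewrite csum_mult_l.
  replace (c * csum n a - c * l) with (c * (csum n a - l)) by ring. rewrite Cmod_mult.
  apply Rlt_div_r in HN; [|lra]. assert (Q := Cmod_ge_0 (csum n a - l)). nra.
Qed.

Lemma Cser_plus a b l m : Cser a l -> Cser b m -> Cser (fun n => a n + b n) (l + m).
Proof.
  intros H H' eps He.
  destruct (H (eps / 2)%R ltac:(lra)) as [N HN]. destruct (H' (eps / 2)%R ltac:(lra)) as [N' HN'].
  exists (N + N')%nat. intros n Hn. specialize (HN n ltac:(lia)). specialize (HN' n ltac:(lia)).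
  rewrite csum_plus. replace (csum n a + csum n b - (l + m)) with ((csum n a - l) + (csum n b - m)) by ring.
  eapply Rle_lt_trans; [apply Cmod_triangle|]. lra.
Qed.

Lemma Cser_csum (q : nat) (a : nat -> nat -> C) (l : nat -> C) :
  (forall k, (k <= q)%nat -> Cser (a k) (l k)) -> Cser (fun n => csum q (fun k => a k n)) (csum q l).
Proof.
  induction q as [|q IH]; intros H; simpl. { apply Cser_ext with (a 0%nat); auto. }
  apply Cser_plus; auto.
Qed.

Lemma csum_diff_bound (a : nat -> C) (b : nat -> R) n k : (forall n, (Cmod (a n) <= b n)%R) ->
  (Cmod (csum (n + k) a - csum n a) <= sum_n b (n + k) - sum_n b n)%R.
Proof.
  intros H. induction k as [|k IH].
  - rewrite Nat.add_0_r. replace (csum n a - csum n a) with (RtoC 0) by ring. rewrite Cmod_0. lra.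
  - rewrite <- plus_n_Sm, sum_Sn. simpl csum.
    replace (csum (n + k) a + a (S (n + k)) - csum n a) with ((csum (n + k) a - csum n a) + a (S (n + k))) by ring.
    eapply Rle_trans; [apply Cmod_triangle|]. specialize (H (S (n + k))).
    change (plus (sum_n b (n + k)) (b (S (n + k)))) with (sum_n b (n + k) + b (S (n + k)))%R. lra.
Qed.

Lemma sum_n_le_Series b n : (forall n, (0 <= b n)%R) -> ex_series b -> (sum_n b n <= Series b)%R.
Proof.
  intros Hp [l Hl]. rewrite (is_series_unique _ _ Hl).
  apply (is_lim_seq_incr_compare (sum_n b)); auto.
  intros k. rewrite sum_Sn. specialize (Hp (S k)).
  change (plus (sum_n b k) (b (S k))) with (sum_n b k + b (S k))%R. lra.
Qed.

Lemma Cser_tail_bound a b l n : (forall n, (Cmod (a n) <= b n)%R) -> ex_series b -> Cser a l ->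
  (Cmod (l - csum n a) <= Series b - sum_n b n)%R.
Proof.
  intros H Hb Hl.
  assert (Hp : forall n, (0 <= b n)%R) by (intros k; specialize (H k); assert (P := Cmod_ge_0 (a k)); lra).
  apply Rnot_lt_le. intros K.
  set (e := (Cmod (l - csum n a) - (Series b - sum_n b n))%R) in *.
  destruct (Hl e ltac:(unfold e; lra)) as [N HN]. specialize (HN (n + N)%nat ltac:(lia)).
  assert (D := csum_diff_bound a b n N H). assert (S := sum_n_le_Series b (n + N) Hp Hb).
  assert (T := Cmod_triangle_sub (l - csum n a) (csum (n + N) a - csum n a)).
  replace (l - csum n a - (csum (n + N) a - csum n a)) with (- (csum (n + N) a - l)) in T by ring.
  rewrite Cmod_opp in T. unfold e in HN. lra.
Qed.

Lemma Cser_bound a b l : (forall n, (Cmod (a n) <= b n)%R) -> ex_series b -> Cser a l ->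
  (Cmod l <= Series b)%R.
Proof.
  intros H Hb Hl. assert (T := Cser_tail_bound a b l 0%nat H Hb Hl). rewrite sum_O in T.
  specialize (H 0%nat). simpl csum in T. assert (T2 := Cmod_triangle_sub l (a 0%nat)). lra.
Qed.

Lemma Cser_ex a b : (forall n, (Cmod (a n) <= b n)%R) -> ex_series b -> exists l, Cser a l.
Proof.
  intros H Hb.
  destruct (@ex_series_le C_AbsRing C_CompleteNormedModule a b) as [l Hl]; auto.
  exists l. apply Cser_is_series. exact Hl.
Qed.

Lemma Series_tail_small b eps : ex_series b -> (0 < eps)%R -> exists N, forall n, (N <= n)%nat ->
  (Series b - sum_n b n < eps)%R.
Proof.
  intros Hb He. assert (H := Series_correct b Hb).
  destruct (proj1 (filterlim_locally _ _) H (mkposreal _ He)) as [N HN]. exists N. intros n Hn.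
  specialize (HN n Hn). change (Rabs (sum_n b n - Series b) < eps)%R in HN.
  apply Rabs_def2 in HN. lra.
Qed.

(** * Improper integrals over the half-line *)

(** The two independent cutoffs are a rectangle of the product filter behind [is_RInt_gen];
    [al <= be] ensures a < b, so that bounds over [a, b] apply. Existence of the proper integrals is
    part of the assertion. *)
Definition IInt (f : R -> C) (l : C) : Prop :=
  forall eps, (0 < eps)%R -> exists al be, (0 < al <= be)%R /\
    forall a b, (0 < a < al)%R -> (be < b)%R -> exists I : C, CInt f a b I /\ (Cmod (I - l) < eps)%R.

Lemma IInt_is_RInt_gen f l : IInt f l ->
  @is_RInt_gen C_R_NormedModule f (at_right 0) (Rbar_locally p_infty) l.
Proof.
  intros H. intros P [eps HP]. destruct (H eps (cond_pos eps)) as [al [be [Hab K]]].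
  apply Filter_prod with (fun a => (0 < a < al)%R) (fun b => (be < b)%R).
  - exists (mkposreal al (proj1 Hab)). intros y Hy Hy0. split; auto.
    change (Rabs (y - 0) < al)%R in Hy. rewrite Rminus_0_r, Rabs_pos_eq in Hy; lra.
  - exists be. auto.
  - intros a b Ha Hb. destruct (K a b Ha Hb) as [I [HI HC]]. exists I. split; auto.
    apply HP. apply C_NormedModule_mixin_compat1. exact HC.
Qed.

Lemma IInt_common f g lf lg eps : IInt f lf -> IInt g lg -> (0 < eps)%R ->
  exists al be, (0 < al <= be)%R /\ forall a b, (0 < a < al)%R -> (be < b)%R ->
    exists I I' : C, CInt f a b I /\ (Cmod (I - lf) < eps)%R /\ CInt g a b I' /\ (Cmod (I' - lg) < eps)%R.
Proof.
  intros Hf Hg He. destruct (Hf eps He) as [a1 [b1 [H1 K1]]]. destruct (Hg eps He) as [a2 [b2 [H2 K2]]].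
  exists (Rmin a1 a2), (Rmax b1 b2).
  assert (M1 := Rmin_l a1 a2). assert (M2 := Rmin_r a1 a2).
  assert (M3 := Rmax_l b1 b2). assert (M4 := Rmax_r b1 b2).
  split. { split; [apply Rmin_case; lra|lra]. }
  intros a b Ha Hb. destruct (K1 a b) as [I [HI HI']]; try lra.
  destruct (K2 a b) as [I' [HJ HJ']]; try lra. exists I, I'. auto.
Qed.

Lemma IInt_unique f l l' : IInt f l -> IInt f l' -> l = l'.
Proof.
  intros H H'. apply small_eq. intros eps He.
  destruct (IInt_common f f l l' (eps / 2) H H' ltac:(lra)) as [al [be [Hab K]]].
  destruct (K (al / 2) (be + 1))%R as [I [I' [H1 [H2 [H3 H4]]]]]; try lra.
  rewrite (CInt_unique _ _ _ _ _ H3 H1) in H4.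
  replace (l - l') with ((I - l') - (I - l)) by ring.
  eapply Rle_lt_trans; [apply Cmod_minus_le|]. lra.
Qed.

Lemma IInt_plus f g l m : IInt f l -> IInt g m -> IInt (fun x => f x + g x) (l + m).
Proof.
  intros Hf Hg eps He.
  destruct (IInt_common f g l m (eps / 2) Hf Hg ltac:(lra)) as [al [be [Hab K]]].
  exists al, be. split; auto. intros a b Ha Hb.
  destruct (K a b Ha Hb) as [I [I' [H1 [H2 [H3 H4]]]]].
  exists (I + I'). split; [apply CInt_plus; auto|].
  replace (I + I' - (l + m)) with ((I - l) + (I' - m)) by ring.
  eapply Rle_lt_trans; [apply Cmod_triangle|]. lra.
Qed.

Lemma IInt_mult_l c f l : IInt f l -> IInt (fun x => c * f x) (c * l).
Proof.
  intros Hf eps He. assert (P := Cmod_ge_0 c).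
  destruct (Hf (eps / (Cmod c + 1))%R) as [al [be [Hab K]]]. { apply Rdiv_lt_0_compat; lra. }
  exists al, be. split; auto. intros a b Ha Hb. destruct (K a b Ha Hb) as [I [H1 H2]].
  exists (c * I). split; [apply CInt_mult_l; auto|].
  replace (c * I - c * l) with (c * (I - l)) by ring. rewrite Cmod_mult.
  apply Rlt_div_r in H2; [|lra]. assert (Q := Cmod_ge_0 (I - l)). nra.
Qed.

Lemma IInt_ext f g l : (forall x, (0 < x)%R -> f x = g x) -> IInt f l -> IInt g l.
Proof.
  intros E H eps He. destruct (H eps He) as [al [be [Hab K]]]. exists al, be. split; auto.
  intros a b Ha Hb. destruct (K a b Ha Hb) as [I [H1 H2]]. exists I. split; auto.
  apply CInt_ext with f; auto. intros x Hx. apply E. rewrite Rmin_left in Hx by lra. lra.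
Qed.

Lemma CInt_pos_ex (f : R -> C) (a b : R) : (forall x, (0 < x)%R -> ccont f x) -> (0 < a)%R -> (0 < b)%R -> exists I : C, CInt f a b I.
Proof.
  intros H Ha Hb. apply CInt_ex. intros x [Hx _]. apply H. revert Hx. apply Rmin_case; lra.
Qed.

(** The interval [1, 2] has length 1 and serves as a sample giving strict positivity; with c = 0 the
    lemma is plain positivity of the integral. *)
Lemma IInt_Re_ge (f : R -> C) (l : C) (c : R) : (forall x, (0 < x)%R -> ccont f x) -> IInt f l ->
  (forall x, (0 < x)%R -> (0 <= Re (f x))%R) ->
  (forall x, (1 <= x <= 2)%R -> (c <= Re (f x))%R) -> (c <= Re l)%R.
Proof.
  intros Hc H Hp H12. apply Rnot_lt_le. intros K.
  destruct (H (c - Re l)%R ltac:(lra)) as [al [be [Hab L]]].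
  set (a := (Rmin al 1 / 2)%R). set (b := (Rmax be 2 + 1)%R).
  assert (M1 := Rmin_l al 1). assert (M2 := Rmin_r al 1).
  assert (M3 := Rmax_l be 2). assert (M4 := Rmax_r be 2).
  assert (Ha : (0 < a)%R). { unfold a. apply Rdiv_lt_0_compat; [apply Rmin_case; lra|lra]. }
  assert (Ha1 : (a < 1)%R) by (unfold a; lra).
  assert (Hb2 : (2 < b)%R) by (unfold b; lra).
  destruct (L a b) as [I [HI HI']]. { unfold a in *; lra. } { unfold b; lra. }
  destruct (CInt_pos_ex f a 1 Hc) as [I1 H1]; try lra.
  destruct (CInt_pos_ex f 1 2 Hc) as [I2 H2]; try lra.
  destruct (CInt_pos_ex f 2 b Hc) as [I3 H3]; try lra.
  assert (E := CInt_unique _ _ _ _ _ HI (CInt_Chasles _ _ _ _ _ _ (CInt_Chasles _ _ _ _ _ _ H1 H2) H3)).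
  apply CInt_Re in H1. apply CInt_Re in H2. apply CInt_Re in H3.
  apply (f_equal Re) in E. rewrite !re_plus in E.
  assert (Z : forall u v, is_RInt (fun _ => 0%R) u v 0%R).
  { intros u v. evar_last. apply (@is_RInt_const R_NormedModule). apply Rmult_0_r. }
  assert (P1 : (0 <= Re I1)%R).
  { refine (is_RInt_le _ _ _ _ _ _ _ (Z _ _) H1 _); [lra|]. intros x Hx. apply Hp; lra. }
  assert (P3 : (0 <= Re I3)%R).
  { refine (is_RInt_le _ _ _ _ _ _ _ (Z _ _) H3 _); [lra|]. intros x Hx. apply Hp; lra. }
  assert (P2 : (c <= Re I2)%R).
  { assert (Zc : is_RInt (fun _ => c) 1 2 c).
    { evar_last. apply (@is_RInt_const R_NormedModule). change ((2 - 1) * c = c)%R. ring. }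
    refine (is_RInt_le _ _ _ _ _ _ _ Zc H2 _); [lra|]. intros x Hx. apply H12; lra. }
  assert (T := re_le_Cmod (I - l)). assert (T2 := Rle_abs (Re (I - l))).
  unfold Cminus in T, T2, HI'. rewrite re_plus, re_opp in *. lra.
Qed.

Lemma IInt_scale f l n : (0 < n)%R -> IInt f l -> IInt (fun x => f (n * x)%R) (l / RtoC n).
Proof.
  intros Hn H eps He.
  assert (Hn0 : RtoC n <> 0) by (apply RtoC_neq_0; lra).
  destruct (H (eps * n)%R) as [al [be [Hab K]]]. { nra. }
  exists (al / n)%R, (be / n)%R. split.
  { split; [apply Rdiv_lt_0_compat; lra|]. apply Rmult_le_compat_r; [left; apply Rinv_0_lt_compat; auto|lra]. }
  intros a b Ha Hb. destruct (K (n * a) (n * b))%R as [I [HI HI']].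
  { split; [nra|]. destruct Ha as [_ Ha]. apply Rlt_div_r in Ha; lra. }
  { apply Rlt_div_l in Hb; lra. }
  exists (/ RtoC n * I). split.
  - assert (G := @is_RInt_comp_lin C_R_NormedModule f n 0 a b I).
    rewrite !Rplus_0_r in G. specialize (G HI).
    assert (G2 := CInt_mult_l (/ RtoC n) _ _ _ _ G).
    apply CInt_ext with (2 := G2). intros x _. cbv beta. rewrite Rplus_0_r.

    change (/ RtoC n * @scal R_Ring C_R_ModuleSpace n (f (n * x)%R) = f (n * x)%R).
    rewrite scal_R_Cmult. field. auto.
  - replace (/ RtoC n * I - l / RtoC n) with ((I - l) * / RtoC n) by (field; auto).
    rewrite Cmod_mult, Cmod_inv, Cmod_RtoC_pos by (auto; lra). apply Rlt_div_l; auto.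
Qed.

Lemma IInt_FTC (F f : R -> C) : (forall x, (0 < x)%R -> cderiv F x (f x)) -> (forall x, (0 < x)%R -> ccont f x) ->
  (forall eps, (0 < eps)%R -> exists al be, (0 < al <= be)%R /\
     (forall a, (0 < a < al)%R -> (Cmod (F a) < eps)%R) /\ (forall b, (be < b)%R -> (Cmod (F b) < eps)%R)) ->
  IInt f 0.
Proof.
  intros HF Hf Hl eps He. destruct (Hl (eps / 2)%R ltac:(lra)) as [al [be [Hab [Ka Kb]]]].
  exists al, be. split; auto. intros a b Ha Hb. exists (F b - F a). split.
  - apply CInt_FTC; intros x Hx; rewrite Rmin_left in Hx by lra; [apply HF|apply Hf]; lra.
  - replace (F b - F a - 0) with (F b - F a) by ring. eapply Rle_lt_trans; [apply Cmod_minus_le|].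
    specialize (Ka a Ha). specialize (Kb b Hb). lra.
Qed.

Lemma CInt_dom_primitive (f : R -> C) (D d : R -> R) (a b : R) (I : C) : (0 < a <= b)%R -> (forall x, (0 < x)%R -> is_derive D x (d x)) ->
  (forall x, (0 < x)%R -> continuous d x) -> (forall x, (0 < x)%R -> (Cmod (f x) <= d x)%R) ->
  CInt f a b I -> (Cmod I <= D b - D a)%R.
Proof.
  intros Hab HD Hd Hf HI. apply (CInt_dominated f d a b I (D b - D a)); auto; try lra.
  - intros; apply Hf; lra.
  - apply (@is_RInt_derive R_CompleteNormedModule D d); intros x Hx; rewrite Rmin_left in Hx by lra; [apply HD|apply Hd]; lra.
Qed.

(** The dominating function enters through a primitive D with limits at both ends, so tails of the
    integral are bounded by increments of D. The integrals over [1/(n+1), n+1] are then Cauchy, and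
    their limit is the improper integral. *)
Lemma IInt_dominated (f : R -> C) (D d : R -> R) (d0 d1 : R) : (forall x, (0 < x)%R -> ccont f x) ->
  (forall x, (0 < x)%R -> is_derive D x (d x)) -> (forall x, (0 < x)%R -> continuous d x) ->
  (forall x, (0 < x)%R -> (Cmod (f x) <= d x)%R) ->
  (forall eps, (0 < eps)%R -> exists al be, (0 < al <= be)%R /\
     (forall a, (0 < a < al)%R -> (Rabs (D a - d0) < eps)%R) /\
     (forall b, (be < b)%R -> (Rabs (D b - d1) < eps)%R)) ->
  exists l, IInt f l /\ (Cmod l <= d1 - d0)%R.
Proof.
  intros Hc HD Hd Hf Hl.
  (* Integrals over two intervals differ by the pieces between corresponding endpoints, each bounded
     by the variation of D there. *)
  assert (Cmp : forall a b a' b' (I I' : C), (0 < a)%R -> (0 < b)%R -> (0 < a')%R -> (0 < b')%R ->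
     CInt f a b I -> CInt f a' b' I' -> (Cmod (I - I') <= Rabs (D a - D a') + Rabs (D b - D b'))%R).
  { intros a b a' b' I I' Ha Hb Ha' Hb' HI HI'.
    assert (Seg : forall u v (V : C), (0 < u)%R -> (0 < v)%R -> CInt f u v V -> (Cmod V <= Rabs (D u - D v))%R).
    { intros u v V Hu Hv HV. destruct (Rle_dec u v) as [L|L].
      - eapply Rle_trans; [apply (CInt_dom_primitive f D d u v V); auto|]. rewrite Rabs_minus_sym. apply Rle_abs.
      - apply (@is_RInt_swap C_R_NormedModule) in HV. rewrite <- (Cmod_opp V).
        eapply Rle_trans; [apply (CInt_dom_primitive f D d v u (- V)); auto; lra|]. apply Rle_abs. }
    destruct (CInt_pos_ex f a a' Hc Ha Ha') as [V HV].
    destruct (CInt_pos_ex f b' b Hc Hb' Hb) as [W HW].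
    assert (E := CInt_unique _ _ _ _ _ HI (CInt_Chasles _ _ _ _ _ _ (CInt_Chasles _ _ _ _ _ _ HV HI') HW)).
    rewrite E. replace (V + I' + W - I') with (V + W) by ring.
    eapply Rle_trans; [apply Cmod_triangle|].
    apply Seg in HV; auto. apply Seg in HW; auto. rewrite (Rabs_minus_sym (D b)). lra. }
  set (u := fun n => J f (/ INR (S n)) (INR (S n))).
  assert (Pn : forall n, (0 < / INR (S n))%R /\ (0 < INR (S n))%R).
  { intros n. assert (0 < INR (S n))%R by (apply lt_0_INR; lia). split; auto. apply Rinv_0_lt_compat; auto. }
  assert (Hu : forall n, CInt f (/ INR (S n)) (INR (S n)) (u n)).
  { intros n. destruct (Pn n). destruct (CInt_pos_ex f (/ INR (S n)) (INR (S n)) Hc) as [V HV]; auto.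
    unfold u. rewrite (J_unique _ _ _ _ HV). auto. }
  assert (Big : forall al be, (0 < al)%R -> exists N, forall n, (N <= n)%nat -> (/ INR (S n) < al)%R /\ (be < INR (S n))%R).
  { intros al be Hal. destruct (INR_unbounded (Rmax be (/ al))) as [N HN].
    exists N. intros n Hn. assert (INR N < INR (S n))%R by (apply lt_INR; lia).
    assert (M1 := Rmax_l be (/ al)). assert (M2 := Rmax_r be (/ al)). split; [|lra].
    rewrite <- (Rinv_inv al). apply Rinv_lt_contravar; [|lra].
    apply Rmult_lt_0_compat; [apply Rinv_0_lt_compat; auto|apply Pn]. }
  destruct (proj1 (@filterlim_locally_cauchy nat C_R_CompleteNormedModule eventually _ u)) as [l Hlim].
  { intros eps. assert (He : (0 < eps / 4)%R) by (destruct eps; simpl; lra).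
    destruct (Hl _ He) as [al [be [Hab [Ka Kb]]]]. destruct (Big al be) as [N HN]; [lra|].
    exists (fun n => (N <= n)%nat). split; [exists N; auto|]. intros n m Hn Hm.
    apply C_NormedModule_mixin_compat1.
    destruct (HN n Hn) as [A1 A2]. destruct (HN m Hm) as [B1 B2].
    destruct (Pn n) as [Q1 Q2]. destruct (Pn m) as [Q3 Q4].
    eapply Rle_lt_trans; [apply (Cmp _ _ _ _ _ _ Q3 Q4 Q1 Q2 (Hu m) (Hu n))|].
    assert (X1 := Ka _ (conj (proj1 (Pn n)) A1)). assert (X2 := Ka _ (conj (proj1 (Pn m)) B1)).
    assert (X3 := Kb _ A2). assert (X4 := Kb _ B2).
    apply Rabs_def2 in X1. apply Rabs_def2 in X2. apply Rabs_def2 in X3. apply Rabs_def2 in X4.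
    assert (Rabs (D (/ INR (S m)) - D (/ INR (S n))) < eps / 2)%R by (apply Rabs_def1; lra).
    assert (Rabs (D (INR (S m)) - D (INR (S n))) < eps / 2)%R by (apply Rabs_def1; lra). lra. }
  assert (Hlim' : forall eps, (0 < eps)%R -> exists N, forall n, (N <= n)%nat -> (Cmod (u n - l) < eps)%R).
  { intros eps He. assert (He' : (0 < eps / 2)%R) by lra.
    destruct (proj1 (filterlim_locally _ _) Hlim (mkposreal _ He')) as [N HN].
    exists N. intros n Hn. replace eps with (2 * (eps / 2))%R by field. apply ball_Cmod. exact (HN n Hn). }
  assert (HI : IInt f l).
  { intros eps He. destruct (Hl (eps / 8)%R ltac:(lra)) as [al [be [Hab [Ka Kb]]]].
    exists al, be. split; auto. intros a b Ha Hb.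
    destruct (CInt_pos_ex f a b Hc) as [I HI]; try lra. exists I. split; auto.
    destruct (Big al be) as [N1 HN1]; [lra|]. destruct (Hlim' (eps / 4)%R ltac:(lra)) as [N2 HN2].
    destruct (HN1 (N1 + N2)%nat ltac:(lia)) as [A1 A2]. specialize (HN2 (N1 + N2)%nat ltac:(lia)).
    set (n := (N1 + N2)%nat) in *. destruct (Pn n) as [P1 P2].
    assert (Hb0 : (0 < b)%R) by lra.
    assert (C1 := Cmp _ _ _ _ _ _ (proj1 Ha) Hb0 P1 P2 HI (Hu n)).
    assert (X1 := Ka _ (conj P1 A1)). assert (X2 := Ka _ Ha).
    assert (X3 := Kb _ A2). assert (X4 := Kb _ Hb).
    apply Rabs_def2 in X1. apply Rabs_def2 in X2. apply Rabs_def2 in X3. apply Rabs_def2 in X4.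
    assert (Rabs (D a - D (/ INR (S n))) < eps / 4)%R by (apply Rabs_def1; lra).
    assert (Rabs (D b - D (INR (S n))) < eps / 4)%R by (apply Rabs_def1; lra).
    replace (I - l) with ((I - u n) + (u n - l)) by ring.
    eapply Rle_lt_trans; [apply Cmod_triangle|]. lra. }
  exists l. split; auto. apply Rnot_lt_le. intros K.
  set (e := ((Cmod l - (d1 - d0)) / 4)%R). assert (He : (0 < e)%R) by (unfold e; lra).
  destruct (Hl e He) as [al [be [Hab [Ka Kb]]]]. destruct (HI e He) as [al' [be' [Hab' KI]]].
  assert (M1 := Rmin_l al al'). assert (M2 := Rmin_r al al').
  assert (M3 := Rmax_l be be'). assert (M4 := Rmax_r be be').
  assert (M5 : (0 < Rmin al al')%R) by (apply Rmin_case; lra).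
  destruct (KI (Rmin al al' / 2) (Rmax be be' + 1))%R as [I [H1 H2]]; try lra.
  assert (B := CInt_dom_primitive f D d (Rmin al al' / 2) (Rmax be be' + 1) I ltac:(lra) HD Hd Hf H1).
  assert (X1 := Ka (Rmin al al' / 2)%R ltac:(lra)). assert (X2 := Kb (Rmax be be' + 1)%R ltac:(lra)).
  apply Rabs_def2 in X1. apply Rabs_def2 in X2.
  assert (T := Cmod_triangle_sub l I). rewrite Cmod_minus_sym in T. unfold e in *. lra.
Qed.

(** * Mellin transforms *)

Lemma Rpower_pos x y : (0 < Rpower x y)%R.
Proof. apply exp_pos. Qed.

(* The integrand of Gamma is dominated by a multiple of the derivative of [sigmoid]. *)
Definition sigmoid (sg x : R) : R := (1 - / (1 + Rpower x sg))%R.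
Definition sigmoid' (sg x : R) : R := (sg * Rpower x (sg - 1) / (1 + Rpower x sg) ^ 2)%R.
(** The multiple in question: x^sg <= (2 sg)^sg e^(x/2) gives (1 + x^sg)^2 e^-x <= (1 + (2
    sg)^sg)^2. As [sigmoid] rises from 0 to 1, this constant also bounds the integral of x^(sg-1)
    e^-x. *)
Definition mconst (sg : R) : R := ((1 + Rpower (2 * sg) sg) ^ 2 / sg)%R.

Lemma mconst_pos sg : (0 < sg)%R -> (0 < mconst sg)%R.
Proof.
  intros H. apply Rdiv_lt_0_compat; auto. apply pow_lt. assert (P := Rpower_pos (2 * sg) sg). lra.
Qed.

Lemma Rpower_minus_1 x sg : (0 < x)%R -> (Rpower x (sg - 1) = Rpower x sg / x)%R.
Proof. intros H. unfold Rminus. rewrite Rpower_plus, Rpower_Ropp, Rpower_1 by auto. reflexivity. Qed.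

Lemma is_derive_sigmoid sg x : (0 < x)%R -> is_derive (sigmoid sg) x (sigmoid' sg x).
Proof.
  intros H. unfold sigmoid'. rewrite Rpower_minus_1 by auto. unfold sigmoid, Rpower.
  assert (P := exp_pos (sg * ln x)). auto_derive. { repeat split; try lra. }
  field. lra.
Qed.

Lemma continuous_sigmoid' sg x : (0 < x)%R -> continuous (sigmoid' sg) x.
Proof.
  intros H. apply (ex_derive_continuous (K:=R_AbsRing) (V:=R_NormedModule)).
  unfold sigmoid', Rpower. assert (P := exp_pos (sg * ln x)).
  auto_derive. repeat split; auto. apply Rgt_not_eq. nra.
Qed.

Lemma ln_le_minus_1 y : (0 < y)%R -> (ln y <= y - 1)%R.
Proof.
  intros H. rewrite <- (ln_exp (y - 1)). apply ln_le; auto.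
  assert (E := exp_ineq1_le (y - 1)). lra.
Qed.

(** This is ln y <= y - 1 at y = x / (2 sg), multiplied by sg. *)
Lemma Rpower_le_exp sg x : (0 < sg)%R -> (0 < x)%R -> (Rpower x sg <= Rpower (2 * sg) sg * exp (x / 2))%R.
Proof.
  intros Hs Hx. unfold Rpower. rewrite <- exp_plus. apply exp_mono.
  assert (H := ln_le_minus_1 (x / (2 * sg)) ltac:(apply Rdiv_lt_0_compat; lra)).
  unfold Rdiv in H at 1. rewrite ln_mult, ln_Rinv in H; try lra; [|apply Rinv_0_lt_compat; lra].
  assert (E : (sg * (x / (2 * sg)) = x / 2)%R) by (field; lra). nra.
Qed.

Lemma power_exp_dominated sg x : (0 < sg)%R -> (0 < x)%R ->
  (Rpower x (sg - 1) * exp (- x) <= mconst sg * sigmoid' sg x)%R.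
Proof.
  intros Hs Hx. unfold mconst, sigmoid'.
  assert (P := Rpower_pos x sg). assert (P2 := Rpower_pos (2 * sg) sg). assert (P3 := Rpower_pos x (sg - 1)).
  assert (B := Rpower_le_exp sg x Hs Hx).
  set (u := Rpower x sg) in *. set (v := Rpower (2 * sg) sg) in *. set (e := exp (x / 2)) in *.
  assert (E1 : (1 <= e)%R). { unfold e. rewrite <- exp_0. apply exp_mono. lra. }
  assert (E2 : (exp (- x) = / (e * e))%R).
  { unfold e. rewrite <- exp_plus, <- exp_Ropp. f_equal. field. }
  rewrite E2.
  replace ((1 + v) ^ 2 / sg * (sg * Rpower x (sg - 1) / (1 + u) ^ 2))%R
    with (Rpower x (sg - 1) * ((1 + v) ^ 2 / (1 + u) ^ 2))%R by (field; lra).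
  apply Rmult_le_compat_l; [lra|].
  apply Rmult_le_reg_r with ((e * e) * (1 + u) ^ 2)%R. { apply Rmult_lt_0_compat; nra. }
  replace (/ (e * e) * (e * e * (1 + u) ^ 2))%R with ((1 + u) ^ 2)%R by (field; lra).
  replace ((1 + v) ^ 2 / (1 + u) ^ 2 * (e * e * (1 + u) ^ 2))%R with (((1 + v) * e) ^ 2)%R by (field; lra).
  apply pow_incr. split; [lra|]. nra.
Qed.

Lemma Rpower_lt_base sg x y : (0 < sg)%R -> (0 < x < y)%R -> (Rpower x sg < Rpower y sg)%R.
Proof. intros Hs H. apply exp_increasing. apply Rmult_lt_compat_l; auto. apply ln_increasing; lra. Qed.

Lemma sigmoid_limits sg eps : (0 < sg)%R -> (0 < eps)%R -> exists al be, (0 < al <= be)%R /\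
  (forall a, (0 < a < al)%R -> (Rabs (sigmoid sg a) < eps)%R) /\
  (forall b, (be < b)%R -> (Rabs (sigmoid sg b - 1) < eps)%R).
Proof.
  intros Hs He.
  set (a0 := Rpower eps (/ sg)). set (b0 := Rpower (/ eps) (/ sg)).
  assert (Pa : (Rpower a0 sg = eps)%R).
  { unfold a0. rewrite Rpower_mult, Rinv_l, Rpower_1; auto; lra. }
  assert (Pb : (Rpower b0 sg = / eps)%R).
  { unfold b0. rewrite Rpower_mult, Rinv_l, Rpower_1; auto; try lra. apply Rinv_0_lt_compat; auto. }
  exists a0, (Rmax a0 b0). split. { split; [apply Rpower_pos|apply Rmax_l]. }
  split.
  - intros a Ha. assert (L := Rpower_lt_base sg a a0 Hs Ha). rewrite Pa in L.
    assert (P := Rpower_pos a sg). unfold sigmoid. set (u := Rpower a sg) in *.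
    replace (1 - / (1 + u))%R with (u / (1 + u))%R by (field; lra).
    rewrite Rabs_pos_eq by (apply Rlt_le, Rdiv_lt_0_compat; lra).
    apply Rlt_div_l; nra.
  - intros b Hb. assert (M := Rmax_r a0 b0). assert (M0 := Rpower_pos (/ eps) (/ sg)). fold b0 in M0.
    assert (L := Rpower_lt_base sg b0 b Hs ltac:(lra)). rewrite Pb in L.
    assert (P := Rpower_pos b sg). unfold sigmoid. set (u := Rpower b sg) in *.
    replace (1 - / (1 + u) - 1)%R with (- (/ (1 + u)))%R by ring.
    rewrite Rabs_Ropp, Rabs_pos_eq by (apply Rlt_le, Rinv_0_lt_compat; lra).
    rewrite <- (Rinv_inv eps). apply Rinv_lt_contravar; [|lra].
    apply Rmult_lt_0_compat; [apply Rinv_0_lt_compat|]; lra.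
Qed.

(** Two exponents are allowed so that a factor |ln x| can be absorbed: it is dominated by x^r near
    infinity and by x^-r near 0. *)
Lemma IInt_power_dominated (f : R -> C) (K s1 s2 : R) : (0 < s1)%R -> (0 < s2)%R -> (0 <= K)%R ->
  (forall x, (0 < x)%R -> ccont f x) ->
  (forall x, (0 < x)%R -> (Cmod (f x) <= K * ((Rpower x (s1 - 1) + Rpower x (s2 - 1)) * exp (- x)))%R) ->
  exists l, IInt f l /\ (Cmod l <= K * (mconst s1 + mconst s2))%R.
Proof.
  intros H1 H2 HK Hc Hb.
  assert (C1 := mconst_pos s1 H1). assert (C2 := mconst_pos s2 H2).
  replace (K * (mconst s1 + mconst s2))%R with (K * (mconst s1 + mconst s2) - 0)%R by ring.
  apply (IInt_dominated f (fun x => K * (mconst s1 * sigmoid s1 x + mconst s2 * sigmoid s2 x))%R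
    (fun x => K * (mconst s1 * sigmoid' s1 x + mconst s2 * sigmoid' s2 x))%R); auto.
  - intros x Hx.
    apply is_derive_scal.
    apply (@is_derive_plus R_AbsRing R_NormedModule); apply is_derive_scal; apply is_derive_sigmoid; auto.
  - intros x Hx. apply (@continuous_scal_r R_UniformSpace R_AbsRing R_NormedModule K).
    apply (@continuous_plus R_UniformSpace R_AbsRing R_NormedModule);
    apply (@continuous_scal_r R_UniformSpace R_AbsRing R_NormedModule); apply continuous_sigmoid'; auto.
  - intros x Hx. eapply Rle_trans; [apply Hb; auto|]. apply Rmult_le_compat_l; auto.
    assert (A1 := power_exp_dominated s1 x H1 Hx). assert (A2 := power_exp_dominated s2 x H2 Hx). lra.
  - intros eps He. set (T := (K * (mconst s1 + mconst s2) + 1)%R).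
    assert (HT : (0 < T)%R) by (unfold T; nra).
    assert (HeT : (0 < eps / T)%R) by (apply Rdiv_lt_0_compat; auto).
    destruct (sigmoid_limits s1 (eps / T) H1 HeT) as [a1 [b1 [L1 [Ka1 Kb1]]]].
    destruct (sigmoid_limits s2 (eps / T) H2 HeT) as [a2 [b2 [L2 [Ka2 Kb2]]]].
    exists (Rmin a1 a2), (Rmax b1 b2).
    assert (M1 := Rmin_l a1 a2). assert (M2 := Rmin_r a1 a2).
    assert (M3 := Rmax_l b1 b2). assert (M4 := Rmax_r b1 b2).
    assert (Key : forall u v, (Rabs u < eps / T -> Rabs v < eps / T -> Rabs (K * (mconst s1 * u + mconst s2 * v)) < eps)%R).
    { intros u v Hu Hv. rewrite Rabs_mult, (Rabs_pos_eq K) by auto.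
      assert (Rabs (mconst s1 * u + mconst s2 * v) <= (mconst s1 + mconst s2) * (eps / T))%R.
      { eapply Rle_trans; [apply Rabs_triang|]. rewrite !Rabs_mult, (Rabs_pos_eq (mconst s1)), (Rabs_pos_eq (mconst s2)) by lra. nra. }
      apply Rle_lt_trans with ((T - 1) * (eps / T))%R. { unfold T at 1. nra. }
      replace ((T - 1) * (eps / T))%R with (eps - eps / T)%R by (field; lra). lra. }
    split. { split; [apply Rmin_case; lra|lra]. } split.
    + intros a Ha. rewrite Rminus_0_r. apply Key; [apply Ka1|apply Ka2]; lra.
    + intros b Hb'.
      replace (K * (mconst s1 * sigmoid s1 b + mconst s2 * sigmoid s2 b) - K * (mconst s1 + mconst s2))%R
        with (K * (mconst s1 * (sigmoid s1 b - 1) + mconst s2 * (sigmoid s2 b - 1)))%R by ring.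
      apply Key; [apply Kb1|apply Kb2]; lra.
Qed.

Definition exp_bounded (phi : R -> C) (K : R) : Prop :=
  (forall x, (0 < x)%R -> ccont phi x) /\ (forall x, (0 < x)%R -> (Cmod (phi x) <= K * exp (- x))%R).

Lemma exp_bounded_nonneg phi K : exp_bounded phi K -> (0 <= K)%R.
Proof.
  intros [_ H]. specialize (H 1%R ltac:(lra)). assert (P := Cmod_ge_0 (phi 1%R)).
  assert (Q := exp_pos (- (1))). nra.
Qed.

(** A total function obtained by choice; its value is arbitrary where the integral does not
    converge. *)
Definition Mellin (phi : R -> C) (w : C) : C :=
  epsilon (inhabits (RtoC 0)) (fun l => IInt (fun x => cpow x (w - 1) * phi x) l).

Lemma Mellin_exists phi K w : exp_bounded phi K -> (0 < Re w)%R ->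
  exists l, IInt (fun x => cpow x (w - 1) * phi x) l /\ (Cmod l <= K * (2 * mconst (Re w)))%R.
Proof.
  intros Hphi Hw. assert (HK := exp_bounded_nonneg _ _ Hphi). destruct Hphi as [Hc Hb].
  destruct (IInt_power_dominated (fun x => cpow x (w - 1) * phi x) (K / 1) (Re w) (Re w)) as [l [Hl Hl']]; auto; try lra.
  - intros x Hx. apply ccont_mult; auto. apply ccont_cpow; auto.
  - intros x Hx. rewrite Cmod_mult, Cmod_cpow. specialize (Hb x Hx).
    assert (P := Rpower_pos x (Re (w - 1))). unfold Cminus in *. rewrite re_plus in *. simpl in *.
    fold (Rminus (Re w) 1) in *. assert (E := exp_pos (- x)).
    apply Rle_trans with (Rpower x (Re w - 1) * (K * exp (- x)))%R; [apply Rmult_le_compat_l; auto; lra|].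
    assert (0 <= K * (Rpower x (Re w - 1) * exp (- x)))%R by (apply Rmult_le_pos; auto; nra). lra.
  - exists l. split; auto. lra.
Qed.

Lemma Mellin_correct phi K w : exp_bounded phi K -> (0 < Re w)%R ->
  IInt (fun x => cpow x (w - 1) * phi x) (Mellin phi w).
Proof.
  intros H Hw. apply (epsilon_spec (inhabits (RtoC 0)) (fun l => IInt (fun x => cpow x (w - 1) * phi x) l)).
  destruct (Mellin_exists phi K w H Hw) as [l [Hl _]]. exists l; auto.
Qed.

(** The estimate is linear in K with a constant independent of phi. This is what lets series be
    integrated term by term, remainder included. *)
Lemma Mellin_bound phi K w : exp_bounded phi K -> (0 < Re w)%R ->
  (Cmod (Mellin phi w) <= K * (2 * mconst (Re w)))%R.
Proof.
  intros H Hw. destruct (Mellin_exists phi K w H Hw) as [l [Hl Hb]].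
  rewrite (IInt_unique _ _ _ (Mellin_correct phi K w H Hw) Hl). auto.
Qed.

Lemma Mellin_unique phi w l : IInt (fun x => cpow x (w - 1) * phi x) l -> Mellin phi w = l.
Proof.
  intros H. apply (IInt_unique (fun x => cpow x (w - 1) * phi x)); auto.
  apply (epsilon_spec (inhabits (RtoC 0)) (fun l => IInt (fun x => cpow x (w - 1) * phi x) l)).
  exists l; auto.
Qed.

Lemma exp_bounded_plus phi psi K L : exp_bounded phi K -> exp_bounded psi L ->
  exp_bounded (fun x => phi x + psi x) (K + L).
Proof.
  intros [A B] [A' B']. split; intros x Hx.
  - apply ccont_plus; auto.
  - specialize (B x Hx). specialize (B' x Hx). eapply Rle_trans; [apply Cmod_triangle|]. lra.
Qed.

Lemma exp_bounded_mult_l c phi K : exp_bounded phi K -> exp_bounded (fun x => c * phi x) (Cmod c * K).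
Proof.
  intros [A B]. split; intros x Hx.
  - apply ccont_mult; auto. apply ccont_const.
  - rewrite Cmod_mult, Rmult_assoc. apply Rmult_le_compat_l; auto. apply Cmod_ge_0.
Qed.

Lemma exp_bounded_le phi K L : (K <= L)%R -> exp_bounded phi K -> exp_bounded phi L.
Proof.
  intros H [A B]. split; auto. intros x Hx. eapply Rle_trans; [apply B; auto|].
  apply Rmult_le_compat_r; auto. left; apply exp_pos.
Qed.

Lemma exp_bounded_csum n phi K : (forall k, exp_bounded (phi k) (K k)) ->
  exp_bounded (fun x => csum n (fun k => phi k x)) (sum_n K n).
Proof.
  intros H. induction n as [|n IH]; simpl.
  - rewrite sum_O. apply H.
  - rewrite sum_Sn. apply exp_bounded_plus; auto.
Qed.

Lemma Mellin_plus phi psi K L w : exp_bounded phi K -> exp_bounded psi L -> (0 < Re w)%R ->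
  Mellin (fun x => phi x + psi x) w = Mellin phi w + Mellin psi w.
Proof.
  intros H1 H2 Hw. apply Mellin_unique.
  apply IInt_ext with (fun x => cpow x (w - 1) * phi x + cpow x (w - 1) * psi x); [intros; ring|].
  apply IInt_plus; [apply Mellin_correct with K|apply Mellin_correct with L]; auto.
Qed.

Lemma Mellin_mult_l c phi K w : exp_bounded phi K -> (0 < Re w)%R ->
  Mellin (fun x => c * phi x) w = c * Mellin phi w.
Proof.
  intros H1 Hw. apply Mellin_unique.
  apply IInt_ext with (fun x => c * (cpow x (w - 1) * phi x)); [intros; ring|].
  apply IInt_mult_l. apply Mellin_correct with K; auto.
Qed.

Lemma Mellin_csum n phi K w : (forall k, exp_bounded (phi k) (K k)) -> (0 < Re w)%R ->
  Mellin (fun x => csum n (fun k => phi k x)) w = csum n (fun k => Mellin (phi k) w).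
Proof.
  intros H Hw. induction n as [|n IH]; simpl; auto.
  rewrite <- IH. apply (Mellin_plus _ _ (sum_n K n) (K (S n))); auto. apply exp_bounded_csum; auto.
Qed.

Lemma Mellin_ext phi psi K w : exp_bounded phi K -> (0 < Re w)%R ->
  (forall x, (0 < x)%R -> phi x = psi x) -> Mellin phi w = Mellin psi w.
Proof.
  intros H Hw E. symmetry. apply Mellin_unique.
  apply IInt_ext with (fun x => cpow x (w - 1) * phi x).
  - intros x Hx. rewrite E; auto.
  - apply Mellin_correct with K; auto.
Qed.

Lemma Mellin_scale phi w K n : (0 < n)%R -> (0 < Re w)%R -> exp_bounded phi K ->
  Mellin (fun x => phi (n * x)%R) w = cpow n (- w) * Mellin phi w.
Proof.
  intros Hn Hw Hphi. apply Mellin_unique.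
  assert (H := IInt_mult_l (cpow n (1 - w)) _ _ (IInt_scale _ _ n Hn (Mellin_correct phi K w Hphi Hw))).
  assert (Hn0 : RtoC n <> 0) by (apply RtoC_neq_0; lra).
  replace (cpow n (- w) * Mellin phi w) with (cpow n (1 - w) * (Mellin phi w / RtoC n)).
  2:{ replace (1 - w) with (- w + 1) by ring. rewrite cpow_plus1 by auto. field. auto. }
  apply IInt_ext with (2 := H). intros x Hx. cbv beta.
  rewrite cpow_mult by auto.
  replace (cpow n (1 - w) * (cpow n (w - 1) * cpow x (w - 1) * phi (n * x)%R)) with
    (cpow n (1 - w) * cpow n (w - 1) * (cpow x (w - 1) * phi (n * x)%R)) by ring.
  rewrite <- cpow_plus. replace (1 - w + (w - 1)) with (RtoC 0) by ring. rewrite cpow_0. ring.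
Qed.

(** The Weierstrass test: the tails are small uniformly on the half-line, and d <= x keeps the
    neighbouring points positive. *)
Lemma uniform_sum_ccont (phi : nat -> R -> C) (f : R -> C) (K : nat -> R) x :
  (forall n y, (0 < y)%R -> (Cmod (phi n y) <= K n)%R) -> ex_series K -> (0 < x)%R ->
  (forall n, ccont (phi n) x) -> (forall y, (0 < y)%R -> Cser (fun n => phi n y) (f y)) -> ccont f x.
Proof.
  intros HK HS Hx Hc Hf. apply continuous_C_eps. intros eps He.
  destruct (Series_tail_small K (eps / 4) HS ltac:(lra)) as [N HN]. specialize (HN N (Nat.le_refl _)).
  assert (Hp : ccont (fun y => csum N (fun n => phi n y)) x).
  { clear HN. induction N as [|N IH]; simpl; auto. apply ccont_plus; auto. }
  destruct (continuous_C_inv _ _ (eps / 4) Hp ltac:(lra)) as [d [Hd Kd]].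
  exists (Rmin d x). split; [apply Rmin_case; auto|]. intros y Hy.
  assert (Hy0 : (0 < y)%R).
  { assert (Q := Rlt_le_trans _ _ _ Hy (Rmin_r _ _)). apply Rabs_def2 in Q. lra. }
  specialize (Kd y (Rlt_le_trans _ _ _ Hy (Rmin_l _ _))).
  assert (T1 := Cser_tail_bound _ K _ N (fun n => HK n y Hy0) HS (Hf y Hy0)).
  assert (T2 := Cser_tail_bound _ K _ N (fun n => HK n x Hx) HS (Hf x Hx)).
  cbv beta in *.
  replace (f y - f x) with ((f y - csum N (fun n => phi n y)) + (csum N (fun n => phi n y) - csum N (fun n => phi n x))
    - (f x - csum N (fun n => phi n x))) by ring.
  eapply Rle_lt_trans; [apply Cmod_minus_le|].
  eapply Rle_lt_trans; [apply Rplus_le_compat_r, Cmod_triangle|].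
  apply Rle_lt_trans with (eps / 4 + eps / 4 + eps / 4)%R; [|lra].
  apply Rplus_le_compat; [apply Rplus_le_compat|].
  - eapply Rle_trans; [exact T1|]. left; exact HN.
  - left; exact Kd.
  - eapply Rle_trans; [exact T2|]. left; exact HN.
Qed.

(* The remainder is exp_bounded by the tail of the series of constants. *)
Lemma Mellin_series (phi : nat -> R -> C) (f : R -> C) (K : nat -> R) :
  (forall n, exp_bounded (phi n) (K n)) -> ex_series K ->
  (forall x, (0 < x)%R -> Cser (fun n => phi n x) (f x)) ->
  exp_bounded f (Series K) /\
  forall w, (0 < Re w)%R -> Cser (fun n => Mellin (phi n) w) (Mellin f w).
Proof.
  intros Hphi HS Hf.
  assert (HK : forall n, (0 <= K n)%R) by (intros n; apply (exp_bounded_nonneg (phi n)); auto).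
  assert (Hexp : forall x, ex_series (fun n => K n * exp (- x))%R).
  { intros x. apply (ex_series_scal_r (exp (- x)) K HS). }
  assert (Sexp : forall x, Series (fun n => K n * exp (- x))%R = (Series K * exp (- x))%R).
  { intros x. apply Series_scal_r. }
  assert (Nexp : forall x n, sum_n (fun n => K n * exp (- x))%R n = (sum_n K n * exp (- x))%R).
  { intros x n. apply (sum_n_mult_r (K:=R_Ring) (exp (- x)) K). }
  assert (Hfb : exp_bounded f (Series K)).
  { split; intros x Hx.
    - apply uniform_sum_ccont with (phi := phi) (K := K); auto.
      + intros n y Hy. eapply Rle_trans; [apply Hphi; auto|].
        assert (exp (- y) <= 1)%R by (apply exp_opp_le_1; lra). specialize (HK n). nra.
      + intros n. apply Hphi; auto.
    - rewrite <- Sexp. apply (Cser_bound (fun n => phi n x)); auto.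
      intros n. apply Hphi; auto. }
  split; auto. intros w Hw eps He.
  set (B := (2 * mconst (Re w))%R). assert (HB : (0 < B)%R) by (assert (P := mconst_pos _ Hw); unfold B; lra).
  destruct (Series_tail_small K (eps / B) HS) as [N HN]. { apply Rdiv_lt_0_compat; auto. }
  exists N. intros n Hn. specialize (HN n Hn).
  rewrite <- (Mellin_csum n phi K) by auto.
  assert (R1 : exp_bounded (fun x => f x + - (1) * csum n (fun k => phi k x)) (Series K - sum_n K n)).
  { split; intros x Hx.
    - apply ccont_plus; [apply Hfb; auto|]. apply ccont_mult; [apply ccont_const|].
      apply (exp_bounded_csum n phi K); auto.
    - replace (f x + - (1) * csum n (fun k => phi k x)) with (f x - csum n (fun k => phi k x)) by ring.
      replace ((Series K - sum_n K n) * exp (- x))%R with (Series K * exp (- x) - sum_n K n * exp (- x))%R by ring.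
      rewrite <- Sexp, <- Nexp. apply Cser_tail_bound; auto.
      intros k. apply Hphi; auto. }
  assert (Bd := Mellin_bound _ _ w R1 Hw).
  rewrite (Mellin_plus f _ (Series K) (Cmod (- (1)) * sum_n K n) w) in Bd; auto.
  2:{ apply exp_bounded_mult_l. apply exp_bounded_csum; auto. }
  rewrite (Mellin_mult_l _ _ (sum_n K n)) in Bd; auto; [|apply exp_bounded_csum; auto].
  rewrite Cmod_minus_sym.
  replace (Mellin f w - Mellin (fun x => csum n (fun k => phi k x)) w) with
    (Mellin f w + - (1) * Mellin (fun x => csum n (fun k => phi k x)) w) by ring.
  eapply Rle_lt_trans; [exact Bd|]. fold B. apply Rlt_div_r in HN; auto.
Qed.

Lemma Mellin_series_ex (phi : nat -> R -> C) (K : nat -> R) :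
  (forall n, exp_bounded (phi n) (K n)) -> ex_series K ->
  exists f, forall x, (0 < x)%R -> Cser (fun n => phi n x) (f x).
Proof.
  intros H HS.
  assert (HK : forall n, (0 <= K n)%R) by (intros n; apply (exp_bounded_nonneg (phi n)); auto).
  exists (fun x => epsilon (inhabits (RtoC 0)) (fun l => Cser (fun n => phi n x) l)).
  intros x Hx. apply (epsilon_spec (inhabits (RtoC 0)) (fun l => Cser (fun n => phi n x) l)).
  apply Cser_ex with K; auto. intros n. eapply Rle_trans; [apply H; auto|].
  assert (exp (- x) <= 1)%R by (apply exp_opp_le_1; lra). specialize (HK n). nra.
Qed.

(** * Holomorphy and integration by parts for Mellin transforms *)

Lemma Rabs_ln_exp r x : (0 <= r)%R -> (exp (r * Rabs (ln x)) <= Rpower x r + Rpower x (- r))%R.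
Proof.
  intros Hr. unfold Rpower. assert (P1 := exp_pos (r * ln x)). assert (P2 := exp_pos (- r * ln x)).
  destruct (Rle_dec 0 (ln x)).
  - rewrite Rabs_pos_eq by auto. lra.
  - rewrite Rabs_left by lra. replace (r * - ln x)%R with (- r * ln x)%R by ring. lra.
Qed.

(** The derivative is the transform with the extra factor ln x. The error integrand contains x^h - 1
    - h ln x, of order |h|^2, and its integral is bounded by B |h|^2. *)
Lemma Mellin_Cdiff phi K w : exp_bounded phi K -> (0 < Re w)%R -> exists l, Cdiff (Mellin phi) w l.
Proof.
  intros Hphi Hw. assert (HK := exp_bounded_nonneg _ _ Hphi).
  (* Exponents as low as sg - 3r occur below; this choice of r keeps them positive. *)
  set (sg := Re w) in *. set (r := (sg / 4)%R). assert (Hr : (0 < r)%R) by (unfold r; lra).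
  assert (Split : forall t x, Rpower x (sg - 1 + t) = (Rpower x (sg - 1) * Rpower x t)%R).
  { intros. apply Rpower_plus. }
  assert (Hcw : forall x, Cmod (cpow x (w - 1)) = Rpower x (sg - 1)).
  { intros x. rewrite Cmod_cpow. unfold Cminus. rewrite re_plus. reflexivity. }
  destruct (IInt_power_dominated (fun x => cpow x (w - 1) * RtoC (ln x) * phi x) (K / r) (sg + r) (sg - r)) as [m [Hm _]];
    try (unfold r; lra).
  { apply Rmult_le_pos; auto. left; apply Rinv_0_lt_compat; auto. }
  { intros x Hx. apply ccont_mult; [|apply Hphi; auto]. apply ccont_mult; [apply ccont_cpow; auto|].
    apply ccont_RtoC. apply continuous_ln; auto. }
  { intros x Hx. rewrite !Cmod_mult, Hcw, Cmod_R.
    assert (B := proj2 Hphi x Hx). assert (P := Rpower_pos x (sg - 1)). assert (E := exp_pos (- x)).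
    replace (sg + r - 1)%R with (sg - 1 + r)%R by ring. replace (sg - r - 1)%R with (sg - 1 + - r)%R by ring.
    rewrite !Split.
    assert (L := Rabs_ln_exp r x ltac:(lra)). assert (L2 := exp_ineq1_le (r * Rabs (ln x))).
    assert (L3 : (Rabs (ln x) <= (Rpower x r + Rpower x (- r)) / r)%R) by (apply Rle_div_r; lra).
    replace (K / r * ((Rpower x (sg - 1) * Rpower x r + Rpower x (sg - 1) * Rpower x (- r)) * exp (- x)))%R with
      (Rpower x (sg - 1) * ((Rpower x r + Rpower x (- r)) / r) * (K * exp (- x)))%R by (field; lra).
    apply Rmult_le_compat; auto; try apply Cmod_ge_0.
    - apply Rmult_le_pos; [lra|apply Rabs_pos].
    - apply Rmult_le_compat_l; lra. }
  exists m.
  set (B := (K / (r * r) * (mconst (sg + 3 * r) + mconst (sg - 3 * r)))%R).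
  assert (HB : (0 <= B)%R).
  { unfold B. apply Rmult_le_pos. apply Rmult_le_pos; auto. left; apply Rinv_0_lt_compat; nra.
    assert (P1 := mconst_pos (sg + 3 * r) ltac:(unfold r; lra)).
    assert (P2 := mconst_pos (sg - 3 * r) ltac:(unfold r; lra)). lra. }
  assert (Main : forall w', (Cmod (w' - w) < r)%R ->
    (Cmod (Mellin phi w' - Mellin phi w - m * (w' - w)) <= B * Cmod (w' - w) ^ 2)%R).
  { intros w' Hw'. set (h := w' - w) in *.
    assert (Ew : w' = w + h) by (unfold h; ring).
    assert (Hw2 : (0 < Re w')%R).
    { rewrite Ew, re_plus. fold sg. assert (T := re_le_Cmod h). assert (T2 := Rle_abs (- Re h)).
      rewrite Rabs_Ropp in T2. unfold r in *. lra. }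
    assert (I1 := Mellin_correct phi K w' Hphi Hw2). assert (I2 := Mellin_correct phi K w Hphi Hw).
    assert (I3 := IInt_plus _ _ _ _ (IInt_plus _ _ _ _ I1 (IInt_mult_l (- (1)) _ _ I2)) (IInt_mult_l (- h) _ _ Hm)).
    replace (Mellin phi w' - Mellin phi w - m * h) with (Mellin phi w' + - (1) * Mellin phi w + - h * m) by ring.
    assert (Ef : forall x, cpow x (w' - 1) * phi x + - (1) * (cpow x (w - 1) * phi x) + - h * (cpow x (w - 1) * RtoC (ln x) * phi x)
       = cpow x (w - 1) * (cpow x h - 1 - RtoC (ln x) * h) * phi x).
    { intros x. rewrite Ew. replace (w + h - 1) with (w - 1 + h) by ring. rewrite cpow_plus. ring. }
    apply (IInt_ext _ (fun x => cpow x (w - 1) * (cpow x h - 1 - RtoC (ln x) * h) * phi x)) in I3; [|intros; apply Ef].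
    destruct (IInt_power_dominated (fun x => cpow x (w - 1) * (cpow x h - 1 - RtoC (ln x) * h) * phi x)
      (K * (Cmod h ^ 2 / (r * r))) (sg + 3 * r) (sg - 3 * r)) as [l [Hl Hl']]; try (unfold r; lra).
    { apply Rmult_le_pos; auto. apply Rmult_le_pos; [apply pow2_ge_0|]. left; apply Rinv_0_lt_compat; nra. }
    { intros x Hx. apply ccont_mult; [|apply Hphi; auto]. apply ccont_mult; [apply ccont_cpow; auto|].
      apply ccont_minus. apply ccont_minus. apply ccont_cpow; auto. apply ccont_const.
      apply ccont_mult; [|apply ccont_const]. apply ccont_RtoC. apply continuous_ln; auto. }
    { intros x Hx. rewrite !Cmod_mult, Hcw.
      assert (Bp := proj2 Hphi x Hx). assert (P := Rpower_pos x (sg - 1)). assert (E := exp_pos (- x)).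
      replace (sg + 3 * r - 1)%R with (sg - 1 + 3 * r)%R by ring. replace (sg - 3 * r - 1)%R with (sg - 1 + - (3 * r))%R by ring.
      rewrite !Split.
      assert (Q := cexp_minus_1_minus_id_bound (RtoC (ln x) * h)). rewrite Cmod_mult, Cmod_R in Q.
      fold (cpow x h) in Q.
      set (y := Rabs (ln x)) in *. assert (Hy : (0 <= y)%R) by apply Rabs_pos.
      assert (L := Rabs_ln_exp (3 * r) x ltac:(lra)). fold y in L.
      assert (L2 := exp_ineq1_le (r * y)).
      assert (Hh := Cmod_ge_0 h).
      assert (L3 : (exp (y * Cmod h) <= exp (r * y))%R) by (apply exp_mono; nra).
      assert (L4 : (exp (3 * r * y) = exp (r * y) * exp (r * y) * exp (r * y))%R).
      { rewrite <- !exp_plus. f_equal. ring. }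
      assert (L5 : (0 < exp (r * y))%R) by apply exp_pos.
      set (G := (Rpower x (3 * r) + Rpower x (- (3 * r)))%R) in *.
      set (e := exp (r * y)) in *.
      (* For |h| < r the error is at most (|h|/r)^2 (r y)^2 e^(r y), and r y <= e^(r y) turns this
         into e^(3 r y): hence the exponents 3r and -3r. *)
      assert (Q2 : (Cmod (cpow x h - 1 - RtoC (ln x) * h) <= Cmod h ^ 2 / (r * r) * G)%R).
      { eapply Rle_trans; [exact Q|].
        apply Rle_trans with (Cmod h ^ 2 / (r * r) * ((r * y) ^ 2 * e))%R.
        - replace (Cmod h ^ 2 / (r * r) * ((r * y) ^ 2 * e))%R with ((y * Cmod h) ^ 2 * e)%R by (field; lra).
          apply Rmult_le_compat_l; auto. apply pow2_ge_0.
        - apply Rmult_le_compat_l. apply Rmult_le_pos; [apply pow2_ge_0|]. left; apply Rinv_0_lt_compat; nra.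
          eapply Rle_trans; [|exact L]. rewrite L4.
          assert (Z1 : (0 <= r * y)%R) by (apply Rmult_le_pos; lra). assert (Z2 : (r * y <= e)%R) by lra.
          apply Rmult_le_compat_r; [left; exact L5|]. nra. }
      replace (K * (Cmod h ^ 2 / (r * r)) * ((Rpower x (sg - 1) * Rpower x (3 * r) + Rpower x (sg - 1) * Rpower x (- (3 * r))) * exp (- x)))%R
        with (Rpower x (sg - 1) * (Cmod h ^ 2 / (r * r) * G) * (K * exp (- x)))%R by (unfold G; ring).
      apply Rmult_le_compat; auto; try apply Cmod_ge_0.
      - apply Rmult_le_pos; [lra|apply Cmod_ge_0].
      - apply Rmult_le_compat_l; lra. }
    rewrite (IInt_unique _ _ _ I3 Hl).
    eapply Rle_trans; [exact Hl'|]. unfold B. right. field. lra. }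
  intros eps He. exists (Rmin r (eps / (B + 1))). split.
  { apply Rmin_case; auto. apply Rdiv_lt_0_compat; lra. }
  intros w' Hw'.
  assert (Q1 := Rlt_le_trans _ _ _ Hw' (Rmin_l _ _)). assert (Q2 := Rlt_le_trans _ _ _ Hw' (Rmin_r _ _)).
  eapply Rle_trans; [apply Main; auto|].
  set (t := Cmod (w' - w)) in *. assert (Ht : (0 <= t)%R) by apply Cmod_ge_0.
  apply Rlt_div_r in Q2; [|lra]. nra.
Qed.

(** Supplies the vanishing boundary terms of integration by parts. Near 0 the power decides; at
    infinity x^sg e^-x is at most a constant times e^(-x/2), and e^(x/2) >= 1 + x/2. *)
Lemma power_exp_vanish sg K eps : (0 < sg)%R -> (0 <= K)%R -> (0 < eps)%R ->
  exists al be, (0 < al <= be)%R /\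
    (forall a, (0 < a < al)%R -> (K * (Rpower a sg * exp (- a)) < eps)%R) /\
    (forall b, (be < b)%R -> (K * (Rpower b sg * exp (- b)) < eps)%R).
Proof.
  intros Hs HK He.
  set (a0 := Rpower (eps / (K + 1)) (/ sg)).
  assert (He1 : (0 < eps / (K + 1))%R) by (apply Rdiv_lt_0_compat; lra).
  assert (Pa : (Rpower a0 sg = eps / (K + 1))%R).
  { unfold a0. rewrite Rpower_mult, Rinv_l, Rpower_1; auto; lra. }
  set (v := Rpower (2 * sg) sg). assert (Hv : (0 < v)%R) by apply Rpower_pos.
  set (b0 := (2 * (K * v + 1) / eps)%R).
  assert (Hb0 : (0 < b0)%R) by (apply Rdiv_lt_0_compat; nra).
  exists a0, (Rmax a0 b0). split. { split; [apply Rpower_pos|apply Rmax_l]. }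
  split.
  - intros a Ha. assert (L := Rpower_lt_base sg a a0 Hs Ha). rewrite Pa in L.
    assert (P := Rpower_pos a sg). assert (E := exp_pos (- a)).
    assert (E1 : (exp (- a) <= 1)%R) by (apply exp_opp_le_1; lra).
    apply Rle_lt_trans with (K * (eps / (K + 1)))%R. { apply Rmult_le_compat_l; auto. nra. }
    replace (K * (eps / (K + 1)))%R with (eps - eps / (K + 1))%R by (field; lra). lra.
  - intros b Hb. assert (M := Rmax_r a0 b0).
    assert (L := Rpower_le_exp sg b Hs ltac:(lra)). fold v in L.
    assert (E : (exp (- b) = exp (- (b / 2)) * exp (- (b / 2)))%R) by (rewrite <- exp_plus; f_equal; field).
    assert (E2 : (exp (b / 2) * exp (- (b / 2)) = 1)%R) by (rewrite <- exp_plus, Rplus_opp_r; apply exp_0).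
    assert (E3 := exp_ineq1_le (b / 2)). assert (P := exp_pos (- (b / 2))). assert (P2 := exp_pos (b / 2)).
    set (e := exp (- (b / 2))) in *. set (g := exp (b / 2)) in *.
    assert (Hbe : (K * v + 1 < b / 2 * eps)%R).
    { assert (Hb' : (b0 < b)%R) by lra. unfold b0 in Hb'. apply Rlt_div_l in Hb'; lra. }
    apply Rle_lt_trans with (K * v * e)%R.
    { rewrite Rmult_assoc. apply Rmult_le_compat_l; auto. rewrite E.
      apply Rle_trans with (v * g * (e * e))%R. { apply Rmult_le_compat_r; nra. }
      replace (v * g * (e * e))%R with (v * e * (g * e))%R by ring. rewrite E2. lra. }
    apply Rmult_lt_reg_r with g; auto. replace (K * v * e * g)%R with (K * v * (g * e))%R by ring.
    rewrite E2. nra.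
Qed.

(** x^w phi(x) vanishes at 0 because Re w > 0 and at infinity by the exponential bound, so the
    integral of its derivative is 0. *)
Lemma Mellin_by_parts phi phi' K K' w : exp_bounded phi K -> exp_bounded phi' K' ->
  (forall x, (0 < x)%R -> cderiv phi x (phi' x)) -> (0 < Re w)%R ->
  Mellin phi' (w + 1) = - w * Mellin phi w.
Proof.
  intros H H' Hd Hw.
  assert (Hw1 : (0 < Re (w + 1))%R) by (rewrite re_plus; simpl; lra).
  assert (HK := exp_bounded_nonneg _ _ H).
  assert (Z : IInt (fun x => w * (cpow x (w - 1) * phi x) + cpow x (w + 1 - 1) * phi' x) 0).
  { apply (IInt_FTC (fun x => cpow x w * phi x)).
    - intros x Hx. evar_last. { apply cderiv_mult; [apply cderiv_cpow; auto|apply Hd; auto]. }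
      cbv beta. replace (w + 1 - 1) with w by ring.
      change (w * cpow x (w - 1) * phi x + cpow x w * phi' x = w * (cpow x (w - 1) * phi x) + cpow x w * phi' x). ring.
    - intros x Hx. apply ccont_plus.
      + apply ccont_mult; [apply ccont_const|]. apply ccont_mult; [apply ccont_cpow; auto|apply H; auto].
      + apply ccont_mult; [apply ccont_cpow; auto|apply H'; auto].
    - intros eps He. destruct (power_exp_vanish (Re w) K eps Hw HK He) as [al [be [Hab [Ka Kb]]]].
      assert (B : forall x, (0 < x)%R -> (Cmod (cpow x w * phi x) <= K * (Rpower x (Re w) * exp (- x)))%R).
      { intros x Hx. rewrite Cmod_mult, Cmod_cpow. assert (B := proj2 H x Hx).
        assert (P := Rpower_pos x (Re w)). nra. }
      exists al, be. split; auto. split; intros x Hx; (eapply Rle_lt_trans; [apply B; lra|]); auto. }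
  assert (Z2 := IInt_plus _ _ _ _ (IInt_mult_l w _ _ (Mellin_correct phi K w H Hw)) (Mellin_correct phi' K' (w + 1) H' Hw1)).
  assert (E := IInt_unique _ _ _ Z2 Z).
  replace (Mellin phi' (w + 1)) with (w * Mellin phi w + Mellin phi' (w + 1) - w * Mellin phi w) by ring.
  rewrite E. ring.
Qed.

(** * The Gamma function *)

Definition expm (x : R) : C := RtoC (exp (- x)).
Definition Gam (w : C) : C := Mellin expm w.

Lemma continuous_exp_opp x : continuous (fun t => exp (- t)) x.
Proof.
  apply (ex_derive_continuous (K:=R_AbsRing) (V:=R_NormedModule)). auto_derive. auto.
Qed.

Lemma ccont_expm x : ccont expm x.
Proof. apply ccont_RtoC. apply continuous_exp_opp. Qed.

Lemma Cmod_expm x : Cmod (expm x) = exp (- x).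
Proof. apply Cmod_RtoC_pos. left; apply exp_pos. Qed.

Lemma expm_exp_bounded : exp_bounded expm 1.
Proof.
  split; intros x Hx; [apply ccont_expm|]. rewrite Cmod_expm. lra.
Qed.

Lemma Gam_is_Gamma w : (0 < Re w)%R -> is_Gamma w (Gam w).
Proof.
  intros H. unfold is_Gamma.
  assert (K := IInt_is_RInt_gen _ _ (Mellin_correct expm 1 w expm_exp_bounded H)).
  exact K.
Qed.

Lemma cderiv_expm x : cderiv expm x (- (1) * expm x).
Proof.
  unfold expm. replace (- (1) * RtoC (exp (- x))) with (RtoC (- exp (- x))) by (rewrite RtoC_opp; ring).
  apply cderiv_RtoC. auto_derive; auto. ring.
Qed.

Lemma Gam_plus_1 w : (0 < Re w)%R -> Gam (w + 1) = w * Gam w.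
Proof.
  intros H.
  assert (E := Mellin_by_parts expm (fun x => - (1) * expm x) 1 (Cmod (- (1)) * 1) w expm_exp_bounded
    (exp_bounded_mult_l _ _ _ expm_exp_bounded) (fun x _ => cderiv_expm x) H).
  rewrite (Mellin_mult_l (- (1)) expm 1) in E; [|apply expm_exp_bounded|rewrite re_plus; simpl; lra].
  fold (Gam (w + 1)) in E. fold (Gam w) in E.
  replace (Gam (w + 1)) with (- (- (1) * Gam (w + 1))) by ring. rewrite E. ring.
Qed.

Lemma Gam_plus_nat_zero w n : (0 < Re w)%R -> Gam w = 0 -> Gam (w + RtoC (INR n)) = 0.
Proof.
  intros H E. induction n as [|n IH]; [simpl; replace (w + 0) with w by ring; auto|].
  rewrite RtoC_INR_S, Cplus_assoc, Gam_plus_1, IH; [ring|].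
  rewrite re_plus; simpl. assert (P := pos_INR n). lra.
Qed.

(** * Gamma has no zero in the right half-plane *)

Lemma exp_plus_exp_opp_sqr v : (exp v + exp (- v) - 2 = (exp (v / 2) - exp (- (v / 2))) ^ 2)%R.
Proof.
  replace (exp v) with (exp (v / 2) * exp (v / 2))%R by (rewrite <- exp_plus; f_equal; field).
  replace (exp (- v)) with (exp (- (v / 2)) * exp (- (v / 2)))%R by (rewrite <- exp_plus; f_equal; field).
  assert (E : (exp (v / 2) * exp (- (v / 2)) = 1)%R) by (rewrite <- exp_plus, Rplus_opp_r; apply exp_0).
  nra.
Qed.

Lemma exp_minus_exp_opp_ge a : (0 <= a)%R -> (2 * a <= exp a - exp (- a))%R.
Proof.
  intros [Ha|<-]; [|rewrite Ropp_0; lra].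
  destruct (MVT_cor2 (fun v => exp v - exp (- v) - 2 * v)%R (fun v => exp v + exp (- v) - 2)%R 0 a Ha) as [c [Hc _]].
  - intros c _. apply is_derive_Reals. auto_derive; auto. ring.
  - rewrite Ropp_0 in Hc.
    assert (P : (0 <= exp c + exp (- c) - 2)%R).
    { rewrite exp_plus_exp_opp_sqr. apply pow2_ge_0. }
    nra.
Qed.

(** The right side is the square of 2 sinh(v/2), and sinh a >= a for a >= 0. At v = ln u it reads
    ln^2 u <= u + 1/u - 2. *)
Lemma sqr_le_exp_plus_exp_opp v : (v ^ 2 <= exp v + exp (- v) - 2)%R.
Proof.
  assert (Pos : forall v, (0 <= v)%R -> (v ^ 2 <= exp v + exp (- v) - 2)%R).
  { intros u Hu. rewrite exp_plus_exp_opp_sqr. apply pow_incr. split; auto.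
    assert (K := exp_minus_exp_opp_ge (u / 2) ltac:(lra)). lra. }
  destruct (Rle_dec 0 v) as [H|H]; [apply Pos; auto|].
  specialize (Pos (- v)%R ltac:(lra)). rewrite Ropp_involutive in Pos. nra.
Qed.

(** From cos th = 1 - 2 sin^2(th/2) and sin^2 t <= t^2. *)
Lemma cos_ge_quadratic th : (1 - th ^ 2 / 2 <= cos th)%R.
Proof.
  assert (S : forall t, (sin t * sin t <= t * t)%R).
  { assert (P : forall t, (0 <= t)%R -> (sin t * sin t <= t * t)%R).
    { intros t [Ht|<-]; [|rewrite sin_0; lra].
      assert (U := sin_lt_x t Ht). destruct (Rle_dec t 1) as [H1|H1].
      - assert (L := sin_ge_0 t ltac:(lra) ltac:(assert (Q := PI2_1); lra)). nra.
      - assert (B := SIN_bound t). nra. }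
    intros t. destruct (Rle_dec 0 t) as [H|H]; auto.
    specialize (P (- t)%R ltac:(lra)). rewrite sin_neg in P. nra. }
  replace th with (2 * (th / 2))%R at 2 by field. rewrite cos_2a_sin.
  specialize (S (th / 2)%R). nra.
Qed.

(** On [1, 2] the integrand is at least e^-2, since x^(p-1) >= 1 there. *)
Lemma Gam_real_pos p : (1 <= p)%R -> (0 < Re (Gam (RtoC p)))%R.
Proof.
  intros Hp.
  apply Rlt_le_trans with (exp (- (2)))%R; [apply exp_pos|].
  apply IInt_Re_ge with (fun x => cpow x (RtoC p - 1) * expm x).
  - intros x Hx. apply ccont_mult; [apply ccont_cpow; auto|apply ccont_expm].
  - apply (Mellin_correct expm 1); [apply expm_exp_bounded|simpl; lra].
  - intros x Hx. rewrite <- RtoC_minus, cpow_RtoC. unfold expm. rewrite <- RtoC_mult. simpl.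
    apply Rmult_le_pos; left; apply exp_pos.
  - intros x Hx. rewrite <- RtoC_minus, cpow_RtoC. unfold expm. rewrite <- RtoC_mult. simpl.
    assert (E : (exp (- (2)) <= exp (- x))%R) by (apply exp_mono; lra).
    assert (Q : (1 <= Rpower x (p - 1))%R).
    { apply Rle_trans with (exp 0); [rewrite exp_0; lra|]. apply exp_mono. apply Rmult_le_pos; [lra|].
      rewrite <- ln_1. apply ln_le; lra. }
    assert (E2 := exp_pos (- (2))). nra.
Qed.

(* If Gamma vanished at w it would vanish at w + n = p + iy for every n.  Under the weight
   t^(p-1) e^-t, which concentrates near t = p, the bounds cos th >= 1 - th^2/2 and
   ln^2 u <= u - 2 + 1/u give Gamma(p) <= (y^2/2) Gamma(p) / (p-1), absurd for large p. *)
Theorem Gam_neq_0 w : (0 < Re w)%R -> Gam w <> 0.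
Proof.
  intros Hw E0.
  set (y := Im w).
  destruct (INR_unbounded (2 + y ^ 2)) as [n Hn].
  set (p := (Re w + INR n)%R).
  assert (Hy2 : (0 <= y ^ 2)%R) by apply pow2_ge_0.
  assert (Hp : (2 + y ^ 2 < p)%R) by (unfold p; lra).
  assert (Ep : w + RtoC (INR n) = RtoC p + Ci * RtoC y).
  { apply C_eq; rewrite re_plus || rewrite im_plus; unfold p, y; simpl; ring. }
  assert (Z := Gam_plus_nat_zero w n Hw E0). rewrite Ep in Z.
  clearbody y p.
  assert (Hre : (0 < Re (RtoC p + Ci * RtoC y))%R).
  { rewrite re_plus, re_mult, !re_RtoC, im_RtoC. cbn [Re Im Ci fst snd]. lra. }
  assert (I0 := Mellin_correct expm 1 (RtoC p + Ci * RtoC y) expm_exp_bounded Hre).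
  fold (Gam (RtoC p + Ci * RtoC y)) in I0. rewrite Z in I0.
  assert (I1 := Mellin_correct expm 1 (RtoC (p + 1)) expm_exp_bounded ltac:(cbn [Re RtoC fst]; lra)).
  assert (I2 := Mellin_correct expm 1 (RtoC p) expm_exp_bounded ltac:(cbn [Re RtoC fst]; lra)).
  assert (I3 := Mellin_correct expm 1 (RtoC (p - 1)) expm_exp_bounded ltac:(cbn [Re RtoC fst]; lra)).
  fold (Gam (RtoC (p + 1))) in I1. fold (Gam (RtoC p)) in I2. fold (Gam (RtoC (p - 1))) in I3.
  assert (Hp0 : RtoC p <> 0) by (apply RtoC_neq_0; lra).
  assert (G1 : Gam (RtoC (p + 1)) = RtoC p * Gam (RtoC p)).
  { rewrite RtoC_plus. apply Gam_plus_1. simpl; lra. }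
  assert (G2 : Gam (RtoC p) = RtoC (p - 1) * Gam (RtoC (p - 1))).
  { rewrite <- Gam_plus_1 by (simpl; lra). rewrite <- RtoC_plus. f_equal. f_equal. ring. }
  assert (Pos := Gam_real_pos p ltac:(lra)).
  set (k := (y ^ 2 / 2)%R).
  (* With v = ln(x/p), the factor p^(-iy) turns x^(iy) into e^(iyv), and the coefficients are chosen
     so that the real part of the integrand is x^(p-1) e^-x (cos(y v) - 1 + k (x/p + p/x - 2)),
     which is nonnegative. The integral has real part (-1 + k/(p-1)) Gamma(p), negative because p >
     2 + y^2. *)
  assert (T := IInt_plus _ _ _ _ (IInt_plus _ _ _ _ (IInt_mult_l (cpow p (- (Ci * RtoC y))) _ _ I0)
     (IInt_mult_l (RtoC (- 1 - 2 * k)) _ _ I2))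
     (IInt_plus _ _ _ _ (IInt_mult_l (RtoC (k / p)) _ _ I1) (IInt_mult_l (RtoC (k * p)) _ _ I3))).
  rewrite G1 in T.
  match type of T with IInt ?f ?l => assert (NN : forall x, (0 < x)%R -> (0 <= Re (f x))%R) end.
  { intros x Hx.
    replace (RtoC p + Ci * RtoC y - 1) with (RtoC (p - 1) + Ci * RtoC y) by (rewrite RtoC_minus; ring).
    rewrite cpow_plus.
    rewrite <- !RtoC_minus, !cpow_RtoC.
    replace (p + 1 - 1)%R with (p - 1 + 1)%R by ring. rewrite (Rpower_plus (p - 1) 1), Rpower_1 by auto.
    rewrite (Rpower_minus_1 x (p - 1)) by auto.
    assert (Ec : cpow p (- (Ci * RtoC y)) * cpow x (Ci * RtoC y) = cexp (Ci * RtoC (y * (ln x - ln p)))).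
    { unfold cpow. rewrite <- cexp_plus. f_equal. rewrite RtoC_mult, RtoC_minus. ring. }
    set (A := Rpower x (p - 1)). assert (HA : (0 < A)%R) by apply Rpower_pos.
    replace (cpow p (- (Ci * RtoC y)) * (RtoC A * cpow x (Ci * RtoC y) * expm x)) with
      (RtoC A * expm x * cexp (Ci * RtoC (y * (ln x - ln p)))) by (rewrite <- Ec; ring).
    unfold expm. rewrite <- !RtoC_mult.
    rewrite !re_plus, re_scal_l. simpl Re at 2 3 4.
    replace (Re (cexp (Ci * RtoC (y * (ln x - ln p))))) with (cos (y * (ln x - ln p))).
    2:{ unfold cexp; simpl. rewrite !Rmult_0_l, !Rmult_0_r, Rminus_0_r, exp_0, Rmult_1_l. f_equal. ring. }
    set (v := (ln x - ln p)%R).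
    assert (Q1 := cos_ge_quadratic (y * v)). assert (Q2 := sqr_le_exp_plus_exp_opp v).
    assert (Ev : (exp v = x / p)%R).
    { unfold v, Rminus. rewrite exp_plus, exp_Ropp, !exp_ln by lra. reflexivity. }
    assert (Ev2 : (exp (- v) = p / x)%R).
    { unfold v. replace (- (ln x - ln p))%R with (ln p + - ln x)%R by ring.
      rewrite exp_plus, exp_Ropp, !exp_ln by lra. reflexivity. }
    rewrite Ev, Ev2 in Q2.
    assert (Q3 : (0 <= cos (y * v) - 1 + k * (x / p + p / x - 2))%R).
    { assert (Hk : (0 <= k)%R) by (unfold k; lra).
      assert (k * v ^ 2 <= k * (x / p + p / x - 2))%R by (apply Rmult_le_compat_l; auto).
      unfold k in *. nra. }
    set (e := exp (- x)). assert (He : (0 < e)%R) by apply exp_pos.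
    match goal with |- (0 <= ?G)%R => replace G with (A * e * (cos (y * v) - 1 + k * (x / p + p / x - 2)))%R by (field; lra) end.
    apply Rmult_le_pos; auto. nra. }
  assert (Rl := T). apply (IInt_Re_ge _ _ 0) in Rl; auto.
  2:{ intros x Hx. apply ccont_plus; apply ccont_plus; (apply ccont_mult; [apply ccont_const|]);
      (apply ccont_mult; [apply ccont_cpow; auto|apply ccont_expm]). }
  2:{ intros x Hx. apply NN. lra. }
  assert (Ge : Re (RtoC (k * p) * Gam (RtoC (p - 1))) = (k * p / (p - 1) * Re (Gam (RtoC p)))%R).
  { rewrite G2, !re_scal_l. field. lra. }
  rewrite !re_plus, Ge, Cmult_0_r, !re_scal_l in Rl. simpl Re at 1 in Rl.
  set (g := Re (Gam (RtoC p))) in *.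
  replace (0 + (-1 - 2 * k) * g + (k / p * (p * g) + k * p / (p - 1) * g))%R with ((-1 + k / (p - 1)) * g)%R in Rl by (field; lra).
  assert (Hk : (k / (p - 1) < 1)%R). { apply Rlt_div_l; unfold k; lra. }
  nra.
Qed.

(** * Polynomially weighted geometric series *)

(** Bernoulli's inequality for 1/t = 1 + d gives t^-m >= 1 + m d >= (m+1) min(1, d). *)
Lemma lin_geom_bounded t : (0 < t < 1)%R -> exists B, (0 < B)%R /\ forall m, (INR (m + 1) * t ^ m <= B)%R.
Proof.
  intros Ht. set (d := (/ t - 1)%R).
  assert (Hd : (0 < d)%R). { unfold d. assert (1 < / t)%R by (rewrite <- Rinv_1; apply Rinv_lt_contravar; lra). lra. }
  set (c := Rmin 1 d). assert (Hc : (0 < c)%R) by (apply Rmin_case; lra).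
  exists (/ c)%R. split; [apply Rinv_0_lt_compat; auto|]. intros m.
  assert (P : (0 < t ^ m)%R) by (apply pow_lt; lra).
  assert (Q : (1 + INR m * d <= (/ t) ^ m)%R).
  { replace (/ t)%R with (1 + d)%R by (unfold d; ring). apply poly; lra. }
  rewrite pow_inv in Q.
  assert (M1 := Rmin_l 1 d). assert (M2 := Rmin_r 1 d). fold c in M1, M2. assert (I := pos_INR m).
  rewrite plus_INR; simpl.
  assert (Q2 : ((INR m + 1) * c <= / t ^ m)%R) by nra.
  apply Rmult_le_reg_r with (c * / t ^ m)%R. { apply Rmult_lt_0_compat; auto. apply Rinv_0_lt_compat; auto. }
  replace ((INR m + 1) * t ^ m * (c * / t ^ m))%R with ((INR m + 1) * c)%R by (field; lra).
  replace (/ c * (c * / t ^ m))%R with (/ t ^ m)%R by (field; lra). auto.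
Qed.

(** Write r^m as the square of (sqrt r)^m: one half of the decay absorbs a factor m + 1, and the
    other half goes to the induction. *)
Lemma poly_geom_bound k r : (0 <= r < 1)%R ->
  exists B r', (0 < B)%R /\ (0 < r' < 1)%R /\ forall m, (INR (m + 1) ^ k * r ^ m <= B * r' ^ m)%R.
Proof.
  intros Hr.
  assert (Main : forall r, (0 < r < 1)%R ->
    exists B r', (0 < B)%R /\ (0 < r' < 1)%R /\ forall m, (INR (m + 1) ^ k * r ^ m <= B * r' ^ m)%R).
  { clear r Hr. induction k as [|k IH]; intros r Hr.
    - exists 1%R, r. repeat split; try lra. intros m. simpl. lra.
    - assert (Hs : (0 < sqrt r < 1)%R).
      { split; [apply sqrt_lt_R0; lra|]. rewrite <- sqrt_1. apply sqrt_lt_1; lra. }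
      destruct (lin_geom_bounded _ Hs) as [B1 [HB1 K1]].
      destruct (IH _ Hs) as [B2 [r' [HB2 [Hr' K2]]]].
      exists (B1 * B2)%R, r'. split; [apply Rmult_lt_0_compat; auto|]. split; auto.
      intros m. rewrite <- (sqrt_sqrt r) at 1 by lra. rewrite Rpow_mult_distr. simpl.
      replace (INR (m + 1) * INR (m + 1) ^ k * (sqrt r ^ m * sqrt r ^ m))%R with
        ((INR (m + 1) * sqrt r ^ m) * (INR (m + 1) ^ k * sqrt r ^ m))%R by ring.
      rewrite (Rmult_assoc B1). apply Rmult_le_compat; auto;
      repeat apply Rmult_le_pos; try apply pos_INR; try apply pow_le; try apply pos_INR; lra. }
  (* Raising r to at least 1/2 covers r = 0, for which the square-root argument would not give a
     positive base. *)
  destruct (Main (Rmax r (1 / 2))) as [B [r' [HB [Hr' K]]]].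
  { split; [apply Rlt_le_trans with (1 / 2)%R; [lra|apply Rmax_r]|apply Rmax_case; lra]. }
  exists B, r'. repeat split; try lra. intros m. eapply Rle_trans; [|apply K].
  apply Rmult_le_compat_l; [apply pow_le, pos_INR|]. apply pow_incr. split; [lra|apply Rmax_l].
Qed.

Lemma ex_series_poly_geom k r : (0 <= r < 1)%R -> ex_series (fun m => INR (m + 1) ^ k * r ^ m)%R.
Proof.
  intros Hr. destruct (poly_geom_bound k r Hr) as [B [r' [HB [Hr' K]]]].
  apply (@ex_series_le R_AbsRing R_CompleteNormedModule) with (fun m => B * r' ^ m)%R.
  - intros m. change (Rabs (INR (m + 1) ^ k * r ^ m) <= B * r' ^ m)%R.
    rewrite Rabs_pos_eq; auto. apply Rmult_le_pos; apply pow_le; [apply pos_INR|lra].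
  - apply (ex_series_scal_l B (fun m => r' ^ m)%R). apply ex_series_geom. rewrite Rabs_pos_eq; lra.
Qed.

Lemma poly_geom_small k r eps : (0 <= r < 1)%R -> (0 < eps)%R ->
  exists N, forall m, (N <= m)%nat -> (INR (m + 1) ^ k * r ^ m < eps)%R.
Proof.
  intros Hr He. destruct (poly_geom_bound k r Hr) as [B [r' [HB [Hr' K]]]].
  destruct (pow_lt_1_zero r' ltac:(rewrite Rabs_pos_eq; lra) (eps / B)) as [N HN].
  { apply Rdiv_lt_0_compat; auto. }
  exists N. intros m Hm. specialize (HN m Hm). rewrite Rabs_pos_eq in HN by (apply pow_le; lra).
  eapply Rle_lt_trans; [apply K|]. apply Rlt_div_r in HN; lra.
Qed.

Lemma Cser_deriv_geom (q : C) : (Cmod q < 1)%R -> Cser (fun m => RtoC (INR (m + 1)) * q ^ m) (1 / ((1 - q) * (1 - q))).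
Proof.
  intros Hq.
  assert (Hn : 1 - q <> 0).
  { intros E. apply (f_equal (fun z => Cmod (1 - z))) in E. replace (1 - (1 - q)) with q in E by ring.
    replace (1 - 0) with (RtoC 1) in E by ring. rewrite Cmod_1 in E. lra. }
  assert (P := proj1 (Cmod_gt_0 _) Hn). set (d := Cmod (1 - q)) in *.
  (* The partial sums have a closed form, so convergence reduces to (n+1) q^n tending to 0. *)
  assert (E : forall n, csum n (fun m => RtoC (INR (m + 1)) * q ^ m) =
     1 / ((1 - q) * (1 - q)) - q ^ (S n) * (RtoC (INR (n + 2)) - RtoC (INR (n + 1)) * q) / ((1 - q) * (1 - q))).
  { induction n as [|n IH].
    - simpl. rewrite RtoC_plus. field. auto.
    - cbn [csum]. rewrite IH.
      replace (INR (S n + 1)) with (INR n + 2)%R by (rewrite plus_INR, S_INR; simpl; ring).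
      replace (INR (S n + 2)) with (INR n + 3)%R by (rewrite plus_INR, S_INR; simpl; ring).
      replace (INR (n + 1)) with (INR n + 1)%R by (rewrite plus_INR; simpl; ring).
      replace (INR (n + 2)) with (INR n + 2)%R by (rewrite plus_INR; simpl; ring).
      rewrite !RtoC_plus, !Cpow_S.
      generalize (q ^ n), (RtoC (INR n)). intros Q t. field. auto. }
  assert (Hq0 := Cmod_ge_0 q).
  intros eps He. destruct (poly_geom_small 1 (Cmod q) (eps * (d * d) / 3)) as [N HN]; auto.
  { assert (0 < eps * (d * d))%R by (apply Rmult_lt_0_compat; nra). lra. }
  exists N. intros n Hn'. specialize (HN n Hn'). rewrite E.
  match goal with |- (Cmod (?a - ?b - ?a) < _)%R => replace (a - b - a) with (- b) by ring end.
  rewrite Cmod_opp. rewrite Cmod_div by (apply Cmult_neq_0; auto). rewrite !Cmod_mult. fold d.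
  apply Rlt_div_l; [nra|]. simpl (q ^ S n). rewrite Cmod_mult, Cmod_pow.
  assert (B : (Cmod (RtoC (INR (n + 2)) - RtoC (INR (n + 1)) * q) <= 3 * INR (n + 1))%R).
  { eapply Rle_trans; [apply Cmod_minus_le|]. rewrite Cmod_mult, !Cmod_RtoC_pos by apply pos_INR.
    rewrite !plus_INR. simpl. assert (I := pos_INR n). nra. }
  simpl in HN. assert (Pq : (0 <= Cmod q ^ n)%R) by (apply pow_le; auto).
  assert (B0 := Cmod_ge_0 (RtoC (INR (n + 2)) - RtoC (INR (n + 1)) * q)).
  apply Rle_lt_trans with (Cmod q ^ n * (3 * INR (n + 1)))%R; [|lra].
  apply Rmult_le_compat; auto; nra.
Qed.

(** * The kernels of the integral representation *)

(** This is u of the overview: despite its name, the logistic function at -x, equal to 1 / (1 +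
    e^x). *)
Definition logit (x : R) : R := (exp (- x) / (1 + exp (- x)))%R.
Definition kern (m : nat) (x : R) : R := (logit x ^ (m + 1) * (1 - logit x))%R.

Lemma logit_bounds x : (0 < x)%R -> (0 < logit x <= 1 / 2)%R /\ (logit x <= exp (- x))%R.
Proof.
  intros Hx. assert (P := exp_pos (- x)).
  assert (E : (exp (- x) <= 1)%R) by (apply exp_opp_le_1; lra).
  unfold logit. split; [split|].
  - apply Rdiv_lt_0_compat; lra.
  - apply Rle_div_l; lra.
  - apply Rle_div_l; nra.
Qed.

Lemma is_derive_logit x : is_derive logit x (- (logit x * (1 - logit x)))%R.
Proof.
  unfold logit. assert (P := exp_pos (- x)). auto_derive; [lra|]. field. lra.
Qed.

(** It follows from u' = -u (1 - u). The two coefficients are those of the recursion for the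
    Stirling sums, which is why the same Mellin transforms solve it. *)
Lemma is_derive_kern m x :
  is_derive (kern m) x (INR (m + 2) * kern (m + 1) x - INR (m + 1) * kern m x)%R.
Proof.
  unfold kern. evar_last.
  { apply Derive.is_derive_mult.
    - apply (is_derive_pow logit (m + 1) x). apply is_derive_logit.
    - apply @is_derive_minus; [apply @is_derive_const|apply is_derive_logit]. }
  unfold minus, plus, opp, zero; simpl.
  replace (m + 1)%nat with (S m) by lia. replace (m + 2)%nat with (S (S m)) by lia.
  replace (S m + 1)%nat with (S (S m)) by lia. rewrite !S_INR. simpl. ring.
Qed.

Lemma continuous_kern m x : continuous (kern m) x.
Proof.
  apply (ex_derive_continuous (K:=R_AbsRing) (V:=R_NormedModule)). eexists. apply is_derive_kern.
Qed.

(** m of the factors u are bounded by 1/2; the remaining one supplies e^-x. *)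
Lemma kern_bound m x : (0 < x)%R -> (0 <= kern m x <= (/ 2) ^ m * exp (- x))%R.
Proof.
  intros Hx. destruct (logit_bounds x Hx) as [H1 H2]. unfold kern.
  rewrite pow_add, pow_1.
  assert (P : (0 <= logit x ^ m <= (/ 2) ^ m)%R). { split; [apply pow_le; lra|apply pow_incr; lra]. }
  set (u := logit x) in *. set (p := (u ^ m)%R) in *. set (h := ((/ 2) ^ m)%R) in *.
  split.
  - apply Rmult_le_pos; nra.
  - apply Rle_trans with (p * u)%R; [|apply Rmult_le_compat; lra].
    rewrite <- (Rmult_1_r (p * u)) at 2. apply Rmult_le_compat_l; nra.
Qed.

Definition kernC (m : nat) (x : R) : C := RtoC (kern m x).

Lemma kernC_exp_bounded m : exp_bounded (kernC m) ((/ 2) ^ m).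
Proof.
  split; intros x Hx.
  - apply ccont_RtoC. apply continuous_kern.
  - unfold kernC. destruct (kern_bound m x Hx). rewrite Cmod_RtoC_pos; auto.
Qed.

Lemma exp_INR_mult n a : exp (INR n * a) = (exp a ^ n)%R.
Proof.
  induction n as [|n IH]; [simpl; rewrite Rmult_0_l; apply exp_0|].
  rewrite S_INR, Rmult_plus_distr_r, Rmult_1_l, exp_plus, IH. simpl. ring.
Qed.

Lemma kern_quotient m x : RtoC (kern m x) = RtoC (exp (- x * INR (m + 1)))%R / RtoC ((1 + exp (- x)) ^ (m + 2))%R.
Proof.
  assert (P := exp_pos (- x)).
  assert (Q : ((1 + exp (- x)) ^ (m + 2) <> 0)%R) by (apply pow_nonzero; lra).
  rewrite <- RtoC_div by auto. f_equal. unfold kern, logit.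
  replace (- x * INR (m + 1))%R with (INR (m + 1) * - x)%R by ring. rewrite exp_INR_mult.
  unfold Rdiv at 1. rewrite Rpow_mult_distr, pow_inv.
  replace (m + 2)%nat with (S (m + 1)) in * by lia. simpl. field. split; [|lra]. apply pow_nonzero; lra.
Qed.

(** * The eta coefficients *)

Definition coef (eta : C -> C) (m : nat) (s : C) : C :=
  RtoC ((-1) ^ m / INR (fact m))%R *
  csum1 (m + 1) (fun l => RtoC (IZR (stirling1 (m + 1) l)) * eta (s + 1 - RtoC (INR l))).

Lemma csum1_ext n f g : (forall k, (1 <= k <= n)%nat -> f k = g k) -> csum1 n f = csum1 n g.
Proof.
  induction n as [|n IH]; intros H; simpl; auto.
  rewrite IH, (H (S n)) by (auto; try lia; intros; apply H; lia). auto.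
Qed.

Lemma csum1_plus n f g : csum1 n (fun k => f k + g k) = csum1 n f + csum1 n g.
Proof. induction n as [|n IH]; simpl; [ring|]. rewrite IH. ring. Qed.

Lemma csum1_mult_l n c f : csum1 n (fun k => c * f k) = c * csum1 n f.
Proof. induction n as [|n IH]; simpl; [ring|]. rewrite IH. ring. Qed.

Lemma csum1_shift n f : csum1 (S n) f = f 1%nat + csum1 n (fun l => f (S l)).
Proof. induction n as [|n IH]; [simpl; ring|]. cbn [csum1] in *. rewrite IH. ring. Qed.

Lemma stirling1_gt n : forall k, (n < k)%nat -> stirling1 n k = 0%Z.
Proof.
  induction n as [|n IH]; intros [|k] H; try lia; auto.
  simpl. rewrite !IH by lia. lia.
Qed.

Lemma coef_0 eta s : coef eta 0 s = eta s.
Proof.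
  unfold coef. simpl. replace (s + 1 - 1) with s by ring. replace (1 / 1)%R with 1%R by field. ring.
Qed.

(** In s(m+2, l) = s(m+1, l-1) - (m+1) s(m+1, l), reindexing the first term by l - 1 lowers the
    argument of eta by 1. *)
Lemma coef_S eta m s : coef eta (S m) s = coef eta m s - / RtoC (INR (m + 1)) * coef eta m (s - 1).
Proof.
  unfold coef.
  set (T := fun s => csum1 (m + 1) (fun l => RtoC (IZR (stirling1 (m + 1) l)) * eta (s + 1 - RtoC (INR l)))).
  change (csum1 (m + 1) (fun l => RtoC (IZR (stirling1 (m + 1) l)) * eta (s + 1 - RtoC (INR l)))) with (T s).
  change (csum1 (m + 1) (fun l => RtoC (IZR (stirling1 (m + 1) l)) * eta (s - 1 + 1 - RtoC (INR l)))) with (T (s - 1)).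
  assert (E : csum1 (S m + 1) (fun l => RtoC (IZR (stirling1 (S m + 1) l)) * eta (s + 1 - RtoC (INR l)))
     = T (s - 1) - RtoC (INR (m + 1)) * T s).
  { replace (S m + 1)%nat with (S (S m)) by lia.
    (* Both ends of the longer sum are harmless: the shifted part starts with s(m+1, 0) = 0, and the
       other part ends with s(m+1, m+2) = 0. *)
    rewrite (csum1_ext (S (S m)) _ (fun l => RtoC (IZR (stirling1 (S m) (pred l))) * eta (s + 1 - RtoC (INR l)) +
       - RtoC (INR (m + 1)) * (RtoC (IZR (stirling1 (S m) l)) * eta (s + 1 - RtoC (INR l))))).
    2:{ intros [|k] Hk; [lia|]. cbn [pred].
        change (stirling1 (S (S m)) (S k)) with (stirling1 (S m) k - Z.of_nat (S m) * stirling1 (S m) (S k))%Z.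
        rewrite minus_IZR, mult_IZR, <- INR_IZR_INZ, RtoC_minus, RtoC_mult.
        replace (m + 1)%nat with (S m) by lia. ring. }
    rewrite csum1_plus, csum1_mult_l. unfold T. replace (m + 1)%nat with (S m) by lia.
    rewrite csum1_shift. cbn [pred].
    change (stirling1 (S m) 0) with 0%Z.
    replace (csum1 (S (S m)) (fun k => RtoC (IZR (stirling1 (S m) k)) * eta (s + 1 - RtoC (INR k)))) with
      (csum1 (S m) (fun k => RtoC (IZR (stirling1 (S m) k)) * eta (s + 1 - RtoC (INR k)))).
    2:{ change (csum1 (S (S m)) ?f) with (csum1 (S m) f + f (S (S m))). cbv beta.
        rewrite (stirling1_gt (S m) (S (S m))) by lia. ring. }
    rewrite (csum1_ext (S m) (fun l => RtoC (IZR (stirling1 (S m) l)) * eta (s + 1 - RtoC (INR (S l))))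
      (fun l => RtoC (IZR (stirling1 (S m) l)) * eta (s - 1 + 1 - RtoC (INR l)))).
    2:{ intros k _. f_equal. f_equal. rewrite RtoC_INR_S. ring. }
    ring. }
  rewrite E. clearbody T.
  assert (Hm : (0 < INR (m + 1))%R) by (apply lt_0_INR; lia).
  assert (Hf : (0 < INR (fact m))%R) by (apply lt_0_INR, lt_O_fact).
  assert (Hm0 : RtoC (INR (m + 1)) <> 0) by (apply RtoC_neq_0; lra).
  replace (RtoC ((-1) ^ S m / INR (fact (S m)))) with (- / RtoC (INR (m + 1)) * RtoC ((-1) ^ m / INR (fact m))).
  - field. auto.
  - rewrite <- RtoC_inv, <- RtoC_opp, <- RtoC_mult by lra. f_equal.
    rewrite fact_simpl, mult_INR. replace (m + 1)%nat with (S m) in * by lia. simpl pow. field. lra.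
Qed.

Lemma coef_shift eta m s : coef eta m (s - 1) = RtoC (INR (m + 1)) * (coef eta m s - coef eta (S m) s).
Proof.
  assert (Hm : (0 < INR (m + 1))%R) by (apply lt_0_INR; lia).
  assert (Hm0 : RtoC (INR (m + 1)) <> 0) by (apply RtoC_neq_0; lra).
  rewrite coef_S. field. auto.
Qed.

Lemma entire_Cdiff f : entire f -> forall z, exists l, Cdiff f z l.
Proof. intros H z. destruct (H z) as [l Hl]. exists l. apply is_derive_Cdiff. auto. Qed.

Lemma coef_Cdiff eta m s : (forall z, exists l, Cdiff eta z l) -> exists l, Cdiff (coef eta m) s l.
Proof.
  intros H. unfold coef.
  assert (K : exists l, Cdiff (fun s => csum1 (m + 1) (fun l => RtoC (IZR (stirling1 (m + 1) l)) * eta (s + 1 - RtoC (INR l)))) s l).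
  { generalize (m + 1)%nat at 1 as n. induction n as [|n [l Hl]]. { exists 0. apply (Cdiff_const 0). }
    destruct (H (1 - RtoC (INR (S n)) + s)) as [l' Hl'].
    eexists. cbn [csum1]. apply Cdiff_plus; [exact Hl|]. apply Cdiff_mult; [apply Cdiff_const|].
    apply Cdiff_ext with (fun w => eta (1 - RtoC (INR (S n)) + w)); [intros w; f_equal; ring|].
    apply Cdiff_translate. exact Hl'. }
  destruct K as [l Hl]. eexists. apply Cdiff_mult; [apply Cdiff_const|exact Hl].
Qed.

(** * Mellin transforms of eta and of its Stirling combinations *)

Definition logitC (x : R) : C := RtoC (logit x).

Lemma logitC_exp_bounded : exp_bounded logitC 1.
Proof.
  split; intros x Hx.
  - apply ccont_RtoC. apply (ex_derive_continuous (K:=R_AbsRing) (V:=R_NormedModule)). eexists. apply is_derive_logit.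
  - unfold logitC. destruct (logit_bounds x Hx). rewrite Cmod_RtoC_pos; lra.
Qed.

Lemma Mellin_expm_scale n s : (0 < Re s)%R ->
  Mellin (fun x => expm (INR (S n) * x)) s = cpow (INR (S n)) (- s) * Gam s.
Proof. intros H. apply (Mellin_scale expm s 1); auto. apply lt_0_INR; lia. apply expm_exp_bounded. Qed.

Lemma expm_scale_exp_bounded n : exp_bounded (fun x => expm (INR (S n) * x)) 1.
Proof.
  split; intros x Hx.
  - apply (continuous_comp (V:=R_UniformSpace) (fun x => INR (S n) * x)%R expm); [|apply ccont_expm].
    apply (continuous_scal_r (V:=R_NormedModule) (INR (S n)) (fun x => x)). apply continuous_id.
  - rewrite Cmod_expm, Rmult_1_l. apply exp_mono. rewrite S_INR. assert (P := pos_INR n). nra.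
Qed.

Lemma expm_INR k x : expm (INR (S k) * x) = expm x ^ S k.
Proof.
  unfold expm. rewrite <- RtoC_pow. f_equal. rewrite <- exp_INR_mult. f_equal. ring.
Qed.

Lemma alternating_partial n x : csum n (fun k => RtoC ((-1) ^ k) * expm (INR (S k) * x)) =
  logitC x * (1 - (- expm x) ^ S n).
Proof.
  assert (P := exp_pos (- x)).
  assert (E := fun k => expm_INR k x).
  assert (L : logitC x = expm x / (1 + expm x)).
  { unfold logitC, logit, expm. rewrite RtoC_div, RtoC_plus by lra. auto. }
  assert (N : 1 + expm x <> 0).
  { unfold expm. rewrite <- RtoC_plus. apply Cmod_gt_0. rewrite Cmod_RtoC_pos; lra. }
  rewrite L. set (y := expm x) in *. clearbody y.
  induction n as [|n IH].
  - cbn [csum]. rewrite E. simpl. field. auto.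
  - cbn [csum]. rewrite IH, E, !Cpow_S.
    assert (F : forall k, RtoC ((-1) ^ k) * y ^ k = (- y) ^ k).
    { intros k. rewrite RtoC_pow, <- Cpow_mult_l. f_equal. ring. }
    replace (RtoC ((-1) ^ S n)) with (- RtoC ((-1) ^ n)) by (rewrite <- RtoC_opp; f_equal; simpl; ring).
    rewrite <- F. field. auto.
Qed.

(** For 0 < Re s <= 1 the series is not absolutely convergent and [Mellin_series] does not apply.
    Instead the remainder of the geometric series is explicit and at most e^(-(n+2)x), so its
    transform is of order (n+2)^(-Re s). *)
Lemma eta_Mellin eta s : is_eta_function eta -> (0 < Re s)%R -> Mellin logitC s = Gam s * eta s.
Proof.
  intros [_ Heta] Hs. specialize (Heta s Hs). apply Cser_is_series in Heta.
  apply (Cser_mult_l (Gam s)) in Heta.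
  apply (Cser_unique (fun n => Gam s * (RtoC ((-1) ^ n) * cpow (INR (S n)) (- s)))); auto.
  intros eps He.
  set (B := (2 * mconst (Re s))%R). assert (HB : (0 < B)%R) by (assert (P := mconst_pos _ Hs); unfold B; lra).
  (* Chosen so that M^(Re s) > B / eps for M = n + 2, which makes the remainder B / M^(Re s) smaller
     than eps. *)
  destruct (INR_unbounded (Rpower (B / eps) (/ Re s))) as [N HN].
  exists N. intros n Hn.
  set (phi := fun k x => RtoC ((-1) ^ k) * expm (INR (S k) * x)).
  assert (Hphi : forall k, exp_bounded (phi k) (Cmod (RtoC ((-1) ^ k)) * 1)).
  { intros k. apply exp_bounded_mult_l. apply expm_scale_exp_bounded. }
  replace (csum n (fun n0 => Gam s * (RtoC ((-1) ^ n0) * cpow (INR (S n0)) (- s)))) with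
    (csum n (fun k => Mellin (phi k) s)).
  2:{ apply csum_ext. intros k _. unfold phi. rewrite (Mellin_mult_l _ _ 1), Mellin_expm_scale by (auto; apply expm_scale_exp_bounded). ring. }
  rewrite <- (Mellin_csum n phi (fun k => Cmod (RtoC ((-1) ^ k)) * 1)%R) by auto.
  set (r := fun x => logitC x * (- expm x) ^ S n).
  set (M := INR (S (S n))). assert (HM : (0 < M)%R) by (apply lt_0_INR; lia).
  (* Rescaling by M turns the bound e^(-M x) into e^-t, with a constant independent of n; the decay
     in n reappears as the factor M^-s. *)
  set (psi := fun t => r (/ M * t)%R).
  assert (Hr : forall x, (0 < x)%R -> (Cmod (r x) <= exp (- (M * x)))%R).
  { intros x Hx. unfold r. rewrite Cmod_mult, Cmod_pow, Cmod_opp, Cmod_expm.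
    replace (exp (- (M * x)))%R with (exp (- x) * exp (- x) ^ S n)%R.
    - apply Rmult_le_compat_r; [apply pow_le; left; apply exp_pos|].
      unfold logitC. destruct (logit_bounds x Hx). rewrite Cmod_RtoC_pos; lra.
    - change (exp (- x) * exp (- x) ^ S n)%R with (exp (- x) ^ S (S n))%R. rewrite <- exp_INR_mult. f_equal. unfold M. ring. }
  assert (Hrc : forall x, (0 < x)%R -> ccont r x).
  { intros x Hx. apply ccont_mult; [apply logitC_exp_bounded; auto|]. apply ccont_pow. apply ccont_opp. apply ccont_expm. }
  assert (HiM : (0 < / M)%R) by (apply Rinv_0_lt_compat; auto).
  assert (Hpsi : exp_bounded psi 1).
  { split; intros x Hx; unfold psi.
    - apply (continuous_comp (V:=R_UniformSpace) (fun x => / M * x)%R r); [|apply Hrc; nra].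
      apply (continuous_scal_r (V:=R_NormedModule) (/ M)%R (fun x => x)). apply continuous_id.
    - eapply Rle_trans; [apply Hr; nra|]. right. rewrite Rmult_1_l. f_equal. f_equal. field. lra. }
  assert (Hrb : exp_bounded r 1).
  { split; auto. intros x Hx. eapply Rle_trans; [apply Hr; auto|]. rewrite Rmult_1_l. apply exp_mono.
    unfold M. rewrite !S_INR. assert (P := pos_INR n). nra. }
  assert (E1 : Mellin r s = cpow M (- s) * Mellin psi s).
  { rewrite <- (Mellin_scale psi s 1 M) by auto. apply (Mellin_ext r _ 1); auto.
    intros x Hx. unfold psi. f_equal. field. lra. }
  assert (E2 : Mellin (fun x => csum n (fun k => phi k x)) s = Mellin logitC s + - (1) * Mellin r s).
  { rewrite <- (Mellin_mult_l _ r 1), <- (Mellin_plus logitC _ 1 (Cmod (- (1)) * 1)) by (auto; try apply logitC_exp_bounded; apply exp_bounded_mult_l; auto).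
    apply (Mellin_ext _ _ (sum_n (fun k => Cmod (RtoC ((-1) ^ k)) * 1)%R n)); auto.
    - apply exp_bounded_csum; auto.
    - intros x Hx. unfold phi. rewrite alternating_partial. unfold r. ring. }
  rewrite E2, E1. replace (Mellin logitC s + - (1) * (cpow M (- s) * Mellin psi s) - Mellin logitC s) with
    (- (cpow M (- s) * Mellin psi s)) by ring.
  rewrite Cmod_opp, Cmod_mult, Cmod_cpow, re_opp, Rpower_Ropp.
  assert (Bd := Mellin_bound psi 1 s Hpsi Hs). fold B in Bd. rewrite Rmult_1_l in Bd.
  assert (Pw : (B / eps < Rpower M (Re s))%R).
  { replace (B / eps)%R with (Rpower (Rpower (B / eps) (/ Re s)) (Re s)).
    - apply Rpower_lt_base; auto. split; [apply Rpower_pos|]. eapply Rlt_trans; [apply HN|]. apply lt_INR. lia.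
    - rewrite Rpower_mult, Rinv_l, Rpower_1; try lra. apply Rdiv_lt_0_compat; auto. }
  assert (P := Rpower_pos M (Re s)).
  apply Rle_lt_trans with (/ Rpower M (Re s) * B)%R. { apply Rmult_le_compat_l; auto. left; apply Rinv_0_lt_compat; auto. }
  apply Rlt_div_l in Pw; auto. rewrite Rmult_comm. apply Rlt_div_l; lra.
Qed.

Lemma cderiv_kernC m x : cderiv (kernC m) x (RtoC (INR (m + 2)) * kernC (m + 1) x + RtoC (- INR (m + 1)) * kernC m x).
Proof.
  unfold kernC. rewrite <- !RtoC_mult, <- RtoC_plus. apply cderiv_RtoC.
  evar_last. apply is_derive_kern. ring.
Qed.

Lemma Gam_shift_Cdiff s : (-1 < Re s)%R -> exists l, Cdiff (fun s => Gam (s + 1)) s l.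
Proof.
  intros H. destruct (Mellin_Cdiff expm 1 (1 + s) expm_exp_bounded) as [l Hl]. { rewrite re_plus; simpl; lra. }
  exists l. apply Cdiff_ext with (fun s => Mellin expm (1 + s)). { intros w. unfold Gam. f_equal. ring. }
  apply Cdiff_translate. auto.
Qed.

(** [coef_S] involves s - 1, so one step of the induction only reaches Re s > 0. Analytic
    continuation restores Re s > -1 at every m before the next step uses it. The base case
    integrates [logit] by parts, its derivative being minus [kern 0]. *)
Theorem coef_Mellin eta : is_eta_function eta -> forall m s, (-1 < Re s)%R ->
  Gam (s + 1) * coef eta m s = RtoC (INR (m + 1)) * Mellin (kernC m) (s + 1).
Proof.
  intros Heta.
  assert (Hd := entire_Cdiff eta (proj1 Heta)).
  (* both sides are holomorphic on Re s > -1, so it suffices to compare them on Re s > 0 *)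
  assert (Ext : forall m, (forall s, (0 < Re s)%R -> Gam (s + 1) * coef eta m s = RtoC (INR (m + 1)) * Mellin (kernC m) (s + 1)) ->
    forall s, (-1 < Re s)%R -> Gam (s + 1) * coef eta m s = RtoC (INR (m + 1)) * Mellin (kernC m) (s + 1)).
  { intros m H. apply half_plane_identity with 0%R; auto.
    - intros s Hs. destruct (Gam_shift_Cdiff s Hs) as [l Hl]. destruct (coef_Cdiff eta m s Hd) as [l' Hl'].
      eexists. exact (Cdiff_mult _ _ _ _ _ Hl Hl').
    - intros s Hs. destruct (Mellin_Cdiff (kernC m) _ (1 + s) (kernC_exp_bounded m)) as [l Hl]. { rewrite re_plus; simpl; lra. }
      eexists. apply Cdiff_mult; [apply Cdiff_const|].
      apply Cdiff_ext with (fun s => Mellin (kernC m) (1 + s)). { intros w. f_equal. ring. }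
      apply Cdiff_translate. exact Hl. }
  induction m as [|m IH]; apply Ext; intros s Hs.
  - rewrite coef_0, Gam_plus_1 by auto.
    assert (E := Mellin_by_parts logitC (fun x => - (1) * kernC 0 x) 1 (Cmod (- (1)) * (/ 2) ^ 0) s logitC_exp_bounded
       (exp_bounded_mult_l _ _ _ (kernC_exp_bounded 0))).
    rewrite (eta_Mellin eta) in E by auto.
    rewrite (Mellin_mult_l _ _ ((/ 2) ^ 0)) in E; [|apply kernC_exp_bounded|rewrite re_plus; simpl; lra].
    replace (RtoC (INR (0 + 1)) * Mellin (kernC 0) (s + 1)) with (- (- (1) * Mellin (kernC 0) (s + 1))) by (simpl; ring).
    rewrite E; auto.
    + ring.
    + intros x Hx. unfold logitC, kernC.
      replace (- (1) * RtoC (kern 0 x)) with (RtoC (- (logit x * (1 - logit x)))).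
      * apply cderiv_RtoC. apply is_derive_logit.
      * rewrite RtoC_opp. unfold kern. simpl. rewrite Rmult_1_r. ring.
  - assert (Hm : (0 < INR (m + 1))%R) by (apply lt_0_INR; lia).
    assert (Hm0 : RtoC (INR (m + 1)) <> 0) by (apply RtoC_neq_0; lra).
    assert (Hs1 : (0 < Re (s + 1))%R) by (rewrite re_plus; simpl; lra).
    rewrite coef_S.
    replace (Gam (s + 1) * (coef eta m s - / RtoC (INR (m + 1)) * coef eta m (s - 1))) with
      (Gam (s + 1) * coef eta m s - s * / RtoC (INR (m + 1)) * (Gam (s - 1 + 1) * coef eta m (s - 1))).
    2:{ rewrite (Gam_plus_1 s) by auto. replace (s - 1 + 1) with s by ring. ring. }
    rewrite !IH; [|unfold Cminus; rewrite re_plus; simpl; lra|lra].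
    replace (s - 1 + 1) with s by ring.
    assert (B1 := exp_bounded_mult_l (RtoC (INR (m + 2))) _ _ (kernC_exp_bounded (m + 1))).
    assert (B2 := exp_bounded_mult_l (RtoC (- INR (m + 1))) _ _ (kernC_exp_bounded m)).
    assert (E := Mellin_by_parts (kernC m) _ _ _ s (kernC_exp_bounded m) (exp_bounded_plus _ _ _ _ B1 B2) (fun x _ => cderiv_kernC m x) Hs).
    cbv beta in E. rewrite (Mellin_plus _ _ _ _ _ B1 B2 Hs1) in E.
    rewrite (Mellin_mult_l _ _ _ _ (kernC_exp_bounded (m + 1)) Hs1), (Mellin_mult_l _ _ _ _ (kernC_exp_bounded m) Hs1) in E.
    replace (S m + 1)%nat with (m + 2)%nat by lia. replace (S m) with (m + 1)%nat by lia.
    replace (RtoC (INR (m + 1)) * Mellin (kernC m) (s + 1) - s * / RtoC (INR (m + 1)) * (RtoC (INR (m + 1)) * Mellin (kernC m) s)) with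
      (RtoC (INR (m + 1)) * Mellin (kernC m) (s + 1) + - s * Mellin (kernC m) s) by (field; auto).
    rewrite <- E, RtoC_opp. ring.
Qed.

Lemma coef_bound eta : is_eta_function eta -> forall s, exists K k, (0 <= K)%R /\
  forall m, (Cmod (coef eta m s) <= K * (INR (m + 1) ^ k * (/ 2) ^ m))%R.
Proof.
  intros Heta.
  assert (Base : forall s, (-1 < Re s)%R -> exists K k, (0 <= K)%R /\
    forall m, (Cmod (coef eta m s) <= K * (INR (m + 1) ^ k * (/ 2) ^ m))%R).
  { intros s Hs. assert (Hs1 : (0 < Re (s + 1))%R) by (rewrite re_plus; simpl; lra).
    assert (G0 := Gam_neq_0 _ Hs1). assert (G1 := proj1 (Cmod_gt_0 _) G0).
    set (g := Cmod (Gam (s + 1))) in *. assert (Mp := mconst_pos _ Hs1).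
    exists (2 * mconst (Re (s + 1)) / g)%R, 1%nat. split. { apply Rlt_le, Rdiv_lt_0_compat; lra. }
    intros m. assert (E := f_equal Cmod (coef_Mellin eta Heta m s Hs)). rewrite !Cmod_mult in E. fold g in E.
    rewrite (Cmod_RtoC_pos (INR (m + 1))) in E by apply pos_INR.
    assert (Bd := Mellin_bound _ _ _ (kernC_exp_bounded m) Hs1). assert (I := pos_INR (m + 1)).
    rewrite pow_1. apply Rmult_le_reg_l with g; auto. rewrite E.
    replace (g * (2 * mconst (Re (s + 1)) / g * (INR (m + 1) * (/ 2) ^ m)))%R with
      (INR (m + 1) * ((/ 2) ^ m * (2 * mconst (Re (s + 1)))))%R by (field; lra).
    apply Rmult_le_compat_l; auto. }
  assert (Ind : forall n s, (-1 - INR n < Re s)%R -> exists K k, (0 <= K)%R /\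
    forall m, (Cmod (coef eta m s) <= K * (INR (m + 1) ^ k * (/ 2) ^ m))%R).
  { induction n as [|n IH]; intros s Hs. { apply Base. simpl in Hs. lra. }
    destruct (IH (s + 1)) as [K [k [HK B]]]. { rewrite re_plus, S_INR in *. simpl. lra. }
    (* [coef_shift] combines the indices m and m + 1, and (m+2)^k <= 2^k (m+1)^k; its factor m + 1
       raises the power by one. *)
    exists (K * (1 + 2 ^ k))%R, (S k). assert (P2 : (0 < 2 ^ k)%R) by (apply pow_lt; lra).
    split; [apply Rmult_le_pos; lra|].
    intros m. replace s with (s + 1 - 1) by ring. rewrite coef_shift, Cmod_mult, Cmod_RtoC_pos by apply pos_INR.
    assert (I := pos_INR (m + 1)). assert (I1 : (1 <= INR (m + 1))%R) by (rewrite plus_INR; simpl; assert (J := pos_INR m); lra).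
    assert (B1 := B m). assert (B2 := B (S m)).
    assert (T := Cmod_minus_le (coef eta m (s + 1)) (coef eta (S m) (s + 1))).
    assert (Q : (INR (S m + 1) ^ k * (/ 2) ^ S m <= 2 ^ k * (INR (m + 1) ^ k * (/ 2) ^ m))%R).
    { assert (Q1 : (INR (S m + 1) ^ k <= 2 ^ k * INR (m + 1) ^ k)%R).
      { rewrite <- Rpow_mult_distr. apply pow_incr. split; [apply pos_INR|].
        replace (S m + 1)%nat with (S (m + 1)) by lia. rewrite S_INR. lra. }
      assert (Q2 : (0 <= (/ 2) ^ m)%R) by (apply pow_le; lra). simpl ((/ 2) ^ S m)%R.
      assert (Q3 : (0 <= INR (S m + 1) ^ k)%R) by (apply pow_le, pos_INR). nra. }
    set (X := (INR (m + 1) ^ k * (/ 2) ^ m)%R) in *.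
    simpl pow. replace (K * (1 + 2 ^ k) * (INR (m + 1) * INR (m + 1) ^ k * (/ 2) ^ m))%R with
      (INR (m + 1) * (K * X + K * (2 ^ k * X)))%R by (unfold X; ring).
    apply Rmult_le_compat_l; auto.
    assert (K * (INR (S m + 1) ^ k * (/ 2) ^ S m) <= K * (2 ^ k * X))%R by (apply Rmult_le_compat_l; auto). lra. }
  intros s. destruct (INR_unbounded (- Re s)) as [n Hn]. apply (Ind n). lra.
Qed.

(** * A generating function of the coefficients *)

Lemma one_minus_neq_0 (z : C) : (Cmod z < 1)%R -> 1 - z <> 0.
Proof.
  intros H E. apply (f_equal (fun t => 1 - t)) in E. replace (1 - (1 - z)) with z in E by ring.
  rewrite E in H. replace (1 - 0) with (RtoC 1) in H by ring. rewrite Cmod_1 in H. lra.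
Qed.

Lemma one_plus_lt_2 (v : C) : (Cmod v < 1)%R -> (Cmod (1 + v) < 2)%R.
Proof. intros H. assert (T := Cmod_triangle 1 v). rewrite Cmod_1 in T. lra. Qed.

Lemma Cser_div_nz (g : C) a l : g <> 0 -> Cser (fun n => g * a n) l -> Cser a (l / g).
Proof.
  intros Hg H. apply (Cser_mult_l (/ g)) in H. replace (l / g) with (/ g * l) by (unfold Cdiv; ring).
  apply Cser_ext with (2 := H). intros n. field. auto.
Qed.

(* Both series are Mellin transforms of e^-x / (1 - v e^-x)^2, expanded in two ways. *)
Lemma coef_generating eta s v : is_eta_function eta -> (-1 < Re s)%R -> (Cmod v < 1)%R ->
  exists P, Cser (fun m => coef eta m s * (1 + v) ^ m) P /\
            Cser (fun n => cpow (INR (S n)) (- s) * v ^ n) P.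
Proof.
  intros Heta Hs Hv. assert (Hs1 : (0 < Re (s + 1))%R) by (rewrite re_plus; simpl; lra).
  assert (G0 := Gam_neq_0 _ Hs1). assert (Hz := one_plus_lt_2 v Hv).
  set (z := 1 + v) in *. assert (Hz0 := Cmod_ge_0 z). assert (Hv0 := Cmod_ge_0 v).
  set (f := fun x => expm x / ((1 - v * expm x) * (1 - v * expm x))).
  assert (Hy : forall x, (0 < x)%R -> (Cmod (v * expm x) < 1)%R).
  { intros x Hx. rewrite Cmod_mult, Cmod_expm. assert (P := exp_pos (- x)).
    assert (exp (- x) <= 1)%R by (apply exp_opp_le_1; lra). nra. }
  destruct (Mellin_series (fun m x => RtoC (INR (m + 1)) * z ^ m * kernC m x) f
     (fun m => Cmod (RtoC (INR (m + 1)) * z ^ m) * (/ 2) ^ m)%R) as [_ M1].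
  { intros m. apply exp_bounded_mult_l. apply kernC_exp_bounded. }
  { apply (ex_series_ext (fun m => INR (m + 1) ^ 1 * (Cmod z / 2) ^ m)%R).
    - intros m. rewrite Cmod_mult, Cmod_pow, Cmod_RtoC_pos by apply pos_INR. unfold Rdiv. rewrite Rpow_mult_distr, pow_1.
      symmetry. apply Rmult_assoc.
    - apply ex_series_poly_geom. lra. }
  { intros x Hx. destruct (logit_bounds x Hx) as [L1 L2].
    assert (Hq : (Cmod (RtoC (logit x) * z) < 1)%R). { rewrite Cmod_mult, Cmod_RtoC_pos by lra. nra. }
    assert (D := Cser_mult_l (RtoC (logit x * (1 - logit x))) _ _ (Cser_deriv_geom _ Hq)).
    replace (f x) with (RtoC (logit x * (1 - logit x)) * (1 / ((1 - RtoC (logit x) * z) * (1 - RtoC (logit x) * z)))).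
    - apply Cser_ext with (2 := D). intros m. cbv beta. unfold kernC, kern.
      rewrite Cpow_mult_l, pow_add, pow_1, !RtoC_mult, RtoC_pow. ring.
    (* With y = e^-x: u (1 - u) = y / (1 + y)^2 and 1 - u (1 + v) = (1 - v y) / (1 + y), so the
       powers of 1 + y cancel. *)
    - unfold f. assert (P := exp_pos (- x)). assert (N2 := one_minus_neq_0 _ (Hy x Hx)).
      assert (N1 := one_minus_neq_0 _ Hq).
      assert (N3 : 1 + expm x <> 0).
      { unfold expm. rewrite <- RtoC_plus. apply Cmod_gt_0. rewrite Cmod_RtoC_pos; lra. }
      assert (EL : RtoC (logit x) = expm x / (1 + expm x)).
      { unfold logit, expm. rewrite RtoC_div, RtoC_plus by lra. auto. }
      rewrite RtoC_mult, RtoC_minus, EL. rewrite EL in N1. unfold z in *. set (y := expm x) in *. clearbody y.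
      replace (1 - y / (1 + y) * (1 + v)) with ((1 - v * y) / (1 + y)) by (field; auto).
      field. split; auto. }
  destruct (Mellin_series (fun n x => RtoC (INR (n + 1)) * v ^ n * expm (INR (S n) * x)) f
     (fun n => Cmod (RtoC (INR (n + 1)) * v ^ n) * 1)%R) as [_ M2].
  { intros n. apply exp_bounded_mult_l. apply expm_scale_exp_bounded. }
  { apply (ex_series_ext (fun m => INR (m + 1) ^ 1 * (Cmod v) ^ m)%R).
    - intros m. rewrite Cmod_mult, Cmod_pow, Cmod_RtoC_pos, pow_1, Rmult_1_r by apply pos_INR. reflexivity.
    - apply ex_series_poly_geom. lra. }
  { intros x Hx. assert (D := Cser_mult_l (expm x) _ _ (Cser_deriv_geom _ (Hy x Hx))).
    replace (f x) with (expm x * (1 / ((1 - v * expm x) * (1 - v * expm x)))) by (unfold f, Cdiv; ring).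
    apply Cser_ext with (2 := D). intros n. cbv beta. rewrite expm_INR, Cpow_mult_l, Cpow_S. ring. }
  specialize (M1 _ Hs1). specialize (M2 _ Hs1).
  exists (Mellin f (s + 1) / Gam (s + 1)). split.
  - apply Cser_div_nz; auto. apply Cser_ext with (2 := M1). intros m. cbv beta.
    rewrite (Mellin_mult_l _ _ _ _ (kernC_exp_bounded m) Hs1).
    rewrite Cmult_assoc, coef_Mellin by auto. ring.
  - apply Cser_div_nz; auto. apply Cser_ext with (2 := M2). intros n. cbv beta.
    rewrite (Mellin_mult_l _ _ _ _ (expm_scale_exp_bounded n) Hs1), Mellin_expm_scale by auto.
    assert (Hn : (0 < INR (S n))%R) by (apply lt_0_INR; lia).
    (* The factor n + 1 from the squared denominator compensates the extra power in (n+1)^(-s-1). *)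
    replace (- s) with (- (s + 1) + 1) by ring. rewrite cpow_plus1 by auto.
    replace (n + 1)%nat with (S n) by lia. ring.
Qed.

(** * Finite Fourier expansion of a character *)

Lemma csum_swap n m (f : nat -> nat -> C) :
  csum n (fun i => csum m (fun j => f i j)) = csum m (fun j => csum n (fun i => f i j)).
Proof. induction n as [|n IH]; cbn [csum]; auto. rewrite IH, <- csum_plus. auto. Qed.

Lemma csum_shift n (f : nat -> C) : csum (S n) f = f 0%nat + csum n (fun i => f (S i)).
Proof. induction n as [|n IH]; [reflexivity|]. cbn [csum] in *. rewrite IH. ring. Qed.

Lemma csum_0 n (f : nat -> C) : (forall k, (k <= n)%nat -> f k = 0) -> csum n f = 0.
Proof.
  induction n as [|n IH]; intros H; cbn [csum]; [apply H; lia|].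
  rewrite IH, (H (S n)) by (auto; intros; apply H; lia). ring.
Qed.

Lemma csum_single n (f : nat -> C) i : (i <= n)%nat -> (forall k, (k <= n)%nat -> k <> i -> f k = 0) -> csum n f = f i.
Proof.
  induction n as [|n IH]; intros Hi H; cbn [csum]. { replace i with 0%nat by lia; auto. }
  destruct (Nat.eq_dec i (S n)) as [->|Hn].
  - rewrite csum_0; [ring|]. intros; apply H; lia.
  - rewrite IH, (H (S n)); [ring|lia|lia|lia|]. intros; apply H; lia.
Qed.

Lemma csum_geom n (z : C) : (z - 1) * csum n (fun k => z ^ k) = z ^ S n - 1.
Proof.
  induction n as [|n IH]; [simpl; ring|]. cbn [csum]. rewrite Cmult_plus_distr_l, IH, !Cpow_S. ring.
Qed.

Lemma csum_unity n (z : C) : z ^ S n = 1 -> z <> 1 -> csum n (fun k => z ^ k) = 0.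
Proof.
  intros H Hz. assert (E := csum_geom n z). rewrite H in E. replace (1 - 1) with (RtoC 0) in E by ring.
  assert (N : z - 1 <> 0) by (apply Cminus_eq_contra; auto).
  replace (csum n (fun k => z ^ k)) with (/ (z - 1) * ((z - 1) * csum n (fun k => z ^ k))) by (field; auto).
  rewrite E. ring.
Qed.

Lemma csum_const n (c : C) : csum n (fun _ => c) = RtoC (INR (S n)) * c.
Proof. induction n as [|n IH]; [simpl; ring|]. cbn [csum]. rewrite IH, (RtoC_INR_S (S n)). ring. Qed.

Lemma csum_fold n (f : nat -> C) : csum n f = fold_right Cplus 0 (map f (seq 0 (S n))).
Proof.
  assert (A : forall l a, fold_right Cplus 0 (l ++ a :: nil) = fold_right Cplus 0 l + a).
  { induction l as [|b l IHl]; intros a; simpl; [ring|]. rewrite IHl. ring. }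
  induction n as [|n IH]; [simpl; ring|].
  cbn [csum]. rewrite IH, (seq_S (S n)), map_app. simpl map at 3. rewrite A. reflexivity.
Qed.

Lemma fold_Cplus_perm l l' : Permutation l l' -> fold_right Cplus 0 l = fold_right Cplus 0 l'.
Proof. induction 1; simpl; try congruence. ring. Qed.

Lemma periodic_mod (chi : nat -> C) q n : (1 <= q)%nat -> (forall n, chi (n + q)%nat = chi n) ->
  chi (n mod q)%nat = chi n.
Proof.
  intros Hq H. rewrite (Nat.div_mod_eq n q) at 2. generalize (n / q)%nat as k. intros k.
  induction k as [|k IH]. { f_equal. lia. }
  rewrite IH, <- (H (q * k + n mod q)%nat). f_equal. lia.
Qed.

(** Multiplication by a unit n permutes the residues, so the sum S satisfies chi(n) S = S; choose n
    with chi(n) different from 1. *)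
Lemma character_mean_zero Q chi : dirichlet_character (S Q) chi -> nontrivial_character (S Q) chi ->
  csum Q chi = 0.
Proof.
  intros [_ [Hper [Hmul [_ _]]]] [n [Hn Hn1]].
  assert (E : chi n * csum Q chi = csum Q chi).
  { rewrite <- csum_mult_l.
    rewrite (csum_ext Q _ (fun r => chi ((n * r) mod S Q)%nat)).
    2:{ intros r _. rewrite (periodic_mod chi (S Q)) by (auto; lia). rewrite Hmul. auto. }
    rewrite !csum_fold.
    rewrite <- (map_map (fun r => (n * r) mod S Q)%nat chi).
    apply fold_Cplus_perm. apply Permutation_map.
    apply NoDup_Permutation_bis.
    - apply NoDup_map_NoDup_ForallPairs; [|apply seq_NoDup].
      intros a b Ha Hb Hab. apply in_seq in Ha. apply in_seq in Hb.
      (* Injectivity: equal residues of n a and n b make q divide n (a - b), hence a - b by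
         coprimality, while |a - b| < q. *)
      assert (D : (Z.of_nat (S Q) | Z.of_nat n * (Z.of_nat a - Z.of_nat b))%Z).
      { exists (Z.of_nat ((n * a) / S Q) - Z.of_nat ((n * b) / S Q))%Z.
        assert (Ea := Nat.div_mod_eq (n * a) (S Q)). assert (Eb := Nat.div_mod_eq (n * b) (S Q)).
        rewrite Hab in Ea. set (u := (n * a / S Q)%nat) in *. set (v := (n * b / S Q)%nat) in *.
        set (r := ((n * b) mod S Q)%nat) in *. clearbody u v r. nia. }
      apply Z.gauss in D; [|rewrite Z.gcd_comm; auto].
      destruct D as [t Ht]. assert (t = 0)%Z by nia. subst t. lia.
    - rewrite length_map. auto.
    - intros x Hx. apply in_map_iff in Hx. destruct Hx as [y [<- _]].
      apply in_seq. assert (H := Nat.mod_upper_bound (n * y) (S Q)). lia. }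
  assert (N : chi n - 1 <> 0) by (apply Cminus_eq_contra; auto).
  replace (csum Q chi) with (/ (chi n - 1) * (chi n * csum Q chi - csum Q chi)) by (field; auto).
  rewrite E. ring.
Qed.

Definition unity_root (q : nat) : C := cexp (Ci * RtoC (2 * PI / INR q)).

Lemma cexp_pow z n : cexp z ^ n = cexp (RtoC (INR n) * z).
Proof.
  induction n as [|n IH]. { simpl. rewrite Cmult_0_l, cexp_0. auto. }
  rewrite Cpow_S, IH, <- cexp_plus, RtoC_INR_S. f_equal. ring.
Qed.

Lemma unity_root_pow q n : (1 <= q)%nat ->
  unity_root q ^ n = (cos (2 * PI * INR n / INR q), sin (2 * PI * INR n / INR q)).
Proof.
  intros Hq. assert (P : (0 < INR q)%R) by (apply lt_0_INR; lia).
  unfold unity_root. rewrite cexp_pow. unfold cexp.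
  rewrite re_scal_l, im_scal_l. simpl. rewrite !Rmult_0_l, !Rmult_0_r, !Rmult_1_l, Rplus_0_l, Rminus_0_r, Rmult_0_r, exp_0, !Rmult_1_l.
  f_equal; f_equal; field; lra.
Qed.

Lemma unity_root_order q : (1 <= q)%nat -> unity_root q ^ q = 1.
Proof.
  intros Hq. rewrite unity_root_pow by auto. assert (P : (0 < INR q)%R) by (apply lt_0_INR; lia).
  replace (2 * PI * INR q / INR q)%R with (2 * PI)%R by (field; lra). rewrite cos_2PI, sin_2PI. reflexivity.
Qed.

(** cos th = 1 - 2 sin^2(th/2), and half the angle lies strictly between 0 and pi. *)
Lemma unity_root_primitive q d : (0 < d < q)%nat -> unity_root q ^ d <> 1.
Proof.
  intros Hd E. assert (P : (0 < INR q)%R) by (apply lt_0_INR; lia).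
  assert (D : (0 < INR d)%R) by (apply lt_0_INR; lia). assert (D2 : (INR d < INR q)%R) by (apply lt_INR; lia).
  rewrite unity_root_pow in E by lia. apply (f_equal fst) in E. simpl in E.
  replace (2 * PI * INR d / INR q)%R with (2 * (PI * INR d / INR q))%R in E by (field; lra).
  rewrite cos_2a_sin in E. assert (PP := PI_RGT_0).
  assert (S := sin_gt_0 (PI * INR d / INR q)).
  assert (S1 : (0 < PI * INR d / INR q)%R) by (apply Rdiv_lt_0_compat; nra).
  assert (S2 : (PI * INR d / INR q < PI)%R) by (apply Rlt_div_l; nra).
  specialize (S S1 S2). nra.
Qed.

(** The discrete Fourier transform over Z/q. The frequency 0, whose root is 1, has coefficient equal
    to the mean of chi, which is zero. *)
Lemma character_Fourier q chi : dirichlet_character q chi -> nontrivial_character q chi ->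
  exists (N : nat) (al ze : nat -> C),
    (forall k, (k <= N)%nat -> Cmod (ze k) = 1%R /\ ze k <> 1) /\
    (forall n, chi n = csum N (fun k => al k * ze k ^ n)).
Proof.
  intros Hchi Hnt. assert (H0 := Hchi). destruct H0 as [Hq [Hper [Hmul [Hone Hzero]]]].
  destruct q as [|[|Q]]; [lia| |].
  (* Modulo 1 every character is constant, hence trivial. *)
  { exfalso. destruct Hnt as [n [_ Hn]]. apply Hn.
    assert (A : forall n, chi n = chi 0%nat).
    { induction n0 as [|k IH]; auto. rewrite <- IH, <- (Hper k). f_equal. lia. }
    rewrite A, <- (A 1%nat). auto. }
  set (q := S (S Q)) in *. set (w := unity_root q).
  assert (Wq : w ^ q = 1) by (apply unity_root_order; lia).
  assert (Wm : forall a k, w ^ (a + q * k) = w ^ a).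
  { intros a k. rewrite Cpow_add_r, Cpow_mult_r, Wq, Cpow_1_l. ring. }
  assert (Hq0 : RtoC (INR q) <> 0).
  { apply Cmod_gt_0. rewrite Cmod_RtoC_pos; [apply lt_0_INR; lia|apply pos_INR]. }
  (* w^(q-r) stands for w^-r with a natural exponent; r <= q - 1 in this sum, so the subtraction is
     exact. *)
  set (al := fun k => / RtoC (INR q) * csum (S Q) (fun r => chi r * (w ^ (q - r)) ^ k)).
  assert (Al0 : al 0%nat = 0).
  { unfold al. rewrite (csum_ext _ _ chi) by (intros; simpl; ring).
    rewrite (character_mean_zero (S Q) chi) by auto. ring. }
  assert (Small : forall n, (n < q)%nat -> chi n = csum (S Q) (fun k => al k * (w ^ k) ^ n)).
  { intros n Hn. unfold al.
    rewrite (csum_ext _ _ (fun k => / RtoC (INR q) * csum (S Q) (fun r => chi r * (w ^ (q - r + n)) ^ k))).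
    2:{ intros k _. rewrite <- Cmult_assoc. f_equal. rewrite (Cmult_comm _ ((w ^ k) ^ n)), <- csum_mult_l.
        apply csum_ext. intros r _. rewrite Cpow_add_r, Cpow_mult_l, <- !Cpow_mult_r.
        rewrite (Nat.mul_comm k n). ring. }
    rewrite csum_mult_l, csum_swap.
    (* Orthogonality: for r different from n, w^(q-r+n) is a q-th root of unity other than 1, and
       its powers sum to 0. *)
    rewrite (csum_single _ _ n); [|lia|].
    - rewrite (csum_ext _ _ (fun _ => chi n)).
      + rewrite csum_const. change (S (S Q)) with q. field. auto.
      + intros k _. replace (q - n + n)%nat with q by lia. rewrite Wq, Cpow_1_l. ring.
    - intros r Hr Hrn. rewrite csum_mult_l, csum_unity; [ring| |].
      + change (S (S Q)) with q. rewrite <- Cpow_mult_r, Nat.mul_comm, Cpow_mult_r, Wq, Cpow_1_l. auto.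
      + destruct (Nat.lt_ge_cases r n) as [L|L].
        * replace (q - r + n)%nat with (n - r + q * 1)%nat by lia. rewrite Wm. apply unity_root_primitive. lia.
        * apply unity_root_primitive. lia. }
  (* Shifting the index by one drops the frequency 0. *)
  exists Q, (fun k => al (S k)), (fun k => w ^ S k). split.
  - intros k Hk. split.
    + unfold w, unity_root. rewrite cexp_pow, Cmod_cexp, re_scal_l. simpl Re.
      rewrite <- exp_0. f_equal. simpl. ring.
    + apply unity_root_primitive. lia.
  - intros n. rewrite <- (periodic_mod chi q n) by auto.
    rewrite (Small (n mod q)%nat) by (apply Nat.mod_upper_bound; lia).
    rewrite csum_shift, Al0, Cmult_0_l, Cplus_0_l. apply csum_ext. intros k _. f_equal.
    rewrite <- !Cpow_mult_r. rewrite (Nat.div_mod_eq n q) at 2.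
    replace (S k * (q * (n / q) + n mod q))%nat with (S k * (n mod q) + q * (S k * (n / q)))%nat by ring.
    rewrite Wm. auto.
Qed.

(** * The binomial sums *)

Lemma C_n_0 n : Binomial.C n 0 = 1%R.
Proof. unfold Binomial.C. rewrite Nat.sub_0_r. simpl. field. apply INR_fact_neq_0. Qed.

Lemma C_n_n n : Binomial.C n n = 1%R.
Proof. unfold Binomial.C. rewrite Nat.sub_diag. simpl. field. apply INR_fact_neq_0. Qed.

Lemma csum_binomial m (z : C) : csum m (fun j => RtoC (Binomial.C m j) * z ^ j) = (1 + z) ^ m.
Proof.
  induction m as [|m IH]. { simpl. rewrite C_n_0. ring. }
  rewrite csum_shift, C_n_0, Cpow_S, <- IH.
  destruct m as [|m]. { simpl. rewrite !C_n_0, C_n_n. ring. }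
  cbn [csum]. rewrite (csum_ext m (fun i => RtoC (Binomial.C (S (S m)) (S i)) * z ^ S i)
     (fun i => z * (RtoC (Binomial.C (S m) i) * z ^ i) + RtoC (Binomial.C (S m) (S i)) * z ^ S i)).
  2:{ intros i Hi. rewrite <- pascal by lia. rewrite RtoC_plus, Cpow_S. ring. }
  rewrite csum_plus, csum_mult_l.
  assert (E := csum_shift m (fun j => RtoC (Binomial.C (S m) j) * z ^ j)).
  cbn [csum] in E. rewrite C_n_0 in E.
  rewrite !C_n_n in *. rewrite !Cpow_S in *. simpl (z ^ 0) in *.
  set (X := csum m (fun j => RtoC (Binomial.C (S m) j) * z ^ j)) in *.
  set (Y := csum m (fun i => RtoC (Binomial.C (S m) (S i)) * z ^ S i)) in *.
  replace Y with (X + 1 * (z * z ^ m) - 1 * 1). ring.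
  rewrite E. ring.
Qed.

(** Equivalent to (m + 1 - j) C(m+1, j) = (m + 1) C(m, j). It expresses multiplication by j + 1,
    that is s replaced by s - 1, through two consecutive rows. *)
Lemma binomial_absorb m j : (j <= m)%nat ->
  (INR (S j) * Binomial.C (S m) j = INR (S (S m)) * Binomial.C (S m) j - INR (S m) * Binomial.C m j)%R.
Proof.
  intros H. unfold Binomial.C. replace (S m - j)%nat with (S (m - j)) by lia.
  rewrite !fact_simpl, !mult_INR.
  assert (F1 := INR_fact_neq_0 j). assert (F2 := INR_fact_neq_0 (m - j)).
  assert (F3 : INR (S (m - j)) <> 0%R) by (apply not_0_INR; lia).
  assert (E : INR (S (m - j)) = (INR m - INR j + 1)%R) by (rewrite S_INR, minus_INR by lia; ring).
  rewrite E in *. rewrite !S_INR. field. auto.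
Qed.

Section InnerSum.
Variable chi : nat -> C.

(** Only the term 1^-s remains, which does not depend on s. This starts the recursion, which has no
    row before m = 0. *)
Lemma inner_sum_0 s : inner_sum chi (s - 1) 0 = inner_sum chi s 0.
Proof. unfold inner_sum; simpl. unfold cpow. rewrite ln_1, !Cmult_0_l. auto. Qed.

Lemma inner_sum_S m s : inner_sum chi (s - 1) (S m) =
  RtoC (INR (m + 2)) * inner_sum chi s (S m) - RtoC (INR (m + 1)) * inner_sum chi s m.
Proof.
  unfold inner_sum. cbn [csum].
  assert (Hp : forall j, cpow (INR (S j)) (- (s - 1)) = RtoC (INR (S j)) * cpow (INR (S j)) (- s)).
  { intros j. replace (- (s - 1)) with (- s + 1) by ring. apply cpow_plus1. apply lt_0_INR; lia. }
  rewrite (csum_ext m _ (fun j => RtoC (INR (m + 2)) * (chi (S j) * RtoC (Binomial.C (S m) j) * cpow (INR (S j)) (- s)) +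
     - RtoC (INR (m + 1)) * (chi (S j) * RtoC (Binomial.C m j) * cpow (INR (S j)) (- s)))).
  2:{ intros j Hj. rewrite Hp. assert (E := f_equal RtoC (binomial_absorb m j Hj)).
      rewrite RtoC_minus, !RtoC_mult in E.
      replace (m + 2)%nat with (S (S m)) by lia. replace (m + 1)%nat with (S m) by lia.
      transitivity (chi (S j) * cpow (INR (S j)) (- s) * (RtoC (INR (S j)) * RtoC (Binomial.C (S m) j))); [ring|].
      rewrite E. ring. }
  rewrite csum_plus, !csum_mult_l, C_n_n, Hp. replace (m + 2)%nat with (S (S m)) by lia. ring.
Qed.

Definition bker (m : nat) (x : R) : C :=
  csum m (fun j => chi (S j) * RtoC (Binomial.C m j) * expm (INR (S j) * x)).

Lemma bker_Mellin m s : (0 < Re s)%R -> Mellin (bker m) s = Gam s * inner_sum chi s m.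
Proof.
  intros Hs. unfold bker, inner_sum.
  rewrite (Mellin_csum m (fun j x => chi (S j) * RtoC (Binomial.C m j) * expm (INR (S j) * x))
     (fun j => Cmod (chi (S j) * RtoC (Binomial.C m j)) * 1)%R); auto.
  2:{ intros k. apply exp_bounded_mult_l. apply expm_scale_exp_bounded. }
  rewrite <- csum_mult_l. apply csum_ext. intros j _.
  rewrite (Mellin_mult_l _ _ 1), Mellin_expm_scale by (auto; apply expm_scale_exp_bounded). ring.
Qed.

Lemma bker_ccont m x : (0 < x)%R -> ccont (bker m) x.
Proof.
  intros Hx. unfold bker.
  apply (exp_bounded_csum m (fun j x => chi (S j) * RtoC (Binomial.C m j) * expm (INR (S j) * x))
     (fun j => Cmod (chi (S j) * RtoC (Binomial.C m j)) * 1)%R); auto.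
  intros k. apply exp_bounded_mult_l. apply expm_scale_exp_bounded.
Qed.

Variables (N : nat) (al ze : nat -> C).
Hypothesis Hze : forall k, (k <= N)%nat -> Cmod (ze k) = 1%R /\ ze k <> 1.
Hypothesis HF : forall n, chi n = csum N (fun k => al k * ze k ^ n).

Lemma bker_closed m x : bker m x =
  csum N (fun k => al k * (ze k * expm x) * (1 + ze k * expm x) ^ m).
Proof.
  unfold bker.
  rewrite (csum_ext m _ (fun j => csum N (fun k => al k * (ze k * expm x) * (RtoC (Binomial.C m j) * (ze k * expm x) ^ j)))).
  2:{ intros j _. rewrite HF, expm_INR, <- Cmult_assoc, Cmult_comm, <- csum_mult_l. apply csum_ext. intros k _.
      rewrite Cpow_mult_l, !Cpow_S. ring. }
  rewrite csum_swap. apply csum_ext. intros k _. rewrite csum_mult_l, csum_binomial. auto.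
Qed.

(** |1 + z|^2 = 2 + 2 Re z, and on the unit circle Re z = 1 only at z = 1. *)
Lemma one_plus_unit_lt_2 (z : C) : Cmod z = 1%R -> z <> 1 -> (Cmod (1 + z) < 2)%R.
Proof.
  intros H1 H2.
  assert (A := Cmod2_alt z). assert (B := Cmod2_alt (1 + z)). rewrite H1 in A.
  rewrite re_plus, im_plus in B. simpl (Re 1) in B. simpl (Im 1) in B.
  assert (Hr : (Re z < 1)%R).
  { destruct (Rlt_dec (Re z) 1) as [L|L]; auto. exfalso. apply H2.
    assert (Re z <= 1)%R by (rewrite <- H1; eapply Rle_trans; [apply Rle_abs|apply re_le_Cmod]).
    assert (Er : Re z = 1%R) by lra. rewrite Er in A. assert (Ei : Im z = 0%R) by nra.
    apply C_eq; simpl; auto. }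
  assert (P := Cmod_ge_0 (1 + z)). nra.
Qed.

(** A maximum over finitely many roots. Taking rho >= 1 makes rho^m nondecreasing and lets it
    dominate 1 as well as each |1 + z|. *)
Lemma unit_gap : exists rho, (1 <= rho < 2)%R /\ forall k, (k <= N)%nat -> (Cmod (1 + ze k) <= rho)%R.
Proof.
  assert (G : forall n, (n <= N)%nat -> exists rho, (1 <= rho < 2)%R /\ forall k, (k <= n)%nat -> (Cmod (1 + ze k) <= rho)%R).
  { induction n as [|n IH]; intros Hn.
    - exists (Rmax 1 (Cmod (1 + ze 0%nat))). assert (M1 := Rmax_l 1 (Cmod (1 + ze 0%nat))). split.
      + split; auto. apply Rmax_case; [lra|]. apply one_plus_unit_lt_2; apply Hze; lia.
      + intros k Hk. replace k with 0%nat by lia. apply Rmax_r.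
    - destruct IH as [rho [Hr Hk]]; [lia|].
      exists (Rmax rho (Cmod (1 + ze (S n)))). assert (M1 := Rmax_l rho (Cmod (1 + ze (S n)))). split.
      + split; [lra|]. apply Rmax_case; [lra|]. apply one_plus_unit_lt_2; apply Hze; lia.
      + intros k Hkn. destruct (Nat.eq_dec k (S n)) as [->|Hne]; [apply Rmax_r|].
        eapply Rle_trans; [apply Hk; lia|auto]. }
  apply (G N). lia.
Qed.

Lemma Cmod_csum_le n f (b : nat -> R) : (forall k, (k <= n)%nat -> (Cmod (f k) <= b k)%R) ->
  (Cmod (csum n f) <= sum_n b n)%R.
Proof.
  induction n as [|n IH]; intros H.
  - rewrite sum_O. apply H; lia.
  - rewrite sum_Sn. cbn [csum]. eapply Rle_trans; [apply Cmod_triangle|].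
    apply Rplus_le_compat; [apply IH; intros; apply H; lia|apply H; lia].
Qed.

Lemma bker_exp_bounded : exists rho K, (1 <= rho < 2)%R /\ (0 <= K)%R /\
  forall m, exp_bounded (bker m) (K * rho ^ m).
Proof.
  destruct unit_gap as [rho [Hr Hk]].
  exists rho, (sum_n (fun k => Cmod (al k)) N). split; auto.
  assert (HK : (0 <= sum_n (fun k => Cmod (al k)) N)%R).
  { eapply Rle_trans; [apply (Cmod_ge_0 (csum N al))|]. apply Cmod_csum_le. intros; lra. }
  split; auto. intros m. split; intros x Hx; [apply bker_ccont; auto|].
  rewrite bker_closed.
  replace (sum_n (fun k => Cmod (al k)) N * rho ^ m * exp (- x))%R with
    (sum_n (fun k => Cmod (al k) * (rho ^ m * exp (- x)))%R N).
  2:{ rewrite Rmult_assoc. apply (sum_n_mult_r (K:=R_Ring) (rho ^ m * exp (- x))%R (fun k => Cmod (al k))). }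
  apply Cmod_csum_le. intros k Hkn. destruct (Hze k Hkn) as [Z1 _]. specialize (Hk k Hkn).
  assert (P := exp_pos (- x)). assert (E : (exp (- x) <= 1)%R) by (apply exp_opp_le_1; lra).
  rewrite !Cmod_mult, Z1, Cmod_expm, Cmod_pow, Rmult_1_l.
  assert (Cv : (Cmod (1 + ze k * expm x) <= rho)%R).
  (* 1 + z e^-x is a convex combination of 1 and 1 + z, both of modulus at most rho. *)
  { unfold expm. replace (1 + ze k * RtoC (exp (- x))) with (RtoC (1 - exp (- x)) + RtoC (exp (- x)) * (1 + ze k)) by (rewrite RtoC_minus; ring).
    eapply Rle_trans; [apply Cmod_triangle|]. rewrite Cmod_mult, !Cmod_RtoC_pos by lra. nra. }
  rewrite Rmult_assoc. apply Rmult_le_compat_l; [apply Cmod_ge_0|]. rewrite Rmult_comm.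
  apply Rmult_le_compat_r; [lra|]. apply pow_incr. split; [apply Cmod_ge_0|auto].
Qed.

(** The bound on Re s > 0 comes from the Mellin transform. Each unit to the left costs one power of
    m + 1 by the recursion in s, whose earlier row is absorbed because rho >= 1. *)
Lemma inner_sum_bound rho K : (1 <= rho)%R -> (0 <= K)%R -> (forall m, exp_bounded (bker m) (K * rho ^ m)) ->
  forall s, exists B k, (0 <= B)%R /\ forall m, (Cmod (inner_sum chi s m) <= B * (INR (m + 1) ^ k * rho ^ m))%R.
Proof.
  intros Hr HK Hb.
  assert (Ind : forall n s, (- INR n < Re s)%R -> exists B k, (0 <= B)%R /\
    forall m, (Cmod (inner_sum chi s m) <= B * (INR (m + 1) ^ k * rho ^ m))%R).
  { induction n as [|n IH]; intros s Hs.
    - simpl in Hs. assert (Hs' : (0 < Re s)%R) by lra.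
      assert (G1 := proj1 (Cmod_gt_0 _) (Gam_neq_0 _ Hs')). set (g := Cmod (Gam s)) in *.
      assert (Mp := mconst_pos _ Hs').
      exists (K * (2 * mconst (Re s)) / g)%R, 0%nat. split.
      { apply Rmult_le_pos; [nra|]. left; apply Rinv_0_lt_compat; auto. }
      intros m. assert (E := f_equal Cmod (bker_Mellin m s Hs')). rewrite Cmod_mult in E. fold g in E.
      assert (Bd := Mellin_bound _ _ _ (Hb m) Hs'). rewrite E in Bd.
      apply Rmult_le_reg_l with g; auto. eapply Rle_trans; [exact Bd|]. right. simpl. field. lra.
    - destruct (IH (s + 1)) as [B [k [HB Hk]]]. { rewrite re_plus, S_INR in *. simpl. lra. }
      exists (2 * B)%R, (S k). split; [lra|]. intros m.
      replace s with (s + 1 - 1) by ring. destruct m as [|m].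
      + rewrite inner_sum_0. specialize (Hk 0%nat). simpl in *. rewrite pow1 in *. lra.
      + rewrite inner_sum_S. eapply Rle_trans; [apply Cmod_minus_le|]. rewrite !Cmod_mult, !Cmod_RtoC_pos by apply pos_INR.
        assert (B1 := Hk (S m)). assert (B2 := Hk m).
        replace (S m + 1)%nat with (m + 2)%nat in * by lia.
        assert (I1 : (INR (m + 1) <= INR (m + 2))%R) by (apply le_INR; lia).
        assert (I0 := pos_INR (m + 1)).
        assert (Q : (INR (m + 1) ^ k * rho ^ m <= INR (m + 2) ^ k * rho ^ S m)%R).
        { apply Rmult_le_compat; try (apply pow_le; lra).
          - apply pow_incr; lra.
          - simpl. assert (0 <= rho ^ m)%R by (apply pow_le; lra). nra. }
        set (X := (INR (m + 2) ^ k * rho ^ S m)%R) in *.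
        replace (2 * B * (INR (m + 2) ^ S k * rho ^ S m))%R with (INR (m + 2) * (B * X) + INR (m + 2) * (B * X))%R by (unfold X; simpl; ring).
        assert (B * (INR (m + 1) ^ k * rho ^ m) <= B * X)%R by (apply Rmult_le_compat_l; auto).
        assert (C1 := Cmod_ge_0 (inner_sum chi (s + 1) m)).
        apply Rplus_le_compat; [apply Rmult_le_compat_l; lra|]. apply Rmult_le_compat; auto; lra. }
  intros s. destruct (INR_unbounded (- Re s)) as [n Hn]. apply (Ind n). lra.
Qed.

End InnerSum.

(** * Summation of the double series *)

(** Summation by parts leaves a boundary term only at the upper end; at the lower end [inner_sum_0]
    removes it. *)
Lemma csum_coef_shift eta chi s0 s N :
  csum N (fun m => coef eta m (s0 - 1) * inner_sum chi s m) =
  csum N (fun m => coef eta m s0 * inner_sum chi (s - 1) m)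
  - RtoC (INR (N + 1)) * coef eta (S N) s0 * inner_sum chi s N.
Proof.
  induction N as [|N IH].
  - cbn [csum]. rewrite coef_shift, inner_sum_0. simpl. ring.
  - cbn [csum]. rewrite IH, coef_shift, inner_sum_S.
    replace (S N + 1)%nat with (N + 2)%nat by lia. ring.
Qed.

(** A telescoping series, used as the majorant of the sum of n^-2 through 1/t^2 <= 2 / (t (t+1)). *)
Lemma ex_series_inv_sqr : ex_series (fun n => / INR (S n) - / INR (S (S n)))%R.
Proof.
  exists 1%R.
  change (is_lim_seq (sum_n (fun n => / INR (S n) - / INR (S (S n)))%R) 1%R).
  apply (is_lim_seq_ext (fun n => 1 - / INR (S (S n)))%R).
  - induction n as [|n IH]. { rewrite sum_O. simpl. field. }
    rewrite sum_Sn, <- IH. change plus with Rplus. ring.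
  - replace (Finite 1) with (Finite (1 - 0)) by (f_equal; ring).
    apply is_lim_seq_minus'; [apply is_lim_seq_const|].
    apply (is_lim_seq_incr_1 (fun n => / INR (S n))%R 0), (is_lim_seq_incr_1 (fun n => / INR n)%R 0).
    evar_last. { apply is_lim_seq_inv; [apply is_lim_seq_INR|discriminate]. } reflexivity.
Qed.

Lemma ex_series_Rpower sg : (2 <= sg)%R -> ex_series (fun n => Rpower (INR (S n)) (- sg)).
Proof.
  intros H. apply (@ex_series_le R_AbsRing R_CompleteNormedModule) with (fun n => 2 * (/ INR (S n) - / INR (S (S n))))%R.
  - intros n. change (Rabs (Rpower (INR (S n)) (- sg)) <= 2 * (/ INR (S n) - / INR (S (S n))))%R.
    rewrite Rabs_pos_eq by (left; apply Rpower_pos).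
    rewrite (S_INR (S n)). assert (P : (1 <= INR (S n))%R) by (rewrite S_INR; assert (Q := pos_INR n); lra).
    set (t := INR (S n)) in *.
    apply Rle_trans with (/ (t * t))%R.
    + rewrite Rpower_Ropp. apply Rinv_le_contravar; [nra|].
      replace (t * t)%R with (Rpower t 2).
      * apply Rle_Rpower; auto.
      * replace 2%R with (1 + 1)%R by ring. rewrite Rpower_plus, Rpower_1; lra.
    + replace (2 * (/ t - / (t + 1)))%R with (2 * / (t * (t + 1)))%R by (field; lra).
      apply Rmult_le_reg_r with (t * t * (t + 1))%R; [repeat apply Rmult_lt_0_compat; lra|].
      replace (/ (t * t) * (t * t * (t + 1)))%R with (t + 1)%R by (field; lra).
      replace (2 * / (t * (t + 1)) * (t * t * (t + 1)))%R with (2 * t)%R by (field; lra). lra.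
  - apply (ex_series_scal_l 2 (fun n => / INR (S n) - / INR (S (S n)))%R). apply ex_series_inv_sqr.
Qed.

Section Summation.

Variables (chi : nat -> C) (eta L : C -> C).
Hypothesis Heta : is_eta_function eta.
Hypothesis HL : is_L_function chi L.
Variables (N : nat) (al ze : nat -> C).
Hypothesis Hze : forall k, (k <= N)%nat -> Cmod (ze k) = 1%R /\ ze k <> 1.
Hypothesis HF : forall n, chi n = csum N (fun k => al k * ze k ^ n).
Variables (rho K : R).
Hypothesis Hrho : (1 <= rho < 2)%R.
Hypothesis HK : (0 <= K)%R.
Hypothesis Hker : forall m, exp_bounded (bker chi m) (K * rho ^ m).

Let term s0 s m := coef eta m s0 * inner_sum chi s m.

(** The product of both bounds is a power of n + 1 times (rho/2)^n, and rho < 2. *)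
Lemma boundary_term_vanish s0 s eps : (0 < eps)%R -> exists M, forall n, (M <= n)%nat ->
  (Cmod (RtoC (INR (n + 1)) * coef eta (S n) s0 * inner_sum chi s n) < eps)%R.
Proof.
  intros He. destruct (coef_bound eta Heta s0) as [A [a [HA Ha]]].
  destruct (inner_sum_bound chi rho K ltac:(lra) HK Hker s) as [B [b [HB Hb]]].
  set (T := (A * B * 2 ^ a + 1)%R).
  assert (P2 : (0 < 2 ^ a)%R) by (apply pow_lt; lra).
  assert (HT : (0 < T)%R). { unfold T. assert (0 <= A * B * 2 ^ a)%R by (repeat apply Rmult_le_pos; lra). lra. }
  destruct (poly_geom_small (S a + b) (rho / 2) (eps / T)) as [M HM]; [lra|apply Rdiv_lt_0_compat; auto|].
  exists M. intros n Hn. specialize (HM n Hn). rewrite !Cmod_mult, Cmod_RtoC_pos by apply pos_INR.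
  specialize (Ha (S n)). specialize (Hb n).
  set (t := INR (n + 1)) in *. assert (Ht : (1 <= t)%R) by (unfold t; rewrite plus_INR; simpl; assert (Q := pos_INR n); lra).
  assert (Ha2 : (Cmod (coef eta (S n) s0) <= A * (2 ^ a * (t ^ a * (/ 2) ^ n)))%R).
  { eapply Rle_trans; [exact Ha|]. apply Rmult_le_compat_l; auto.
    assert (Q1 : (INR (S n + 1) ^ a <= 2 ^ a * t ^ a)%R).
    { rewrite <- Rpow_mult_distr. apply pow_incr. split; [apply pos_INR|].
      replace (S n + 1)%nat with (S (n + 1)) by lia. rewrite S_INR. fold t. lra. }
    assert (Q2 : (0 <= (/ 2) ^ n)%R) by (apply pow_le; lra). simpl ((/ 2) ^ S n)%R.
    assert (Q3 : (0 <= INR (S n + 1) ^ a)%R) by (apply pow_le, pos_INR). nra. }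
  apply Rle_lt_trans with (T * (t ^ (S a + b) * (rho / 2) ^ n))%R.
  2:{ apply Rlt_div_r in HM; auto. lra. }
  apply Rle_trans with (t * (A * (2 ^ a * (t ^ a * (/ 2) ^ n))) * (B * (t ^ b * rho ^ n)))%R.
  - apply Rmult_le_compat; auto; [apply Rmult_le_pos; [lra|apply Cmod_ge_0]|apply Cmod_ge_0|].
    apply Rmult_le_compat_l; [lra|auto].
  - replace (t * (A * (2 ^ a * (t ^ a * (/ 2) ^ n))) * (B * (t ^ b * rho ^ n)))%R with
      ((A * B * 2 ^ a) * (t ^ (S a + b) * (rho / 2) ^ n))%R.
    + apply Rmult_le_compat_r; [|unfold T; lra]. apply Rmult_le_pos; apply pow_le; lra.
    + unfold Rdiv. rewrite Rpow_mult_distr, pow_add. simpl. ring.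
Qed.

Lemma Cser_term_shift s0 s l : Cser (term (s0 - 1) s) l <-> Cser (term s0 (s - 1)) l.
Proof.
  assert (E := csum_coef_shift eta chi s0 s).
  split; intros H eps He; destruct (H (eps / 2)%R ltac:(lra)) as [n1 H1];
  destruct (boundary_term_vanish s0 s (eps / 2) ltac:(lra)) as [n2 H2];
  exists (n1 + n2)%nat; intros n Hn; specialize (H1 n ltac:(lia)); specialize (H2 n ltac:(lia));
  specialize (E n); unfold term in *; set (X := RtoC (INR (n + 1)) * coef eta (S n) s0 * inner_sum chi s n) in *.
  - replace (csum n (fun m => coef eta m s0 * inner_sum chi (s - 1) m) - l) with
      ((csum n (fun m => coef eta m (s0 - 1) * inner_sum chi s m) - l) + X) by (rewrite E; ring).
    eapply Rle_lt_trans; [apply Cmod_triangle|]. lra.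
  - rewrite E. replace (csum n (fun m => coef eta m s0 * inner_sum chi (s - 1) m) - X - l) with
      ((csum n (fun m => coef eta m s0 * inner_sum chi (s - 1) m) - l) - X) by ring.
    eapply Rle_lt_trans; [apply Cmod_minus_le|]. lra.
Qed.

Lemma Cser_term_shift_nat k s0 s l :
  Cser (term s0 s) l <-> Cser (term (s0 + RtoC (INR k)) (s - RtoC (INR k))) l.
Proof.
  induction k as [|k IH].
  - simpl. replace (s0 + 0) with s0 by ring. replace (s - 0) with s by ring. tauto.
  - rewrite IH. rewrite RtoC_INR_S.
    replace (s0 + RtoC (INR k)) with (s0 + (RtoC (INR k) + 1) - 1) by ring.
    rewrite Cser_term_shift.
    replace (s - RtoC (INR k) - 1) with (s - (RtoC (INR k) + 1)) by ring. tauto.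
Qed.

Lemma ex_series_coef_ker s0 : ex_series (fun m => Cmod (coef eta m s0) * (K * rho ^ m))%R.
Proof.
  destruct (coef_bound eta Heta s0) as [A [a [HA Ha]]].
  apply (@ex_series_le R_AbsRing R_CompleteNormedModule) with (fun m => A * K * (INR (m + 1) ^ a * (rho / 2) ^ m))%R.
  - intros m. specialize (Ha m).
    assert (P : (0 <= K * rho ^ m)%R) by (apply Rmult_le_pos; auto; apply pow_le; lra).
    change (Rabs (Cmod (coef eta m s0) * (K * rho ^ m)) <= A * K * (INR (m + 1) ^ a * (rho / 2) ^ m))%R.
    rewrite Rabs_pos_eq by (apply Rmult_le_pos; auto; apply Cmod_ge_0).
    replace (A * K * (INR (m + 1) ^ a * (rho / 2) ^ m))%R with (A * (INR (m + 1) ^ a * (/ 2) ^ m) * (K * rho ^ m))%R.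
    + apply Rmult_le_compat_r; auto.
    + unfold Rdiv. rewrite Rpow_mult_distr. ring.
  - apply (ex_series_scal_l (A * K)%R (fun m => INR (m + 1) ^ a * (rho / 2) ^ m)%R). apply ex_series_poly_geom. lra.
Qed.

(* Multiplied by Gamma(s), the double series is a Mellin transform in s, hence holomorphic for Re s > 0. *)
Lemma term_series_Mellin s0 : exists Psi B, exp_bounded Psi B /\
  (forall x, (0 < x)%R -> Cser (fun m => coef eta m s0 * bker chi m x) (Psi x)) /\
  (forall s, (0 < Re s)%R -> Cser (term s0 s) (Mellin Psi s / Gam s)).
Proof.
  set (phi := fun m x => coef eta m s0 * bker chi m x).
  assert (Hphi : forall m, exp_bounded (phi m) (Cmod (coef eta m s0) * (K * rho ^ m))).
  { intros m. apply exp_bounded_mult_l. apply Hker. }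
  destruct (Mellin_series_ex phi _ Hphi (ex_series_coef_ker s0)) as [Psi HPsi].
  destruct (Mellin_series phi Psi _ Hphi (ex_series_coef_ker s0) HPsi) as [HB HM].
  exists Psi, (Series (fun m => Cmod (coef eta m s0) * (K * rho ^ m))%R). split; [|split]; auto.
  intros s Hs. apply Cser_div_nz; [apply Gam_neq_0; auto|].
  apply Cser_ext with (2 := HM s Hs). intros m. unfold phi, term.
  rewrite (Mellin_mult_l _ _ _ _ (Hker m) Hs), bker_Mellin by auto. ring.
Qed.

Lemma chi_bounded n : (Cmod (chi n) <= sum_n (fun k => Cmod (al k)) N)%R.
Proof.
  rewrite HF. apply Cmod_csum_le. intros k Hk. destruct (Hze k Hk) as [Z _].
  rewrite Cmod_mult, Cmod_pow, Z, pow1. lra.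
Qed.

(** [coef_generating] at v = z e^-x, for each root z, identifies Psi(x) with the sum of chi(n) n^-s0
    e^(-n x). Since Re s0 >= 2 the coefficients are absolutely summable, so the Mellin transform may
    be taken term by term and gives Gamma(s) L(s + s0). *)
Lemma term_series_convergent_region s0 s : (2 <= Re s0)%R -> (0 < Re s)%R -> Cser (term s0 s) (L (s + s0)).
Proof.
  intros Hs0 Hs. destruct (term_series_Mellin s0) as [Psi [B [HB [HPsi HM]]]].
  specialize (HM s Hs). assert (G0 := Gam_neq_0 s Hs).
  set (psi := fun n x => chi (S n) * cpow (INR (S n)) (- s0) * expm (INR (S n) * x)).
  set (A := sum_n (fun k => Cmod (al k)) N).
  assert (Hpsi : forall n, exp_bounded (psi n) (A * Rpower (INR (S n)) (- Re s0))).
  { intros n. apply exp_bounded_le with (Cmod (chi (S n) * cpow (INR (S n)) (- s0)) * 1)%R.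
    - rewrite Rmult_1_r, Cmod_mult, Cmod_cpow, re_opp. apply Rmult_le_compat_r; [left; apply Rpower_pos|apply chi_bounded].
    - apply exp_bounded_mult_l. apply expm_scale_exp_bounded. }
  assert (HS : ex_series (fun n => A * Rpower (INR (S n)) (- Re s0))%R).
  { apply (ex_series_scal_l A (fun n => Rpower (INR (S n)) (- Re s0))). apply ex_series_Rpower; auto. }
  assert (Hsum : forall x, (0 < x)%R -> Cser (fun n => psi n x) (Psi x)).
  { intros x Hx.
    assert (Hv : forall k, (k <= N)%nat -> (Cmod (ze k * expm x) < 1)%R).
    { intros k Hk. destruct (Hze k Hk) as [Z _]. rewrite Cmod_mult, Z, Cmod_expm, Rmult_1_l.
      rewrite <- exp_0. apply exp_increasing. lra. }
    (* The sums for all roots are chosen at once, so that the two expansions of Psi are compared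
       with the same values [P k]. *)
    assert (HP : exists P, forall k, (k <= N)%nat -> Cser (fun m => coef eta m s0 * (1 + ze k * expm x) ^ m) (P k) /\
       Cser (fun n => cpow (INR (S n)) (- s0) * (ze k * expm x) ^ n) (P k)).
    { exists (fun k => epsilon (inhabits (RtoC 0)) (fun P => Cser (fun m => coef eta m s0 * (1 + ze k * expm x) ^ m) P /\
       Cser (fun n => cpow (INR (S n)) (- s0) * (ze k * expm x) ^ n) P)).
      intros k Hk. apply (epsilon_spec (inhabits (RtoC 0)) (fun P => Cser (fun m => coef eta m s0 * (1 + ze k * expm x) ^ m) P /\
       Cser (fun n => cpow (INR (S n)) (- s0) * (ze k * expm x) ^ n) P)).
      apply coef_generating; auto. lra. }
    destruct HP as [P HP].
    assert (S1 := Cser_csum N (fun k m => al k * (ze k * expm x) * (coef eta m s0 * (1 + ze k * expm x) ^ m))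
      (fun k => al k * (ze k * expm x) * P k)).
    assert (S2 := Cser_csum N (fun k n => al k * (ze k * expm x) * (cpow (INR (S n)) (- s0) * (ze k * expm x) ^ n))
      (fun k => al k * (ze k * expm x) * P k)).
    specialize (S1 (fun k Hk => Cser_mult_l _ _ _ (proj1 (HP k Hk)))).
    specialize (S2 (fun k Hk => Cser_mult_l _ _ _ (proj2 (HP k Hk)))).
    assert (E : Psi x = csum N (fun k => al k * (ze k * expm x) * P k)).
    { apply (Cser_unique _ _ _ (HPsi x Hx)). apply Cser_ext with (2 := S1). intros m. cbv beta.
      rewrite (bker_closed chi N al ze HF), <- csum_mult_l. apply csum_ext. intros k _. ring. }
    rewrite E. apply Cser_ext with (2 := S2). intros n. unfold psi. rewrite HF, expm_INR.
    rewrite <- Cmult_assoc, Cmult_comm, <- csum_mult_l. apply csum_ext. intros k _.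
    rewrite Cpow_mult_l, !Cpow_S. ring. }
  destruct (Mellin_series psi Psi _ Hpsi HS Hsum) as [_ HM2]. specialize (HM2 s Hs).
  assert (Hser : Cser (fun n => chi (S n) * cpow (INR (S n)) (- (s + s0))) (L (s + s0))).
  { apply Cser_is_series. apply (proj2 HL). rewrite re_plus. lra. }
  assert (E : Mellin Psi s = Gam s * L (s + s0)).
  { apply (Cser_unique _ _ _ HM2). apply Cser_ext with (2 := Cser_mult_l (Gam s) _ _ Hser).
    intros n. unfold psi. cbv beta. rewrite (Mellin_mult_l _ _ _ _ (expm_scale_exp_bounded n) Hs), Mellin_expm_scale by auto.
    replace (- (s + s0)) with (- s + - s0) by ring. rewrite cpow_plus. ring. }
  rewrite E in HM. replace (L (s + s0)) with (Gam s * L (s + s0) / Gam s) by (field; auto). auto.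
Qed.

Lemma term_series_right_half s0 s : (0 < Re s)%R -> Cser (term s0 s) (L (s + s0)).
Proof.
  intros Hs. destruct (term_series_Mellin s0) as [Psi [B [HB [_ HM]]]].
  assert (E : forall s, (0 < Re s)%R -> Gam s * L (s0 + s) = Mellin Psi s).
  (* For Re w > k the shifted pair (s0 + k, w - k) lies in the region already treated, since Re s0 +
     k > 2. The identity theorem then descends to Re w > 0. *)
  { destruct (INR_unbounded (2 - Re s0)) as [k Hk].
    apply half_plane_identity with (INR k).
    - intros w Hw. destruct (Mellin_Cdiff expm 1 w expm_exp_bounded Hw) as [l Hl].
      destruct (entire_Cdiff L (proj1 HL) (s0 + w)) as [l' Hl'].
      eexists. apply (Cdiff_mult Gam (fun w => L (s0 + w))); [exact Hl|]. apply Cdiff_translate. exact Hl'.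
    - intros w Hw. apply (Mellin_Cdiff Psi B w HB Hw).
    - intros w Hw. assert (Pk := pos_INR k). assert (Hw0 : (0 < Re w)%R) by lra.
      assert (R1 : Cser (term s0 w) (L (w + s0))).
      { apply (Cser_term_shift_nat k).
        replace (w + s0) with (w - RtoC (INR k) + (s0 + RtoC (INR k))) by ring.
        apply term_series_convergent_region.
        - rewrite re_plus, re_RtoC. lra.
        - unfold Cminus. rewrite re_plus, re_opp, re_RtoC. lra. }
      assert (E := Cser_unique _ _ _ R1 (HM w Hw0)). rewrite Cplus_comm, E. field. apply Gam_neq_0; auto. }
  specialize (HM s Hs). rewrite <- E in HM by auto. rewrite (Cplus_comm s s0).
  replace (L (s0 + s)) with (Gam s * L (s0 + s) / Gam s) by (field; apply Gam_neq_0; auto). auto.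
Qed.

(** The opposite shift: for k > -Re s the pair (s0 - k, s + k) is covered by the right half-plane
    case, which holds for every first argument. *)
Lemma term_series s0 s : Cser (term s0 s) (L (s + s0)).
Proof.
  destruct (INR_unbounded (- Re s)) as [k Hk].
  replace s0 with (s0 - RtoC (INR k) + RtoC (INR k)) at 1 by ring.
  replace s with (s + RtoC (INR k) - RtoC (INR k)) at 1 by ring.
  apply Cser_term_shift_nat.
  replace (s + s0) with (s + RtoC (INR k) + (s0 - RtoC (INR k))) by ring.
  apply term_series_right_half. rewrite re_plus, re_RtoC. lra.
Qed.

End Summation.

Theorem theorem6 (q : nat) (chi : nat -> C) (L eta : C -> C)
  (Hchi : dirichlet_character q chi) (Hnt : nontrivial_character q chi)
  (HL : is_L_function chi L) (Heta : is_eta_function eta) :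
  (forall s0 s : C, (-1 < Re s0)%R ->
     exists (G : C) (I : nat -> C) (S : C),
       is_Gamma (s0 + 1) G /\
       (forall m : nat,
          is_RInt_gen
            (fun x : R => cpow x s0 * RtoC (exp (- x * INR (m + 1)))%R
                          / RtoC ((1 + exp (- x)) ^ (m + 2))%R)
            (at_right 0) (Rbar_locally p_infty) (I m)) /\
       is_series (fun m : nat => RtoC (INR (m + 1)) * I m * inner_sum chi s m) S /\
       L (s + s0) = S / G)
  /\
  (forall s0 s : C,
     is_series
       (fun m : nat =>
          RtoC ((-1) ^ m / INR (fact m))%R *
          csum1 (m + 1) (fun l => RtoC (IZR (stirling1 (m + 1) l)) *
                                  eta (s0 + 1 - RtoC (INR l))) *
          inner_sum chi s m)
       (L (s + s0))).
Proof.
  destruct (character_Fourier q chi Hchi Hnt) as [N [al [ze [Hze HF]]]].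
  destruct (bker_exp_bounded chi N al ze Hze HF) as [rho [K [Hrho [HK Hker]]]].
  assert (Main := term_series chi eta L Heta HL N al ze Hze HF rho K Hrho HK Hker).
  split.
  - intros s0 s Hs0. assert (Hs1 : (0 < Re (s0 + 1))%R) by (rewrite re_plus; simpl; lra).
    assert (G0 := Gam_neq_0 _ Hs1).
    (* By [coef_Mellin], the first series is the second one multiplied termwise by Gamma(s0 + 1),
       which gives its sum. *)
    exists (Gam (s0 + 1)), (fun m => Mellin (kernC m) (s0 + 1)), (Gam (s0 + 1) * L (s + s0)).
    split; [apply Gam_is_Gamma; auto|]. split; [|split].
    + intros m. assert (H := Mellin_correct _ _ _ (kernC_exp_bounded m) Hs1).
      apply (IInt_ext _ (fun x : R => cpow x s0 * RtoC (exp (- x * INR (m + 1)))%R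
                          / RtoC ((1 + exp (- x)) ^ (m + 2))%R)) in H.
      * exact (IInt_is_RInt_gen _ _ H).
      * intros x Hx. unfold kernC. rewrite kern_quotient. replace (s0 + 1 - 1) with s0 by ring. unfold Cdiv. ring.
    + assert (H := Cser_mult_l (Gam (s0 + 1)) _ _ (Main s0 s)).
      assert (H2 : Cser (fun m => RtoC (INR (m + 1)) * Mellin (kernC m) (s0 + 1) * inner_sum chi s m) (Gam (s0 + 1) * L (s + s0))).
      { apply Cser_ext with (2 := H). intros m. cbv beta. rewrite Cmult_assoc, (coef_Mellin eta Heta) by auto. ring. }
      exact (proj1 (Cser_is_series _ _) H2).
    + field. auto.
  - intros s0 s. exact (proj1 (Cser_is_series _ _) (Main s0 s)).
Qed.
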